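(* Let $\Gamma\subset\mathbb{R}^2$ be a lattice, let $T^2=\mathbb{R}^2/\Gamma$ be the torus with its flat metric $g_o$, and let $(M^2,g)$ be a two-dimensional Riemannian manifold conformally equivalent to $(T^2,g_o)$, i.e. $M^2 = T^2$ and $g = h^4 g_o$ with $h : T^2\to\mathbb{R}$ a smooth positive function. Equip $M^2$ with the trivial spin structure. Then the Dirac operator $D$ on $(M^2,g)$ has a two-dimensional (complex) kernel. Moreover, the first positive eigenvalue $\lambda_1^2(g)$ of $D^2$ on $(M^2,g)$ is bounded by $$\lambda_1^2(g) \le \frac{\displaystyle\int_{T^2} \left\{ \lambda_1^2(g_o) + \frac{4}{h^2}\, |\mathrm{grad}(h)|^2 \right\} \frac{1}{h^6}\, dT^2}{\displaystyle\int_{T^2} \frac{1}{h^2}\, dT^2}.$$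
   Context: The spin structures of $T^2=\mathbb{R}^2/\Gamma$ are described, relative to a basis $v_1,v_2$ of $\Gamma$, by pairs $(\varepsilon_1,\varepsilon_2)$ with $\varepsilon_i\in\{0,1\}$: spinor fields on the flat torus for $(\varepsilon_1,\varepsilon_2)$ correspond to functions $\psi:\mathbb{R}^2\to\mathbb{C}^2$ with $\psi(x+v_j) = (-1)^{\varepsilon_j}\psi(x)$. The trivial spin structure is $(0,0)$. $\lambda_1^2(g_o)$ denotes the first positive eigenvalue of the square of the Dirac operator of the flat torus $(T^2,g_o)$ with the trivial spin structure. The gradient, its norm and the area element $dT^2$ are taken with respect to the flat metric $g_o$. *)

(* Defs.v *)
(* Stdlib reals + Coquelicot.

   Objects on the torus R^2/Gamma, Gamma = Z v1 + Z v2, are represented by their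
   lifts to R^2.  Tensor fields are given by components in the coordinate frame
   d/dx, d/dy; spinor fields are given by components in the trivialisation of the
   spinor bundle induced by a global oriented orthonormal frame that is
   Gamma-periodic.  A section for the spin structure (eps1, eps2) is then a
   function R^2 -> C^2 picking up the sign (-1)^eps_j under translation by v_j. *)
From Stdlib Require Import Reals Lra.
From Coquelicot Require Import Coquelicot.

Open Scope R_scope.

Inductive axis := ax1 | ax2.

Definition axis_eqb (i j : axis) : bool :=
  match i, j with ax1, ax1 | ax2, ax2 => true | _, _ => false end.

Definition sum_axis (f : axis -> R) : R := f ax1 + f ax2.

Definition sfield := R -> R -> R.

Definition smooth (f : sfield) : Prop := forall n x y, ex_diff_n f n x y.

Definition partial (i : axis) (f : sfield) : sfield :=
  fun x y =>
    match i with
    | ax1 => Derive (fun u => f u y) x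
    | ax2 => Derive (fun v => f x v) y
    end.

Definition det2 (v1 v2 : R * R) : R := fst v1 * snd v2 - snd v1 * fst v2.

Definition shift {T : Type} (v : R * R) (f : R -> R -> T) : R -> R -> T :=
  fun x y => f (x + fst v) (y + snd v).

Definition periodic (v1 v2 : R * R) (f : sfield) : Prop :=
  forall x y, shift v1 f x y = f x y /\ shift v2 f x y = f x y.

(* Integral over T^2 for the flat area element, computed on the fundamental
   parallelogram { s v1 + t v2 | 0 <= s, t <= 1 }. *)
Definition torus_int (v1 v2 : R * R) (f : sfield) : R :=
  Rabs (det2 v1 v2) *
  RInt (fun s => RInt (fun t =>
      f (s * fst v1 + t * fst v2) (s * snd v1 + t * snd v2)) 0 1) 0 1.

Definition flat_grad_sq (h : sfield) : sfield :=
  fun x y => sum_axis (fun i => partial i h x y ^ 2).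

Definition vfield := axis -> sfield.

Definition metric := axis -> axis -> sfield.

Definition inner (g : metric) (X Y : vfield) : sfield :=
  fun x y => sum_axis (fun i => sum_axis (fun j => g i j x y * X i x y * Y j x y)).

Definition metric_det (g : metric) : sfield :=
  fun x y => g ax1 ax1 x y * g ax2 ax2 x y - g ax1 ax2 x y * g ax2 ax1 x y.

Definition inv_metric (g : metric) : metric :=
  fun i j x y =>
    match i, j with
    | ax1, ax1 => g ax2 ax2 x y / metric_det g x y
    | ax2, ax2 => g ax1 ax1 x y / metric_det g x y
    | _, _ => - g i j x y / metric_det g x y
    end.

(* christoffel g k i j is Gamma^k_{ij}. *)
Definition christoffel (g : metric) (k i j : axis) : sfield :=
  fun x y => / 2 * sum_axis (fun l =>
    inv_metric g k l x y *
    (partial i (g j l) x y + partial j (g i l) x y - partial l (g i j) x y)).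

Definition levi_civita (g : metric) (X Y : vfield) : vfield :=
  fun k x y => sum_axis (fun i => X i x y *
    (partial i (Y k) x y + sum_axis (fun j => christoffel g k i j x y * Y j x y))).

Definition orthonormal_frame (g : metric) (e : axis -> vfield) : Prop :=
  forall a b x y, inner g (e a) (e b) x y = if axis_eqb a b then 1 else 0.

Definition spinor := (C * C)%type.

Definition sp_zero : spinor := (RtoC 0, RtoC 0).

Definition sp_plus (s t : spinor) : spinor :=
  (Cplus (fst s) (fst t), Cplus (snd s) (snd t)).

Definition sp_scal (c : C) (s : spinor) : spinor :=
  (Cmult c (fst s), Cmult c (snd s)).

(* Clifford multiplication by the a-th vector of the orthonormal frame, for the
   convention e_a e_b + e_b e_a = -2 delta_ab: the matrices are
   [[0, i], [i, 0]] and [[0, -1], [1, 0]]. *)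
Definition clifford (a : axis) (s : spinor) : spinor :=
  match a with
  | ax1 => (Cmult Ci (snd s), Cmult Ci (fst s))
  | ax2 => (Copp (snd s), fst s)
  end.

Lemma clifford_relation (a b : axis) (s : spinor) :
  sp_plus (clifford a (clifford b s)) (clifford b (clifford a s)) =
  sp_scal (if axis_eqb a b then RtoC (- 2) else RtoC 0) s.
Proof.
destruct s as [[p q] [r t]], a, b;
  unfold sp_plus, sp_scal, clifford, Cplus, Cmult, Copp, Ci, RtoC; simpl;
  (apply injective_projections; apply injective_projections; simpl; ring).
Qed.

Definition spfield := R -> R -> spinor.

Definition Cpartial (i : axis) (f : R -> R -> C) : R -> R -> C :=
  fun x y => (partial i (fun u v => fst (f u v)) x y,
              partial i (fun u v => snd (f u v)) x y).

Definition Csmooth (f : R -> R -> C) : Prop :=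
  smooth (fun x y => fst (f x y)) /\ smooth (fun x y => snd (f x y)).

Definition sp_partial (i : axis) (psi : spfield) : spfield :=
  fun x y => (Cpartial i (fun u v => fst (psi u v)) x y,
              Cpartial i (fun u v => snd (psi u v)) x y).

Definition sp_smooth (psi : spfield) : Prop :=
  Csmooth (fun x y => fst (psi x y)) /\ Csmooth (fun x y => snd (psi x y)).

(* The booleans eps1, eps2 stand for 0 (false) or 1 (true). *)
Definition spin_sign (eps : bool) : C := if eps then RtoC (- 1) else RtoC 1.

(* Smooth sections of the spinor bundle for the spin structure (eps1, eps2). *)
Definition spinor_section (v1 v2 : R * R) (eps1 eps2 : bool) (psi : spfield) : Prop :=
  sp_smooth psi /\
  forall x y, shift v1 psi x y = sp_scal (spin_sign eps1) (psi x y) /\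
              shift v2 psi x y = sp_scal (spin_sign eps2) (psi x y).

Definition trivial_section (v1 v2 : R * R) : spfield -> Prop :=
  spinor_section v1 v2 false false.

(* Derivative along X of psi in the trivialisation given by the frame e:
   nabla_X psi = X(psi) + 1/2 g(nabla_X e_1, e_2) e_1 . e_2 . psi. *)
Definition spin_connection (g : metric) (e : axis -> vfield) (X : vfield)
    (psi : spfield) : spfield :=
  fun x y =>
    sp_plus
      (sp_plus (sp_scal (RtoC (X ax1 x y)) (sp_partial ax1 psi x y))
               (sp_scal (RtoC (X ax2 x y)) (sp_partial ax2 psi x y)))
      (sp_scal (RtoC (/ 2 * inner g (levi_civita g X (e ax1)) (e ax2) x y))
               (clifford ax1 (clifford ax2 (psi x y)))).

(* D psi = sum_a e_a . nabla_{e_a} psi, for a g-orthonormal frame e. *)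
Definition dirac (g : metric) (e : axis -> vfield) (psi : spfield) : spfield :=
  fun x y =>
    sp_plus (clifford ax1 (spin_connection g e (e ax1) psi x y))
            (clifford ax2 (spin_connection g e (e ax2) psi x y)).

(* g = h^4 g_o *)
Definition conf_metric (h : sfield) : metric :=
  fun i j x y => if axis_eqb i j then h x y ^ 4 else 0.

Definition conf_frame (h : sfield) : axis -> vfield :=
  fun a i x y => if axis_eqb a i then / h x y ^ 2 else 0.

Lemma conf_frame_orthonormal (h : sfield) :
  (forall x y, 0 < h x y) -> orthonormal_frame (conf_metric h) (conf_frame h).
Proof.
intros Hh a b x y; specialize (Hh x y).
destruct a, b; unfold inner, sum_axis, conf_metric, conf_frame; simpl;
  field; lra.
Qed.

Definition conf_dirac (h : sfield) : spfield -> spfield :=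
  dirac (conf_metric h) (conf_frame h).

Definition conf_dirac_sq (h : sfield) (psi : spfield) : spfield :=
  conf_dirac h (conf_dirac h psi).

(* The Dirac operator of g_o itself is the case h = 1. *)
Definition flat_factor : sfield := fun _ _ => 1.

Definition kernel (dom : spfield -> Prop) (A : spfield -> spfield) (psi : spfield) : Prop :=
  dom psi /\ forall x y, A psi x y = sp_zero.

Fixpoint lin_comb (n : nat) (c : nat -> C) (phi : nat -> spfield) : spfield :=
  fun x y =>
    match n with
    | O => sp_zero
    | S m => sp_plus (lin_comb m c phi x y) (sp_scal (c m) (phi m x y))
    end.

(* The spinor fields satisfying V form a complex vector space of dimension n:
   phi 0, ..., phi (n-1) is a basis. *)
Definition has_complex_dim (V : spfield -> Prop) (n : nat) : Prop :=
  exists phi : nat -> spfield,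
    (forall c : nat -> C,
        (forall x y, lin_comb n c phi x y = sp_zero) ->
        forall k, (k < n)%nat -> c k = RtoC 0) /\
    (forall psi, V psi <->
        exists c : nat -> C, forall x y, psi x y = lin_comb n c phi x y).

Definition is_eigenvalue (dom : spfield -> Prop) (A : spfield -> spfield) (lam : R) : Prop :=
  exists psi, dom psi /\
    (exists x y, psi x y <> sp_zero) /\
    (forall x y, A psi x y = sp_scal (RtoC lam) (psi x y)).

Definition is_first_positive_eigenvalue (dom : spfield -> Prop)
    (A : spfield -> spfield) (lam : R) : Prop :=
  0 < lam /\ is_eigenvalue dom A lam /\
  forall mu, 0 < mu -> is_eigenvalue dom A mu -> lam <= mu.

(* Main.v *)
From Stdlib Require Import ZArith Cantor FinFun ClassicalEpsilon.
From Stdlib Require Import Reals Lra Lia FunctionalExtensionality ProofIrrelevance.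
From mathcomp Require filter.
From Coquelicot Require Import Coquelicot.
Require Import Defs.

(** In dimension two the Dirac operator is conformally covariant: for [g = h^4 g_o] one
    has [D psi = h^-3 D_o (h psi)] ([conf_dirac_formula]).  In the chosen frame
    [D_o (f, g) = (B g, A f)] with the constant-coefficient Cauchy-Riemann operators
    [A = i d_1 + d_2] and [B = i d_1 - d_2].  Hence [psi] is harmonic exactly when both
    components of [h psi] are constant, because a periodic solution of [A u = 0] has only
    its zeroth Fourier coefficient; this is the two-dimensional kernel
    ([conf_kernel_dim]).

    Put [k = 1 / h].  For [u = h f] the equation [D^2 (f, 0) = lam (f, 0)] becomes
    [B (k^2 A u) = lam h^2 u] ([eigenpair]), and the second component solves the complex
    conjugate of this equation, so the spectrum of [D^2] is that of one scalar problem
    ([conf_eigenvalue_iff]).  Since [B] is the adjoint of [A], the scalar problem is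
    variational, with energy [|k A v|^2] and mass [|h v|^2], on the space of [v] with
    [h^2 v] of mean zero.  Its first positive eigenvalue is the infimum of energy over
    mass ([first_eigenvalue]).  To bound it, take [v = k^2 e] with a character [e] for
    which [|A e|^2 = lam_o]; such a character exists because the flat problem is diagonal
    on characters ([flat_eigenpair_symbol]).  In terms of spinors this is [h^-3] times a
    flat eigenspinor of constant length.  The mass of [v] is the integral of [1 / h^2],
    and its energy is the integral of [lam_o / h^6 + 4 |grad h|^2 / h^8], the mixed term
    being an exact derivative ([test_function_energy]).

    The analytic content is that the infimum is attained by a smooth function.  All of it
    takes place in the algebra of smooth periodic functions with the Riemann integral;
    no completion is formed.  Along a minimizing sequence [u_n], the functionals
    [f |-> int u_n f] and [f |-> int k^2 (A u_n) f] are uniformly bounded in mean square,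
    so they converge along a free ultrafilter to functionals [l] and [m].  By
    [almost_euler_lagrange] the limits satisfy the weak first-order system
    [m (h^2 f) = - l (A f)] and [lam l (h^2 f) = - m (B f)].  On characters the left sides
    are convolutions with the rapidly decreasing coefficients of [h^2], which preserve any
    polynomial decay ([bf_mult_decay]), while on the right [A] and [B] multiply by symbols
    growing linearly; iterating, [l] and [m] decay rapidly on characters and are
    represented by smooth functions solving the system ([weak_system_smooth]).  The limit
    is not zero, since the energy controls the high frequencies uniformly
    ([tail_le_energy]).

    Fourier analysis is used through two facts: a smooth periodic function is determined
    by its coefficients ([tchar_complete]), and every rapidly decreasing family is the
    family of coefficients of a smooth function ([coef_synth]). *)

Open Scope R_scope.

(** * Smooth functions of two real variables *)

Definition continuous2 (f : sfield) : Prop := forall x y, continuity_2d_pt f x y.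

Definition derivable2 (f : sfield) : Prop :=
  forall x y, ex_derive (fun u => f u y) x /\ ex_derive (fun v => f x v) y.

(** Smoothness is a coinductive notion (all partial derivatives are again smooth);
    this is the corresponding proof principle. *)
Lemma smooth_coind (P : sfield -> Prop) :
  (forall f, P f -> continuous2 f /\ derivable2 f /\
     forall i, P (partial i f)) ->
  forall f, P f -> smooth f.
Proof.
intros HP f Pf n; revert f Pf.
induction n as [|n IH]; intros f Pf x y; destruct (HP f Pf) as (Hc & Hd & Hi); split;
  try exact I; try exact (Hc x y).
destruct (Hd x y) as [H1 H2]; repeat split; try assumption.
- exact (IH _ (Hi ax1) x y).
- exact (IH _ (Hi ax2) x y).
Qed.

Lemma smooth_continuous2 (f : sfield) : smooth f -> continuous2 f.
Proof. intros H x y; exact (proj1 (H 0%nat x y)). Qed.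

Lemma smooth_derivable2 (f : sfield) : smooth f -> derivable2 f.
Proof. intros H x y; destruct (H 1%nat x y) as (_ & H1 & H2 & _); now split. Qed.

Lemma smooth_partial (i : axis) (f : sfield) : smooth f -> smooth (partial i f).
Proof.
intros H n x y; destruct (H (S n) x y) as (_ & _ & _ & H1 & H2).
destruct i; assumption.
Qed.

(** The class generated by smooth functions under the elementary operations.  It is
    stable under partial derivatives because differentiating a generator produces
    terms of the same kind; hence it contains only smooth functions, and all
    closure properties of [smooth] follow at once. *)
Inductive elementary : sfield -> Prop :=
| el_smooth f : smooth f -> elementary f
| el_const c : elementary (fun _ _ => c)
| el_fst : elementary (fun x _ => x)
| el_snd : elementary (fun _ y => y)
| el_plus f g : elementary f -> elementary g -> elementary (fun x y => f x y + g x y)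
| el_mult f g : elementary f -> elementary g -> elementary (fun x y => f x y * g x y)
| el_inv f : elementary f -> (forall x y, f x y <> 0) -> elementary (fun x y => / f x y)
| el_cos f : elementary f -> elementary (fun x y => cos (f x y))
| el_sin f : elementary f -> elementary (fun x y => sin (f x y)).

Lemma is_derive_cos_comp (f : R -> R) x :
  ex_derive f x -> is_derive (fun u => cos (f u)) x (- sin (f x) * Derive f x).
Proof. intros H. auto_derive; [exact H|].
change (fun u => f u) with f. ring. Qed.

Lemma is_derive_sin_comp (f : R -> R) x :
  ex_derive f x -> is_derive (fun u => sin (f u)) x (cos (f x) * Derive f x).
Proof. intros H. auto_derive; [exact H|].
change (fun u => f u) with f. ring. Qed.

Lemma elementary_derivable2 (f : sfield) :
  elementary f -> derivable2 f.
Proof.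
induction 1 as [f H|c| | |f g _ Hf _ Hg|f g _ Hf _ Hg|f _ Hf Hn|f _ Hf|f _ Hf];
  intros x y; try destruct (Hf x y) as [F1 F2]; try destruct (Hg x y) as [G1 G2].
- exact (smooth_derivable2 f H x y).
- split; apply ex_derive_const.
- split; [apply ex_derive_id|apply ex_derive_const].
- split; [apply ex_derive_const|apply ex_derive_id].
- split; now apply (ex_derive_plus (V := R_NormedModule)).
- split; now apply ex_derive_mult.
- split; now apply ex_derive_inv.
- split; eexists; now apply is_derive_cos_comp.
- split; eexists; now apply is_derive_sin_comp.
Qed.

Lemma partial_plus (i : axis) (f g : sfield) : derivable2 f -> derivable2 g ->
  partial i (fun x y => f x y + g x y) = fun x y => partial i f x y + partial i g x y.
Proof.
intros Hf Hg; apply functional_extensionality; intros x; apply functional_extensionality; intros y.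
destruct (Hf x y), (Hg x y), i; unfold partial.
- now apply (Derive_plus (fun u => f u y) (fun u => g u y)).
- now apply (Derive_plus (fun v => f x v) (fun v => g x v)).
Qed.

Lemma partial_mult (i : axis) (f g : sfield) : derivable2 f -> derivable2 g ->
  partial i (fun x y => f x y * g x y) =
  fun x y => partial i f x y * g x y + f x y * partial i g x y.
Proof.
intros Hf Hg; apply functional_extensionality; intros x; apply functional_extensionality; intros y.
destruct (Hf x y), (Hg x y), i; unfold partial.
- now apply (Derive_mult (fun u => f u y) (fun u => g u y)).
- now apply (Derive_mult (fun v => f x v) (fun v => g x v)).
Qed.

Lemma partial_inv (i : axis) (f : sfield) : derivable2 f -> (forall x y, f x y <> 0) ->
  partial i (fun x y => / f x y) =
  fun x y => (-1) * partial i f x y * (/ f x y * / f x y).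
Proof.
intros Hf Hn; apply functional_extensionality; intros x; apply functional_extensionality; intros y.
destruct (Hf x y), i; unfold partial.
- rewrite (Derive_inv (fun u => f u y)) by easy; field; apply Hn.
- rewrite (Derive_inv (fun v => f x v)) by easy; field; apply Hn.
Qed.

Lemma partial_const (i : axis) (c : R) : partial i (fun _ _ => c) = fun _ _ => 0.
Proof.
apply functional_extensionality; intros x; apply functional_extensionality; intros y.
destruct i; exact (Derive_const c _).
Qed.

Lemma partial_fst (i : axis) :
  partial i (fun x _ => x) = fun _ _ => if axis_eqb i ax1 then 1 else 0.
Proof.
apply functional_extensionality; intros x; apply functional_extensionality; intros y.
destruct i; [exact (Derive_id x)|exact (Derive_const x y)].
Qed.

Lemma partial_snd (i : axis) :
  partial i (fun _ y => y) = fun _ _ => if axis_eqb i ax2 then 1 else 0.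
Proof.
apply functional_extensionality; intros x; apply functional_extensionality; intros y.
destruct i; [exact (Derive_const y x)|exact (Derive_id y)].
Qed.

Lemma partial_cos (i : axis) (f : sfield) : derivable2 f ->
  partial i (fun x y => cos (f x y)) = fun x y => (-1) * sin (f x y) * partial i f x y.
Proof.
intros Hf; apply functional_extensionality; intros x; apply functional_extensionality; intros y.
destruct (Hf x y), i; unfold partial; apply is_derive_unique;
  replace (-1 * sin (f x y)) with (- sin (f x y)) by ring.
- now apply (is_derive_cos_comp (fun u => f u y)).
- now apply (is_derive_cos_comp (fun u => f x u)).
Qed.

Lemma partial_sin (i : axis) (f : sfield) : derivable2 f ->
  partial i (fun x y => sin (f x y)) = fun x y => cos (f x y) * partial i f x y.
Proof.
intros Hf; apply functional_extensionality; intros x; apply functional_extensionality; intros y.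
destruct (Hf x y), i; unfold partial; apply is_derive_unique.
- now apply (is_derive_sin_comp (fun u => f u y)).
- now apply (is_derive_sin_comp (fun u => f x u)).
Qed.

Lemma elementary_continuous2 (f : sfield) :
  elementary f -> continuous2 f.
Proof.
induction 1 as [f H|c| | |f g _ Hf _ Hg|f g _ Hf _ Hg|f _ Hf Hn|f _ Hf|f _ Hf];
  intros x y; try specialize (Hf x y); try specialize (Hg x y).
- exact (smooth_continuous2 f H x y).
- apply continuity_2d_pt_const.
- apply continuity_2d_pt_id1.
- apply continuity_2d_pt_id2.
- now apply continuity_2d_pt_plus.
- now apply continuity_2d_pt_mult.
- now apply continuity_2d_pt_inv.
- apply (continuity_1d_2d_pt_comp cos); [apply continuity_cos|easy].
- apply (continuity_1d_2d_pt_comp sin); [apply continuity_sin|easy].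
Qed.

Lemma elementary_partial (i : axis) (f : sfield) :
  elementary f -> elementary (partial i f).
Proof.
induction 1 as [f H|c| | |f g Ef Hf Eg Hg|f g Ef Hf Eg Hg|f Ef Hf Hn|f Ef Hf|f Ef Hf];
  try apply elementary_derivable2 in Ef as Df; try apply elementary_derivable2 in Eg as Dg.
- now apply el_smooth, smooth_partial.
- rewrite partial_const; apply el_const.
- rewrite partial_fst; apply el_const.
- rewrite partial_snd; apply el_const.
- rewrite partial_plus by easy; now apply el_plus.
- rewrite partial_mult by easy; apply el_plus; now apply el_mult.
- rewrite partial_inv by easy; apply el_mult; apply el_mult; try easy;
    try apply el_const; now apply el_inv.
- rewrite partial_cos by easy; apply el_mult; [apply el_mult|easy];
    [apply el_const|now apply el_sin].
- rewrite partial_sin by easy; apply el_mult; [now apply el_cos|easy].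
Qed.

Lemma elementary_smooth (f : sfield) : elementary f -> smooth f.
Proof.
apply smooth_coind; intros g Hg; split; [|split].
- now apply elementary_continuous2.
- exact (elementary_derivable2 g Hg).
- intros i; now apply elementary_partial.
Qed.

Lemma smooth_const (c : R) : smooth (fun _ _ => c).
Proof. apply elementary_smooth, el_const. Qed.

Lemma smooth_plus (f g : sfield) :
  smooth f -> smooth g -> smooth (fun x y => f x y + g x y).
Proof. intros; apply elementary_smooth, el_plus; now apply el_smooth. Qed.

Lemma smooth_mult (f g : sfield) :
  smooth f -> smooth g -> smooth (fun x y => f x y * g x y).
Proof. intros; apply elementary_smooth, el_mult; now apply el_smooth. Qed.

Lemma smooth_opp (f : sfield) : smooth f -> smooth (fun x y => - f x y).
Proof.
intros Hf; replace (fun x y => - f x y) with (fun x y => (-1) * f x y).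
- apply (smooth_mult (fun _ _ => -1)); [apply smooth_const|easy].
- apply functional_extensionality; intros x; apply functional_extensionality; intros y; ring.
Qed.

Lemma smooth_inv (f : sfield) :
  smooth f -> (forall x y, f x y <> 0) -> smooth (fun x y => / f x y).
Proof. intros; apply elementary_smooth, el_inv; [now apply el_smooth|easy]. Qed.

Lemma partial_opp (i : axis) (f : sfield) :
  partial i (fun x y => - f x y) = fun x y => - partial i f x y.
Proof.
apply functional_extensionality; intros x; apply functional_extensionality; intros y.
destruct i; unfold partial; apply Derive_opp.
Qed.

Lemma continuous2_line (f : sfield) (a b c d s : R) : continuous2 f ->
  continuous (fun s => f (s * a + b) (s * c + d)) s.
Proof.
intros Hf.
apply (continuous_comp_2 (fun s => s * a + b) (fun s => s * c + d) f).
- apply (ex_derive_continuous (fun s => s * a + b)); auto_derive; easy.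
- apply (ex_derive_continuous (fun s => s * c + d)); auto_derive; easy.
- exact (proj1 (continuity_2d_pt_filterlim f _ _) (Hf _ _)).
Qed.

Lemma smooth_differentiable (f : sfield) (x y : R) : smooth f ->
  differentiable_pt_lim f x y (partial ax1 f x y) (partial ax2 f x y).
Proof.
intros Hf; apply filterdiff_differentiable_pt_lim.
apply (is_derive_filterdiff f x y (partial ax1 f) (partial ax2 f x y)).
- apply filter_forall; intros [u v].
  exact (Derive_correct _ _ (proj1 (smooth_derivable2 f Hf u v))).
- exact (Derive_correct _ _ (proj2 (smooth_derivable2 f Hf x y))).
- apply continuity_2d_pt_filterlim, smooth_continuous2; now apply smooth_partial.
Qed.

Lemma smooth_derive_line (f : sfield) (a b c d s : R) : smooth f ->
  is_derive (fun s => f (s * a + b) (s * c + d)) s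
    (partial ax1 f (s * a + b) (s * c + d) * a + partial ax2 f (s * a + b) (s * c + d) * c).
Proof.
intros Hf; apply is_derive_Reals.
apply (derivable_pt_lim_comp_2d f (fun s => s * a + b) (fun s => s * c + d)).
- now apply smooth_differentiable.
- apply is_derive_Reals; auto_derive; [easy|ring].
- apply is_derive_Reals; auto_derive; [easy|ring].
Qed.

(** * Integration over the period parallelogram *)

Definition square_int (g : sfield) : R :=
  RInt (fun s => RInt (fun t => g s t) 0 1) 0 1.

Lemma ex_RInt_cont (g : R -> R) (a b : R) : (forall t, continuous g t) -> ex_RInt g a b.
Proof. intros Hg; apply (ex_RInt_continuous (V := R_CompleteNormedModule)); auto. Qed.

Lemma continuous2_section (g : sfield) (s t : R) : continuous2 g ->
  continuous (fun t => g s t) t.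
Proof.
intros Hg; apply (continuous_ext (fun t => g (t * 0 + s) (t * 1 + 0))).
- intros u; f_equal; ring.
- now apply continuous2_line.
Qed.

Lemma ex_RInt_section (g : sfield) (s : R) : continuous2 g ->
  ex_RInt (fun t => g s t) 0 1.
Proof. intros Hg; apply ex_RInt_cont; intros; now apply continuous2_section. Qed.

(** Uniform continuity on a compact strip around the line of integration. *)
Lemma continuous_RInt_section (g : sfield) (s : R) : continuous2 g ->
  continuous (fun s => RInt (fun t => g s t) 0 1) s.
Proof.
intros Hg P [eps HP].
destruct (uniform_continuity_2d g (s - 1) (s + 1) 0 1 (fun x y _ _ => Hg x y)
  (pos_div_2 eps)) as [d Hd].
assert (Hm : 0 < Rmin d 1) by (apply Rmin_case; [apply cond_pos|lra]).
exists (mkposreal _ Hm); intros u Hu; apply HP.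
assert (Hu' : Rabs (u - s) < Rmin d 1) by exact Hu.
assert (Rabs (u - s) < d) by (eapply Rlt_le_trans; [exact Hu'|apply Rmin_l]).
assert (Rabs (u - s) < 1) as [? ?]%Rabs_def2 by (eapply Rlt_le_trans; [exact Hu'|apply Rmin_r]).
change (Rabs (RInt (fun t => g u t) 0 1 - RInt (fun t => g s t) 0 1) < eps).
replace (RInt (fun t => g u t) 0 1 - RInt (fun t => g s t) 0 1)
  with (RInt (fun t => g u t - g s t) 0 1)
  by (apply (RInt_minus (fun t => g u t) (fun t => g s t)); now apply ex_RInt_section).
assert (Hcd : forall t, continuous (fun t => g u t - g s t) t).
{ intros t; apply (continuous_minus (fun t => g u t) (fun t => g s t));
    now apply continuous2_section. }
apply Rle_lt_trans with ((1 - 0) * (eps / 2)); [|destruct eps; simpl; lra].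
apply abs_RInt_le_const; [lra|now apply ex_RInt_cont|].
intros t Ht; left; apply Hd; try lra; rewrite Rminus_diag, Rabs_R0; apply cond_pos.
Qed.

Lemma ex_RInt_square (g : sfield) : continuous2 g ->
  ex_RInt (fun s => RInt (fun t => g s t) 0 1) 0 1.
Proof. intros Hg; apply ex_RInt_cont; intros; now apply continuous_RInt_section. Qed.

Lemma square_int_plus (f g : sfield) : continuous2 f -> continuous2 g ->
  square_int (fun s t => f s t + g s t) = square_int f + square_int g.
Proof.
intros Hf Hg; unfold square_int.
rewrite <- (RInt_plus (V := R_CompleteNormedModule) (fun s => RInt (fun t => f s t) 0 1)
  (fun s => RInt (fun t => g s t) 0 1)) by now apply ex_RInt_square.
apply RInt_ext; intros s _.
now apply (RInt_plus (V := R_CompleteNormedModule) (f s) (g s)); apply ex_RInt_section.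
Qed.

Lemma square_int_scal (c : R) (f : sfield) : continuous2 f ->
  square_int (fun s t => c * f s t) = c * square_int f.
Proof.
intros Hf; unfold square_int.
rewrite <- (RInt_scal (V := R_CompleteNormedModule) (fun s => RInt (fun t => f s t) 0 1))
  by now apply ex_RInt_square.
apply RInt_ext; intros s _.
now apply (RInt_scal (V := R_CompleteNormedModule) (f s)); apply ex_RInt_section.
Qed.

Lemma square_int_const (c : R) : square_int (fun _ _ => c) = c.
Proof.
unfold square_int; rewrite (RInt_ext _ (fun _ => c)).
- rewrite RInt_const; unfold scal; simpl; unfold mult; simpl; ring.
- intros s _; rewrite RInt_const; unfold scal; simpl; unfold mult; simpl; ring.
Qed.

Lemma square_int_le (f g : sfield) : continuous2 f -> continuous2 g ->
  (forall s t, 0 < s < 1 -> 0 < t < 1 -> f s t <= g s t) -> square_int f <= square_int g.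
Proof.
intros Hf Hg H; apply RInt_le; try lra; try now apply ex_RInt_square.
intros s Hs; apply RInt_le; try lra; try now apply ex_RInt_section.
now intros t; apply H.
Qed.

(** Otherwise the integrand is bounded below by a positive constant on a subinterval. *)
Lemma RInt_eq_0 (g : R -> R) : (forall t, continuous g t) -> (forall t, 0 <= g t) ->
  RInt g 0 1 = 0 -> forall t, 0 < t < 1 -> g t = 0.
Proof.
intros Hc Hp H0 t Ht.
destruct (Rle_lt_or_eq_dec 0 (g t) (Hp t)) as [Hlt|]; [exfalso|easy].
assert (Hh : 0 < g t / 2) by lra.
destruct (proj1 (filterlim_locally _ _) (Hc t) (mkposreal _ Hh)) as [d Hd].
set (m := Rmin (d / 2) (Rmin (t / 2) ((1 - t) / 2))).
assert (Hm : 0 < m /\ m <= d / 2 /\ m <= t / 2 /\ m <= (1 - t) / 2).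
{ unfold m; pose proof (cond_pos d); repeat split.
  - repeat apply Rmin_case; lra.
  - apply Rmin_l.
  - eapply Rle_trans; [apply Rmin_r|apply Rmin_l].
  - eapply Rle_trans; [apply Rmin_r|apply Rmin_r]. }
assert (Hex : forall a b, ex_RInt g a b) by (intros; now apply ex_RInt_cont).
assert (Hpos : forall a b, a <= b -> 0 <= RInt g a b) by (intros; apply RInt_ge_0; auto).
assert (0 < RInt g (t - m) (t + m)).
{ apply RInt_gt_0; [lra| |intros; apply Hc].
  intros u Hu.
  assert (Hb : Rabs (g u - g t) < g t / 2).
  { apply (Hd u); change (Rabs (u - t) < d); apply Rabs_def1; lra. }
  apply Rabs_def2 in Hb; lra. }
rewrite <- (RInt_Chasles g 0 (t - m) 1), <- (RInt_Chasles g (t - m) (t + m) 1) in H0 by auto.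
unfold plus in H0; simpl in H0.
pose proof (Hpos 0 (t - m)); pose proof (Hpos (t + m) 1); lra.
Qed.

Lemma square_int_eq_0 (g : sfield) : continuous2 g -> (forall s t, 0 <= g s t) ->
  square_int g = 0 -> forall s t, 0 < s < 1 -> 0 < t < 1 -> g s t = 0.
Proof.
intros Hc Hp H0 s t Hs Ht.
apply (RInt_eq_0 (fun t => g s t)); try easy; [intros; now apply continuous2_section|].
apply (RInt_eq_0 (fun s => RInt (fun t => g s t) 0 1)); try easy.
- intros; now apply continuous_RInt_section.
- intros u; apply RInt_ge_0; [lra|now apply ex_RInt_section|easy].
Qed.

(** The coordinates [(s, t)] stand for the point [s v1 + t v2]. *)
Definition in_basis (v1 v2 : R * R) (f : sfield) : sfield :=
  fun s t => f (s * fst v1 + t * fst v2) (s * snd v1 + t * snd v2).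

Lemma continuous2_in_basis (v1 v2 : R * R) (f : sfield) :
  continuous2 f -> continuous2 (in_basis v1 v2 f).
Proof.
intros Hf s t; apply continuity_2d_pt_filterlim.
apply (continuous_comp_2 (fun z : R * R => fst z * fst v1 + snd z * fst v2)
  (fun z : R * R => fst z * snd v1 + snd z * snd v2) f (s, t)).
- apply (proj1 (continuity_2d_pt_filterlim (fun s t => s * fst v1 + t * fst v2) s t)).
  apply (elementary_continuous2 (fun s t => s * fst v1 + t * fst v2)).
  apply el_plus; apply el_mult; first [apply el_const|apply el_fst|apply el_snd].
- apply (proj1 (continuity_2d_pt_filterlim (fun s t => s * snd v1 + t * snd v2) s t)).
  apply (elementary_continuous2 (fun s t => s * snd v1 + t * snd v2)).
  apply el_plus; apply el_mult; first [apply el_const|apply el_fst|apply el_snd].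
- apply continuity_2d_pt_filterlim, Hf.
Qed.

Lemma periodic_in_basis (v1 v2 : R * R) (f : sfield) : periodic v1 v2 f ->
  forall s t, in_basis v1 v2 f (s + 1) t = in_basis v1 v2 f s t /\
              in_basis v1 v2 f s (t + 1) = in_basis v1 v2 f s t.
Proof.
intros Hf s t; unfold in_basis.
destruct (Hf (s * fst v1 + t * fst v2) (s * snd v1 + t * snd v2)) as [H1 H2].
split; [rewrite <- H1|rewrite <- H2]; unfold shift; f_equal; ring.
Qed.

(** The inner integral already vanishes, by the fundamental theorem of calculus along
    the second period. *)
Lemma square_int_derive_snd (v1 v2 : R * R) (f : sfield) : smooth f -> periodic v1 v2 f ->
  square_int (in_basis v1 v2
    (fun x y => partial ax1 f x y * fst v2 + partial ax2 f x y * snd v2)) = 0.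
Proof.
intros Hf Hp; unfold square_int.
rewrite (RInt_ext _ (fun _ => 0)); [rewrite RInt_const; apply Rmult_0_r|].
intros s _; apply is_RInt_unique.
evar_last.
- apply (is_RInt_derive (V := R_CompleteNormedModule) (in_basis v1 v2 f s)).
  + intros t _; unfold in_basis.
    apply (is_derive_ext (fun t => f (t * fst v2 + s * fst v1) (t * snd v2 + s * snd v1))).
    { intros u; f_equal; ring. }
    evar_last; [now apply smooth_derive_line|].
    f_equal; f_equal; f_equal; ring.
  + intros t _; apply (continuous2_section (in_basis v1 v2
      (fun x y => partial ax1 f x y * fst v2 + partial ax2 f x y * snd v2))).
    apply continuous2_in_basis, elementary_continuous2.
    apply el_plus; apply el_mult; try apply el_const;
      now apply el_smooth, smooth_partial.
- pose proof (proj2 (periodic_in_basis v1 v2 f Hp s 0)) as H; rewrite Rplus_0_l in H.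
  rewrite H; apply Rminus_diag.
Qed.

(** Here the derivative is first taken out of the inner integral; this avoids exchanging
    the order of integration. *)
Lemma square_int_derive_fst (v1 v2 : R * R) (f : sfield) : smooth f -> periodic v1 v2 f ->
  square_int (in_basis v1 v2
    (fun x y => partial ax1 f x y * fst v1 + partial ax2 f x y * snd v1)) = 0.
Proof.
intros Hf Hp; unfold square_int.
set (df := fun x y => partial ax1 f x y * fst v1 + partial ax2 f x y * snd v1).
assert (Hdf : continuous2 (in_basis v1 v2 df)).
{ apply continuous2_in_basis, elementary_continuous2.
  apply el_plus; apply el_mult; try apply el_const; now apply el_smooth, smooth_partial. }
assert (Hd : forall s t, is_derive (fun s => in_basis v1 v2 f s t) s (in_basis v1 v2 df s t)).
{ intros s t; unfold in_basis, df; now apply smooth_derive_line. }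
assert (HD : (fun s t => Derive (fun s => in_basis v1 v2 f s t) s) = in_basis v1 v2 df).
{ apply functional_extensionality; intros s; apply functional_extensionality; intros t.
  now apply is_derive_unique. }
assert (Hfc : continuous2 (in_basis v1 v2 f)) by now apply continuous2_in_basis, smooth_continuous2.
apply is_RInt_unique.
evar_last.
- apply (is_RInt_derive (V := R_CompleteNormedModule)
    (fun s => RInt (fun t => in_basis v1 v2 f s t) 0 1)).
  + intros s _.
    rewrite <- HD.
    apply (is_derive_RInt_param (in_basis v1 v2 f)).
    * apply filter_forall; intros u t _; eexists; apply Hd.
    * intros t _; rewrite HD; apply Hdf.
    * apply filter_forall; intros u; now apply ex_RInt_section.
  + intros s _; now apply continuous_RInt_section.
- replace (RInt (fun t => in_basis v1 v2 f 1 t) 0 1) with (RInt (fun t => in_basis v1 v2 f 0 t) 0 1).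
  + apply Rminus_diag.
  + apply RInt_ext; intros t _.
    rewrite <- (proj1 (periodic_in_basis v1 v2 f Hp 0 t)); now rewrite Rplus_0_l.
Qed.

(** Any constant-coefficient derivative is a combination of the two along the
    periods, each of which integrates to zero. *)
Lemma square_int_partial (v1 v2 : R * R) (i : axis) (f : sfield) : det2 v1 v2 <> 0 ->
  smooth f -> periodic v1 v2 f -> square_int (in_basis v1 v2 (partial i f)) = 0.
Proof.
intros Hdet Hf Hp; unfold det2 in Hdet.
set (d := fst v1 * snd v2 - snd v1 * fst v2) in *.
assert (Hc : forall w : R * R, continuous2 (in_basis v1 v2
   (fun x y => partial ax1 f x y * fst w + partial ax2 f x y * snd w))).
{ intros w; apply continuous2_in_basis, elementary_continuous2.
  apply el_plus; apply el_mult; try apply el_const; now apply el_smooth, smooth_partial. }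
assert (H : forall a b : R, square_int (fun s t =>
    a * in_basis v1 v2 (fun x y => partial ax1 f x y * fst v1 + partial ax2 f x y * snd v1) s t
  + b * in_basis v1 v2 (fun x y => partial ax1 f x y * fst v2 + partial ax2 f x y * snd v2) s t)
  = 0).
{ intros a b; rewrite square_int_plus, !square_int_scal, square_int_derive_fst,
    square_int_derive_snd; try easy; [ring| |].
  - intros s t; apply continuity_2d_pt_mult; [apply continuity_2d_pt_const|apply Hc].
  - intros s t; apply continuity_2d_pt_mult; [apply continuity_2d_pt_const|apply Hc]. }
destruct i.
- rewrite <- (H (snd v2 / d) (- snd v1 / d)); f_equal.
  apply functional_extensionality; intros s; apply functional_extensionality; intros t.
  unfold in_basis; unfold d in *; now field.
- rewrite <- (H (- fst v2 / d) (fst v1 / d)); f_equal.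
  apply functional_extensionality; intros s; apply functional_extensionality; intros t.
  unfold in_basis; unfold d in *; now field.
Qed.

(** * The algebra of smooth complex functions on the torus *)

Lemma C_ext (a b : C) : fst a = fst b -> snd a = snd b -> a = b.
Proof. apply injective_projections. Qed.

Section Torus.

Context {v1 v2 : R * R}.

(** Complex functions bundled with smoothness and periodicity.  Since two of them with
    the same values are equal, they form a commutative ring for Leibniz equality, in which
    the later computations are done by [ring]. *)
Record tfun := Tfun {
  ev :> R -> R -> C;
  ev_smooth : Csmooth ev;
  ev_periodic : forall x y, shift v1 ev x y = ev x y /\ shift v2 ev x y = ev x y }.

Lemma tfun_ext (f g : tfun) : (forall x y, f x y = g x y) -> f = g.
Proof.
destruct f as [f f1 f2], g as [g g1 g2]; simpl; intros H.
assert (E : f = g) by (apply functional_extensionality; intros x;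
  apply functional_extensionality; intros y; apply H).
subst g; f_equal; apply proof_irrelevance.
Qed.

Lemma smooth_re (f : tfun) : smooth (fun x y => fst (f x y)).
Proof. exact (proj1 (ev_smooth f)). Qed.

Lemma smooth_im (f : tfun) : smooth (fun x y => snd (f x y)).
Proof. exact (proj2 (ev_smooth f)). Qed.

Lemma periodic_re (f : tfun) : periodic v1 v2 (fun x y => fst (f x y)).
Proof.
intros x y; destruct (ev_periodic f x y) as [H1 H2].
exact (conj (f_equal fst H1) (f_equal fst H2)).
Qed.

Lemma periodic_im (f : tfun) : periodic v1 v2 (fun x y => snd (f x y)).
Proof.
intros x y; destruct (ev_periodic f x y) as [H1 H2].
exact (conj (f_equal snd H1) (f_equal snd H2)).
Qed.

Lemma Csmooth_const (c : C) : Csmooth (fun _ _ => c).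
Proof. split; apply smooth_const. Qed.

Definition tconst (c : C) : tfun.
Proof. refine (Tfun (fun _ _ => c) (Csmooth_const c) _); now split. Defined.

Lemma Csmooth_plus (f g : R -> R -> C) : Csmooth f -> Csmooth g ->
  Csmooth (fun x y => Cplus (f x y) (g x y)).
Proof. intros [] []; split; simpl; now apply smooth_plus. Qed.

Lemma Csmooth_mult (f g : R -> R -> C) : Csmooth f -> Csmooth g ->
  Csmooth (fun x y => Cmult (f x y) (g x y)).
Proof.
intros [] []; split; simpl; unfold Rminus.
- apply smooth_plus; [|apply smooth_opp]; now apply smooth_mult.
- apply smooth_plus; now apply smooth_mult.
Qed.

Lemma Csmooth_opp (f : R -> R -> C) : Csmooth f -> Csmooth (fun x y => Copp (f x y)).
Proof. intros []; split; simpl; now apply smooth_opp. Qed.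

Lemma Csmooth_conj (f : R -> R -> C) : Csmooth f -> Csmooth (fun x y => Cconj (f x y)).
Proof. intros []; split; simpl; [easy|now apply smooth_opp]. Qed.

Definition tplus (f g : tfun) : tfun.
Proof.
refine (Tfun _ (Csmooth_plus _ _ (ev_smooth f) (ev_smooth g)) _); intros x y.
destruct (ev_periodic f x y) as [H1 H2], (ev_periodic g x y) as [H3 H4].
now split; unfold shift in *; f_equal.
Defined.

Definition tmult (f g : tfun) : tfun.
Proof.
refine (Tfun _ (Csmooth_mult _ _ (ev_smooth f) (ev_smooth g)) _); intros x y.
destruct (ev_periodic f x y) as [H1 H2], (ev_periodic g x y) as [H3 H4].
now split; unfold shift in *; f_equal.
Defined.

Definition topp (f : tfun) : tfun.
Proof.
refine (Tfun _ (Csmooth_opp _ (ev_smooth f)) _); intros x y.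
destruct (ev_periodic f x y) as [H1 H2].
now split; unfold shift in *; f_equal.
Defined.

Definition tconj (f : tfun) : tfun.
Proof.
refine (Tfun _ (Csmooth_conj _ (ev_smooth f)) _); intros x y.
destruct (ev_periodic f x y) as [H1 H2].
now split; unfold shift in *; f_equal.
Defined.

Definition tminus (f g : tfun) : tfun := tplus f (topp g).

Lemma partial_shift (i : axis) (w : R * R) (f : sfield) :
  partial i (shift w f) = shift w (partial i f).
Proof.
apply functional_extensionality; intros x; apply functional_extensionality; intros y.
destruct i; unfold partial, shift.
- unfold Derive; f_equal; apply Lim_ext; intros u.
  now replace (x + u + fst w) with (x + fst w + u) by ring.
- unfold Derive; f_equal; apply Lim_ext; intros u.
  now replace (y + u + snd w) with (y + snd w + u) by ring.
Qed.

Lemma periodic_partial (i : axis) (f : sfield) :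
  periodic v1 v2 f -> periodic v1 v2 (partial i f).
Proof.
intros Hf x y; rewrite <- !partial_shift.
now split; f_equal; apply functional_extensionality; intros u;
  apply functional_extensionality; intros v; apply Hf.
Qed.

Definition tpartial (i : axis) (f : tfun) : tfun.
Proof.
refine (Tfun (Cpartial i f) _ _).
- split; unfold Cpartial; simpl; apply smooth_partial; apply ev_smooth.
- intros x y; unfold shift, Cpartial.
  destruct (periodic_partial i _ (periodic_re f) x y) as [H1 H2].
  destruct (periodic_partial i _ (periodic_im f) x y) as [H3 H4].
  now split; f_equal.
Defined.

Lemma tfun_ring : ring_theory (tconst 0) (tconst 1) tplus tmult tminus topp eq.
Proof.
split; intros; apply tfun_ext; intros; unfold tminus; simpl; ring.
Qed.

Add Ring tfun_ring : tfun_ring.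

Lemma tconst_plus a b : tconst (Cplus a b) = tplus (tconst a) (tconst b).
Proof. now apply tfun_ext. Qed.

Lemma tconst_mult a b : tconst (Cmult a b) = tmult (tconst a) (tconst b).
Proof. now apply tfun_ext. Qed.

Lemma tconst_opp a : tconst (Copp a) = topp (tconst a).
Proof. now apply tfun_ext. Qed.

Lemma tconj_conj f : tconj (tconj f) = f.
Proof. apply tfun_ext; intros; simpl; apply Cconj_conj. Qed.

Lemma tconj_plus f g : tconj (tplus f g) = tplus (tconj f) (tconj g).
Proof. apply tfun_ext; intros; simpl; apply Cplus_conj. Qed.

Lemma tconj_mult f g : tconj (tmult f g) = tmult (tconj f) (tconj g).
Proof. apply tfun_ext; intros; simpl; apply Cmult_conj. Qed.

Lemma tconj_opp f : tconj (topp f) = topp (tconj f).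
Proof. apply tfun_ext; intros; simpl; apply Copp_conj. Qed.

Lemma tconj_const c : tconj (tconst c) = tconst (Cconj c).
Proof. now apply tfun_ext. Qed.

Lemma tpartial_plus i f g : tpartial i (tplus f g) = tplus (tpartial i f) (tpartial i g).
Proof.
pose proof (smooth_derivable2 _ (smooth_re f)); pose proof (smooth_derivable2 _ (smooth_im f)).
pose proof (smooth_derivable2 _ (smooth_re g)); pose proof (smooth_derivable2 _ (smooth_im g)).
apply tfun_ext; intros x y; simpl; unfold Cpartial; simpl.
now rewrite 2 partial_plus by easy.
Qed.

Lemma tpartial_const i c : tpartial i (tconst c) = tconst 0.
Proof. apply tfun_ext; intros x y; simpl; unfold Cpartial; simpl. now rewrite !partial_const. Qed.

Lemma tpartial_conj i f : tpartial i (tconj f) = tconj (tpartial i f).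
Proof.
apply tfun_ext; intros x y; simpl; unfold Cpartial, Cconj; simpl. now rewrite !partial_opp.
Qed.

Lemma tpartial_mult i f g : tpartial i (tmult f g) =
  tplus (tmult (tpartial i f) g) (tmult f (tpartial i g)).
Proof.
pose proof (smooth_re f); pose proof (smooth_im f).
pose proof (smooth_re g); pose proof (smooth_im g).
apply tfun_ext; intros x y; simpl; unfold Cpartial; simpl; unfold Rminus.
rewrite (partial_plus i (fun x y => fst (f x y) * fst (g x y))
  (fun x y => - (snd (f x y) * snd (g x y)))).
rewrite (partial_plus i (fun x y => fst (f x y) * snd (g x y))
  (fun x y => snd (f x y) * fst (g x y))).
rewrite partial_opp, 4 partial_mult by now apply smooth_derivable2.
apply C_ext; simpl; ring.
all: apply smooth_derivable2; try apply smooth_opp; now apply smooth_mult.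
Qed.

Definition treal (f : sfield) (Hs : smooth f) (Hp : periodic v1 v2 f) : tfun.
Proof.
refine (Tfun (fun x y => RtoC (f x y)) _ _).
- split; simpl; [exact Hs|apply smooth_const].
- intros x y; destruct (Hp x y) as [H1 H2]; unfold shift in *; split; now f_equal.
Defined.

(** * The integral of a torus function *)

(** Normalised so that constants integrate to themselves; it differs from the integral for
    the flat area element by the area of the torus. *)
Definition tint (f : tfun) : C :=
  (square_int (in_basis v1 v2 (fun x y => fst (f x y))),
   square_int (in_basis v1 v2 (fun x y => snd (f x y)))).

Lemma continuous2_re (f : tfun) : continuous2 (in_basis v1 v2 (fun x y => fst (f x y))).
Proof. apply continuous2_in_basis, smooth_continuous2, smooth_re. Qed.

Lemma continuous2_im (f : tfun) : continuous2 (in_basis v1 v2 (fun x y => snd (f x y))).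
Proof. apply continuous2_in_basis, smooth_continuous2, smooth_im. Qed.

Lemma tint_plus f g : tint (tplus f g) = Cplus (tint f) (tint g).
Proof.
apply C_ext; simpl.
- apply (square_int_plus _ _ (continuous2_re f) (continuous2_re g)).
- apply (square_int_plus _ _ (continuous2_im f) (continuous2_im g)).
Qed.

Lemma tint_scal c f : tint (tmult (tconst c) f) = Cmult c (tint f).
Proof.
assert (Hc : forall (a : R) g, continuous2 g -> continuous2 (fun s t => a * g s t)).
{ intros a g Hg s t; apply continuity_2d_pt_mult; [apply continuity_2d_pt_const|apply Hg]. }
pose proof (continuous2_re f) as H1; pose proof (continuous2_im f) as H2.
apply C_ext; simpl.
- replace (- (snd c * square_int (in_basis v1 v2 (fun x y => snd (f x y)))))
    with ((- snd c) * square_int (in_basis v1 v2 (fun x y => snd (f x y)))) by ring.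
  unfold Rminus; rewrite Ropp_mult_distr_l, <- !square_int_scal, <- square_int_plus by auto.
  f_equal; apply functional_extensionality; intros s; apply functional_extensionality; intros t.
  unfold in_basis; ring.
- rewrite <- !square_int_scal, <- square_int_plus by auto.
  f_equal.
Qed.

Lemma tint_conj f : tint (tconj f) = Cconj (tint f).
Proof.
apply C_ext; simpl; [easy|].
match goal with |- _ = - ?a => replace (- a) with ((-1) * a) by ring end.
rewrite <- square_int_scal by apply continuous2_im.
f_equal; apply functional_extensionality; intros s; apply functional_extensionality; intros t.
unfold in_basis; ring.
Qed.

Lemma tint_const c : tint (tconst c) = c.
Proof. apply C_ext; [exact (square_int_const (fst c))|exact (square_int_const (snd c))]. Qed.

Lemma tint_opp f : tint (topp f) = Copp (tint f).
Proof.
replace (topp f) with (tmult (tconst (Copp 1)) f) by (rewrite tconst_opp; ring).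
rewrite tint_scal; ring.
Qed.

Lemma tint_minus f g : tint (tminus f g) = Cminus (tint f) (tint g).
Proof. unfold tminus, Cminus; now rewrite tint_plus, tint_opp. Qed.

Lemma tint_partial i f : det2 v1 v2 <> 0 -> tint (tpartial i f) = RtoC 0.
Proof.
intros Hdet; apply C_ext.
- apply (square_int_partial v1 v2 i (fun x y => fst (f x y)) Hdet (smooth_re f) (periodic_re f)).
- apply (square_int_partial v1 v2 i (fun x y => snd (f x y)) Hdet (smooth_im f) (periodic_im f)).
Qed.

Lemma tint_re_le (f g : tfun) : (forall x y, fst (f x y) <= fst (g x y)) ->
  fst (tint f) <= fst (tint g).
Proof.
intros H; apply square_int_le; try apply continuous2_re.
intros s t _ _; apply H.
Qed.

(** * Completeness of the characters *)

(** If the moments of [F] against all powers of a nonnegative weight vanish, then [F]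
    cannot be positive where the weight exceeds 1: by Bernoulli's inequality the powers of
    the weight grow at least linearly there, while elsewhere they stay bounded by 1. *)
Lemma moments_exclude_peak (F p : sfield) (s0 t0 c : R) :
  continuous2 F -> continuous2 p -> 0 < c -> (forall s t, 0 <= p s t) ->
  (forall s t, 1 < p s t -> c <= F s t) ->
  0 < s0 < 1 -> 0 < t0 < 1 -> 1 < p s0 t0 ->
  (forall n, square_int (fun s t => F s t * p s t ^ n) = 0) -> False.
Proof.
intros HF Hp Hc Hp0 HpF Hs0 Ht0 Hp1 Hm.
set (g := fun s t => Rmax 0 (p s t - 1)).
assert (Habs : forall f, continuous2 f -> continuous2 (fun s t => Rabs (f s t))).
{ intros f Hf s t; apply (continuity_1d_2d_pt_comp Rabs); [|apply Hf].
  apply continuity_pt_filterlim, (continuous_Rabs). }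
assert (Hscal : forall a f, continuous2 f -> continuous2 (fun s t => a * f s t)).
{ intros a f Hf s t; apply continuity_2d_pt_mult; [apply continuity_2d_pt_const|apply Hf]. }
assert (Hplus : forall f h, continuous2 f -> continuous2 h -> continuous2 (fun s t => f s t + h s t)).
{ intros f h Hf Hh s t; apply continuity_2d_pt_plus; [apply Hf|apply Hh]. }
assert (Hg : continuous2 g).
{ assert (Hp' : continuous2 (fun s t => p s t + -1))
    by (apply (Hplus p (fun _ _ => -1)); [easy|intros s t; apply continuity_2d_pt_const]).
  intros s t; apply (continuity_2d_pt_ext (fun s t => / 2 * ((p s t + -1) + Rabs (p s t + -1)))).
  - intros u v; unfold g, Rmax, Rabs; destruct Rle_dec, Rcase_abs; lra.
  - apply (Hscal (/ 2) (fun s t => (p s t + -1) + Rabs (p s t + -1))).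
    apply (Hplus (fun s t => p s t + -1) (fun s t => Rabs (p s t + -1))); [easy|now apply Habs]. }
assert (Hpow : forall n, continuous2 (fun s t => F s t * p s t ^ n)).
{ intros n; induction n as [|n IH]; intros s t; simpl.
  - apply continuity_2d_pt_mult; [apply HF|apply continuity_2d_pt_const].
  - apply (continuity_2d_pt_ext (fun s t => p s t * (F s t * p s t ^ n))); [intros; ring|].
    apply continuity_2d_pt_mult; [apply Hp|apply IH]. }
assert (HJ : 0 < square_int g).
{ destruct (Rle_lt_or_eq_dec 0 (square_int g)) as [|E]; [|easy|exfalso].
  - rewrite <- (square_int_const 0).
    apply square_int_le; [intros s t; apply continuity_2d_pt_const|easy|].
    intros; apply Rmax_l.
  - apply eq_sym, square_int_eq_0 with (s := s0) (t := t0) in E; try easy.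
    + unfold g, Rmax in E; destruct Rle_dec; lra.
    + intros; apply Rmax_l. }
assert (Hn : forall n, INR n * (c * square_int g) <= square_int (fun s t => Rabs (F s t))).
{ intros n.
  enough (square_int (fun s t => (-1) * Rabs (F s t) + (INR n * c) * g s t)
    <= square_int (fun s t => F s t * p s t ^ n)) as H.
  { rewrite Hm, square_int_plus, !square_int_scal in H; auto; lra. }
  apply square_int_le; auto.
  intros s t _ _; unfold g.
  destruct (Rle_lt_dec (p s t) 1) as [Hle|Hlt].
  - rewrite Rmax_left by lra.
    assert (0 <= p s t ^ n <= 1).
    { split; [apply pow_le, Hp0|].
      rewrite <- (pow1 n); apply pow_incr; split; [apply Hp0|easy]. }
    unfold Rabs; destruct Rcase_abs; nra.
  - rewrite Rmax_right by lra.
    pose proof (HpF s t Hlt) as H1.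
    assert (1 + INR n * (p s t - 1) <= p s t ^ n) as H2.
    { replace (p s t) with (1 + (p s t - 1)) at 2 by ring; apply poly; lra. }
    pose proof (pos_INR n) as H3.
    assert (0 <= INR n * (p s t - 1)) by (apply Rmult_le_pos; lra).
    rewrite Rabs_pos_eq by lra.
    assert (c * (1 + INR n * (p s t - 1)) <= F s t * p s t ^ n)
      by (apply Rmult_le_compat; lra).
    lra. }
destruct (archimed_cor1 (c * square_int g / (1 + square_int (fun s t => Rabs (F s t))))) as [N [HN HN0]].
{ apply Rdiv_lt_0_compat; [nra|].
  enough (0 <= square_int (fun s t => Rabs (F s t))) by lra.
  rewrite <- (square_int_const 0).
  apply square_int_le; [intros s t; apply continuity_2d_pt_const|auto|].
  intros; apply Rabs_pos. }
specialize (Hn N).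
apply lt_0_INR in HN0.
assert (HA : 0 <= square_int (fun s t => Rabs (F s t))).
{ rewrite <- (square_int_const 0).
  apply square_int_le; [intros s t; apply continuity_2d_pt_const|auto|].
  intros; apply Rabs_pos. }
set (A := square_int (fun s t => Rabs (F s t))) in *.
assert (/ INR N * (INR N * (1 + A)) < c * square_int g / (1 + A) * (INR N * (1 + A)))
  by (apply Rmult_lt_compat_r; [nra|easy]).
field_simplify in H; nra.
Qed.

Lemma cos_IZR_period (x : R) (n : Z) : cos (x + 2 * PI * IZR n) = cos x.
Proof.
destruct (Z_le_gt_dec 0 n).
- rewrite <- (Z2Nat.id n), <- INR_IZR_INZ by easy.
  replace (2 * PI * INR (Z.to_nat n)) with (2 * INR (Z.to_nat n) * PI) by ring.
  apply cos_period.
- replace n with (- Z.of_nat (Z.to_nat (- n)))%Z by lia.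
  rewrite opp_IZR, <- INR_IZR_INZ.
  rewrite <- (cos_period (x + 2 * PI * - INR (Z.to_nat (- n))) (Z.to_nat (- n))).
  f_equal; ring.
Qed.

Lemma sin_IZR_period (x : R) (n : Z) : sin (x + 2 * PI * IZR n) = sin x.
Proof.
rewrite <- !cos_shift, <- (cos_IZR_period (PI / 2 - (x + 2 * PI * IZR n)) n); f_equal; ring.
Qed.

(** The nearest integer to [s] works, as the cosine decreases on half a period. *)
Lemma cos_large_near_integer (d s : R) : 0 < d < 1 / 2 -> cos (2 * PI * d) < cos (2 * PI * s) ->
  exists n : Z, Rabs (s - IZR n) < d.
Proof.
intros Hd Hcos; exists (up (s - 1 / 2)).
destruct (archimed (s - 1 / 2)) as [H1 H2].
set (n := up (s - 1 / 2)) in *.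
destruct (Rlt_le_dec (Rabs (s - IZR n)) d) as [|Hge]; [easy|exfalso].
assert (Hle : Rabs (s - IZR n) <= 1 / 2) by (apply Rabs_le; lra).
rewrite <- (cos_IZR_period (2 * PI * s) (- n)), opp_IZR in Hcos.
replace (2 * PI * s + 2 * PI * - IZR n) with (2 * PI * (s - IZR n)) in Hcos by ring.
pose proof PI_RGT_0.
assert (E : cos (2 * PI * (s - IZR n)) = cos (2 * PI * Rabs (s - IZR n))).
{ unfold Rabs; destruct Rcase_abs; [|easy]. rewrite <- cos_neg; f_equal; ring. }
rewrite E in Hcos.
enough (cos (2 * PI * Rabs (s - IZR n)) <= cos (2 * PI * d)) by lra.
destruct (Req_dec (Rabs (s - IZR n)) d) as [->|]; [lra|].
left; apply cos_decreasing_1; nra.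
Qed.

Lemma periodic_IZR (g : sfield) :
  (forall s t, g (s + 1) t = g s t /\ g s (t + 1) = g s t) ->
  forall (m n : Z) s t, g (s + IZR m) (t + IZR n) = g s t.
Proof.
intros Hg.
assert (Hnat : forall (k : nat) s t, g (s + INR k) t = g s t /\ g s (t + INR k) = g s t).
{ induction k as [|k IH]; intros s t; [now rewrite !Rplus_0_r|].
  rewrite S_INR, <- !Rplus_assoc.
  now rewrite (proj1 (Hg _ _)), (proj2 (Hg _ _)). }
assert (H1 : forall (m : Z) s t, g (s + IZR m) t = g s t).
{ intros m s t; destruct (Z_le_gt_dec 0 m).
  - rewrite <- (Z2Nat.id m), <- INR_IZR_INZ by easy; apply Hnat.
  - replace m with (- Z.of_nat (Z.to_nat (- m)))%Z by lia.
    rewrite opp_IZR, <- INR_IZR_INZ, <- (proj1 (Hnat (Z.to_nat (- m)) _ _)).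
    f_equal; ring. }
assert (H2 : forall (m : Z) s t, g s (t + IZR m) = g s t).
{ intros m s t; destruct (Z_le_gt_dec 0 m).
  - rewrite <- (Z2Nat.id m), <- INR_IZR_INZ by easy; apply Hnat.
  - replace m with (- Z.of_nat (Z.to_nat (- m)))%Z by lia.
    rewrite opp_IZR, <- INR_IZR_INZ, <- (proj2 (Hnat (Z.to_nat (- m)) _ _)).
    f_equal; ring. }
intros m n s t; now rewrite H1, H2.
Qed.

(** Vanishing on the open cell propagates to the whole plane: reduce modulo the
    integers and approach the resulting point from the centre of the cell. *)
Lemma periodic_eq_0 (g : sfield) : continuous2 g ->
  (forall s t, g (s + 1) t = g s t /\ g s (t + 1) = g s t) ->
  (forall s t, 0 < s < 1 -> 0 < t < 1 -> g s t = 0) -> forall s t, g s t = 0.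
Proof.
intros Hc Hp H0.
assert (Hcell : forall s t, 0 <= s < 1 -> 0 <= t < 1 -> g s t = 0).
{ intros s t Hs Ht.
  set (f := fun u => g (u * (1 / 2 - s) + s) (u * (1 / 2 - t) + t)).
  assert (Hf : continuous f 0) by now apply continuous2_line.
  assert (E : f 0 = g s t) by (unfold f; f_equal; ring).
  rewrite <- E.
  destruct (Req_dec (f 0) 0) as [|Hn]; [easy|exfalso].
  destruct (proj1 (filterlim_locally _ _) Hf (mkposreal _ (Rabs_pos_lt _ Hn))) as [d Hd].
  assert (Hm : 0 < Rmin (d / 2) (1 / 2)) by (pose proof (cond_pos d); apply Rmin_case; lra).
  set (m := Rmin (d / 2) (1 / 2)) in *.
  assert (m <= d / 2) by apply Rmin_l.
  assert (m <= 1 / 2) by apply Rmin_r.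
  assert (Hb : Rabs (f m - f 0) < Rabs (f 0)).
  { apply (Hd m); change (Rabs (m - 0) < d); rewrite Rabs_pos_eq; lra. }
  replace (f m) with 0 in Hb.
  - replace (0 - f 0) with (- f 0) in Hb by ring; rewrite Rabs_Ropp in Hb; lra.
  - symmetry; apply H0; nra. }
intros s t.
destruct (archimed s) as [A1 A2], (archimed t) as [B1 B2].
rewrite <- (periodic_IZR g Hp (1 - up s) (1 - up t)).
apply Hcell; rewrite minus_IZR; lra.
Qed.

Context (Hdet : det2 v1 v2 <> 0).

(** [freq k] is the dual lattice vector, scaled by [2 PI], whose products with [v1] and
    [v2] are [2 PI] times the two entries of [k]. *)
Definition freq (k : Z * Z) (i : axis) : R :=
  match i with
  | ax1 => 2 * PI * (IZR (fst k) * snd v2 - IZR (snd k) * snd v1) / det2 v1 v2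
  | ax2 => 2 * PI * (IZR (snd k) * fst v1 - IZR (fst k) * fst v2) / det2 v1 v2
  end.

Lemma freq_v1 (k : Z * Z) : freq k ax1 * fst v1 + freq k ax2 * snd v1 = 2 * PI * IZR (fst k).
Proof. unfold freq, det2 in *; field; exact Hdet. Qed.

Lemma freq_v2 (k : Z * Z) : freq k ax1 * fst v2 + freq k ax2 * snd v2 = 2 * PI * IZR (snd k).
Proof. unfold freq, det2 in *; field; exact Hdet. Qed.

Definition phase (k : Z * Z) : sfield := fun x y => freq k ax1 * x + freq k ax2 * y.

Lemma elementary_phase (k : Z * Z) : elementary (phase k).
Proof.
apply el_plus; apply el_mult; first [apply el_const|apply el_fst|apply el_snd].
Qed.

Definition tchar (k : Z * Z) : tfun.
Proof.
refine (Tfun (fun x y => (cos (phase k x y), sin (phase k x y))) _ _).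
- split; simpl; apply elementary_smooth; constructor; apply elementary_phase.
- intros x y; unfold shift, phase; split; cbv beta.
  + replace (freq k ax1 * (x + fst v1) + freq k ax2 * (y + snd v1))
      with (freq k ax1 * x + freq k ax2 * y + 2 * PI * IZR (fst k))
      by (rewrite <- freq_v1; ring).
    now rewrite cos_IZR_period, sin_IZR_period.
  + replace (freq k ax1 * (x + fst v2) + freq k ax2 * (y + snd v2))
      with (freq k ax1 * x + freq k ax2 * y + 2 * PI * IZR (snd k))
      by (rewrite <- freq_v2; ring).
    now rewrite cos_IZR_period, sin_IZR_period.
Defined.

Definition kplus (j k : Z * Z) : Z * Z := (fst j + fst k, snd j + snd k)%Z.
Definition kopp (k : Z * Z) : Z * Z := (- fst k, - snd k)%Z.

Lemma phase_kplus j k x y : phase (kplus j k) x y = phase j x y + phase k x y.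
Proof. unfold phase, freq, kplus; simpl; rewrite !plus_IZR; field; exact Hdet. Qed.

Lemma phase_kopp k x y : phase (kopp k) x y = - phase k x y.
Proof. unfold phase, freq, kopp; simpl; rewrite !opp_IZR; field; exact Hdet. Qed.

Lemma tchar_kplus j k : tchar (kplus j k) = tmult (tchar j) (tchar k).
Proof.
apply tfun_ext; intros x y; simpl; rewrite phase_kplus, cos_plus, sin_plus.
apply C_ext; simpl; ring.
Qed.

Lemma tchar_0 : tchar (0, 0)%Z = tconst 1.
Proof.
apply tfun_ext; intros x y; simpl.
replace (phase (0, 0)%Z x y) with 0 by (unfold phase, freq; simpl; field; exact Hdet).
now rewrite cos_0, sin_0.
Qed.

Lemma tconj_tchar k : tconj (tchar k) = tchar (kopp k).
Proof.
apply tfun_ext; intros x y; simpl; rewrite phase_kopp, cos_neg, sin_neg; easy.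
Qed.

Lemma partial_phase i k : partial i (phase k) = fun _ _ => freq k i.
Proof.
apply functional_extensionality; intros x; apply functional_extensionality; intros y.
unfold partial, phase; destruct i;
  generalize (freq k ax1) (freq k ax2); intros a b;
  apply is_derive_unique; auto_derive; try easy; ring.
Qed.

Lemma tpartial_tchar i k :
  tpartial i (tchar k) = tmult (tconst (Cmult Ci (freq k i))) (tchar k).
Proof.
pose proof (elementary_derivable2 _ (elementary_phase k)).
apply tfun_ext; intros x y; simpl; unfold Cpartial; simpl.
rewrite partial_cos, partial_sin, partial_phase by easy.
apply C_ext; simpl; ring.
Qed.

Lemma phase_in_basis k s t :
  in_basis v1 v2 (phase k) s t = 2 * PI * (IZR (fst k) * s + IZR (snd k) * t).
Proof.
unfold in_basis, phase.
transitivity (s * (freq k ax1 * fst v1 + freq k ax2 * snd v1) +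
              t * (freq k ax1 * fst v2 + freq k ax2 * snd v2)); [ring|].
rewrite freq_v1, freq_v2; ring.
Qed.

(** The cosine with phase shift [a], written as a combination of two characters. *)
Definition tcos (k : Z * Z) (a : R) : tfun :=
  tmult (tconst (RtoC (/ 2)))
    (tplus (tmult (tconst (cos a, - sin a)) (tchar k))
           (tmult (tconst (cos a, sin a)) (tchar (kopp k)))).

(** The two phases combine by the addition formula; having trigonometric polynomials
    centred at any point is what localises the argument below. *)
Lemma tcos_ev k a x y : tcos k a x y = RtoC (cos (phase k x y - a)).
Proof.
simpl; rewrite phase_kopp, cos_neg, sin_neg, cos_minus; apply C_ext; simpl; field.
Qed.

Definition orthogonal_to_chars (f : tfun) : Prop :=
  forall k, tint (tmult f (tchar k)) = RtoC 0.

Lemma orthogonal_plus f g : orthogonal_to_chars f -> orthogonal_to_chars g ->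
  orthogonal_to_chars (tplus f g).
Proof.
intros Hf Hg k.
replace (tmult (tplus f g) (tchar k)) with (tplus (tmult f (tchar k)) (tmult g (tchar k)))
  by (apply tfun_ext; intros; simpl; ring).
rewrite tint_plus, Hf, Hg; apply Cplus_0_l.
Qed.

Lemma orthogonal_scal c f : orthogonal_to_chars f -> orthogonal_to_chars (tmult (tconst c) f).
Proof.
intros Hf k.
replace (tmult (tmult (tconst c) f) (tchar k)) with (tmult (tconst c) (tmult f (tchar k)))
  by (apply tfun_ext; intros; simpl; ring).
rewrite tint_scal, Hf; ring.
Qed.

Lemma orthogonal_tchar j f : orthogonal_to_chars f -> orthogonal_to_chars (tmult f (tchar j)).
Proof.
intros Hf k; rewrite <- (Hf (kplus j k)), tchar_kplus; f_equal.
apply tfun_ext; intros; simpl; ring.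
Qed.

Lemma orthogonal_tcos k a f : orthogonal_to_chars f -> orthogonal_to_chars (tmult f (tcos k a)).
Proof.
intros Hf.
replace (tmult f (tcos k a)) with (tmult (tconst (RtoC (/ 2)))
    (tplus (tmult (tconst (cos a, - sin a)) (tmult f (tchar k)))
           (tmult (tconst (cos a, sin a)) (tmult f (tchar (kopp k))))))
  by (apply tfun_ext; intros; simpl; ring).
apply orthogonal_scal, orthogonal_plus; now apply orthogonal_scal, orthogonal_tchar.
Qed.

(** Each factor lies between 0 and 2 and is 2 only at the points congruent to [s0], resp.
    [t0]; after division by [4 * q] with [q] just below 1 the product exceeds 1 only near
    the points congruent to [(s0, t0)]. *)
Definition tbump (q s0 t0 : R) : tfun :=
  tmult (tconst (RtoC (/ (4 * q))))
    (tmult (tplus (tconst 1) (tcos (1, 0)%Z (2 * PI * s0)))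
           (tplus (tconst 1) (tcos (0, 1)%Z (2 * PI * t0)))).

Definition bump (q s0 t0 : R) : sfield := fun s t =>
  / (4 * q) * ((1 + cos (2 * PI * (s - s0))) * (1 + cos (2 * PI * (t - t0)))).

Lemma tbump_in_basis q s0 t0 s t :
  tbump q s0 t0 (s * fst v1 + t * fst v2) (s * snd v1 + t * snd v2)
  = RtoC (bump q s0 t0 s t).
Proof.
assert (H : forall k a, tcos k a (s * fst v1 + t * fst v2) (s * snd v1 + t * snd v2) =
  RtoC (cos (2 * PI * (IZR (fst k) * s + IZR (snd k) * t) - a))).
{ intros k a; rewrite tcos_ev; do 3 f_equal; apply (phase_in_basis k s t). }
change (Cmult (RtoC (/ (4 * q))) (Cmult
  (Cplus 1 (tcos (1, 0)%Z (2 * PI * s0) (s * fst v1 + t * fst v2) (s * snd v1 + t * snd v2)))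
  (Cplus 1 (tcos (0, 1)%Z (2 * PI * t0) (s * fst v1 + t * fst v2) (s * snd v1 + t * snd v2))))
  = RtoC (bump q s0 t0 s t)).
rewrite !H; unfold bump; simpl fst; simpl snd.
replace (2 * PI * (1 * s + 0 * t) - 2 * PI * s0) with (2 * PI * (s - s0)) by ring.
replace (2 * PI * (0 * s + 1 * t) - 2 * PI * t0) with (2 * PI * (t - t0)) by ring.
apply C_ext; simpl; ring.
Qed.

Lemma orthogonal_tbump q s0 t0 f :
  orthogonal_to_chars f -> orthogonal_to_chars (tmult f (tbump q s0 t0)).
Proof.
intros Hf.
assert (Hc : forall k a g, orthogonal_to_chars g ->
  orthogonal_to_chars (tmult g (tplus (tconst 1) (tcos k a)))).
{ intros k a g Hg.
  replace (tmult g (tplus (tconst 1) (tcos k a))) with (tplus g (tmult g (tcos k a)))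
    by (apply tfun_ext; intros; simpl; ring).
  now apply orthogonal_plus; [|apply orthogonal_tcos]. }
unfold tbump.
set (A := tplus (tconst 1) (tcos (1, 0)%Z (2 * PI * s0))).
set (B := tplus (tconst 1) (tcos (0, 1)%Z (2 * PI * t0))).
replace (tmult f (tmult (tconst (RtoC (/ (4 * q)))) (tmult A B)))
  with (tmult (tconst (RtoC (/ (4 * q)))) (tmult (tmult f A) B))
  by (apply tfun_ext; intros; unfold tmult; simpl; ring).
now apply orthogonal_scal, Hc, Hc.
Qed.

Fixpoint tpow (f : tfun) (n : nat) : tfun :=
  match n with O => tconst 1 | S m => tmult f (tpow f m) end.

Lemma orthogonal_tpow q s0 t0 n : forall f,
  orthogonal_to_chars f -> orthogonal_to_chars (tmult f (tpow (tbump q s0 t0) n)).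
Proof.
induction n as [|n IH]; intros f Hf; simpl tpow.
- replace (tmult f (tconst 1)) with f; [easy|].
  apply tfun_ext; intros; simpl; ring.
- replace (tmult f (tmult (tbump q s0 t0) (tpow (tbump q s0 t0) n)))
    with (tmult (tmult f (tbump q s0 t0)) (tpow (tbump q s0 t0) n))
    by (apply tfun_ext; intros; unfold tmult; simpl; ring).
  now apply IH, orthogonal_tbump.
Qed.

Lemma tpow_tbump_in_basis q s0 t0 n s t :
  tpow (tbump q s0 t0) n (s * fst v1 + t * fst v2) (s * snd v1 + t * snd v2)
  = RtoC (bump q s0 t0 s t ^ n).
Proof.
induction n as [|n IH]; [easy|].
change (Cmult (tbump q s0 t0 (s * fst v1 + t * fst v2) (s * snd v1 + t * snd v2))
  (tpow (tbump q s0 t0) n (s * fst v1 + t * fst v2) (s * snd v1 + t * snd v2))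
  = RtoC (bump q s0 t0 s t ^ S n)).
rewrite IH, tbump_in_basis; apply C_ext; simpl; ring.
Qed.

Lemma continuous2_bump q s0 t0 : continuous2 (bump q s0 t0).
Proof.
apply elementary_continuous2, el_mult; [apply el_const|apply el_mult].
- apply el_plus, (el_cos (fun s _ => 2 * PI * (s - s0))); [apply el_const|].
  apply el_mult; [apply el_const|apply el_plus; [apply el_fst|apply el_const]].
- apply el_plus, (el_cos (fun _ t => 2 * PI * (t - t0))); [apply el_const|].
  apply el_mult; [apply el_const|apply el_plus; [apply el_snd|apply el_const]].
Qed.

Lemma in_basis_onto (x y : R) : exists s t,
  x = s * fst v1 + t * fst v2 /\ y = s * snd v1 + t * snd v2.
Proof.
exists ((x * snd v2 - y * fst v2) / det2 v1 v2), ((y * fst v1 - x * snd v1) / det2 v1 v2).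
unfold det2 in *; split; field; exact Hdet.
Qed.

Lemma tfun_eq_0_in_cell (f : tfun) :
  (forall s t, 0 < s < 1 -> 0 < t < 1 ->
     f (s * fst v1 + t * fst v2) (s * snd v1 + t * snd v2) = RtoC 0) -> f = tconst 0.
Proof.
intros H; apply tfun_ext; intros x y; simpl.
destruct (in_basis_onto x y) as (s & t & -> & ->).
apply C_ext; simpl.
- apply (periodic_eq_0 _ (continuous2_re f) (periodic_in_basis _ _ _ (periodic_re f))).
  intros; unfold in_basis; now rewrite H.
- apply (periodic_eq_0 _ (continuous2_im f) (periodic_in_basis _ _ _ (periodic_im f))).
  intros; unfold in_basis; now rewrite H.
Qed.

(** If [f] does not vanish at some point of the cell, it can be rotated to have positive
    real part near the points congruent to it.  The orthogonality passes to products
    with trigonometric polynomials, so all moments of the real part against the powers of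
    a bump centred there vanish, contradicting [moments_exclude_peak]. *)
Theorem tchar_complete (f : tfun) : orthogonal_to_chars f -> f = tconst 0.
Proof.
intros Hf; apply tfun_eq_0_in_cell; intros s0 t0 Hs0 Ht0.
set (z := f (s0 * fst v1 + t0 * fst v2) (s0 * snd v1 + t0 * snd v2)).
destruct (Ceq_dec z 0) as [|Hz]; [easy|exfalso].
(* [Conj z] turns the value [z] at the point into the positive real number [|z|^2]. *)
set (g := tmult (tconst (Cconj z)) f).
set (F := in_basis v1 v2 (fun x y => fst (g x y))).
assert (Hg : orthogonal_to_chars g) by now apply orthogonal_scal.
assert (HF0 : 0 < F s0 t0).
{ unfold F, in_basis, g; simpl; fold z.
  apply Cmod_gt_0 in Hz.
  assert (E : Cmod z ^ 2 = fst z * fst z - - snd z * snd z) by (rewrite Cmod2_alt; unfold Re, Im; ring).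
  rewrite <- E; now apply pow_lt. }
assert (HFc : continuous2 F) by apply continuous2_re.
assert (HFp : forall s t, F (s + 1) t = F s t /\ F s (t + 1) = F s t)
  by (apply periodic_in_basis, periodic_re).
assert (Hc : 0 < F s0 t0 / 2) by lra.
destruct (HFc s0 t0 (mkposreal _ Hc)) as [d Hd]; simpl in Hd.
(* The radius must be below 1/2 for the cosine to detect it; the threshold [q] is placed
   halfway between the value of the factor at that radius and its maximum. *)
set (d' := Rmin d (1 / 4)).
assert (Hd' : 0 < d' < 1 / 2).
{ split; [apply Rmin_case; [apply cond_pos|lra]|].
  apply Rle_lt_trans with (1 / 4); [apply Rmin_r|lra]. }
set (C := cos (2 * PI * d')).
assert (HC : -1 < C < 1).
{ unfold C; pose proof PI_RGT_0; split.
  - rewrite <- cos_PI; apply cos_decreasing_1; nra.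
  - rewrite <- cos_0; apply cos_decreasing_1; nra. }
set (q := (1 + C) / 2).
assert (Hq : 0 < q < 1) by (unfold q; lra).
assert (Hc1 : forall a, 0 <= 1 + cos a <= 2) by (intros a; pose proof (COS_bound a); lra).
apply (moments_exclude_peak F (bump q s0 t0) s0 t0 (F s0 t0 / 2)); try easy.
- apply continuous2_bump.
- intros s t; unfold bump; pose proof (Hc1 (2 * PI * (s - s0))); pose proof (Hc1 (2 * PI * (t - t0))).
  apply Rmult_le_pos; [left; apply Rinv_0_lt_compat; lra|nra].
- intros s t Hb; unfold bump in Hb.
  pose proof (Hc1 (2 * PI * (s - s0))) as H1; pose proof (Hc1 (2 * PI * (t - t0))) as H2.
  set (a := 1 + cos (2 * PI * (s - s0))) in *; set (b := 1 + cos (2 * PI * (t - t0))) in *.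
  assert (Hab : 4 * q < a * b).
  { apply (Rmult_lt_compat_l (4 * q)) in Hb; [|lra].
    rewrite <- Rmult_assoc, Rinv_r, Rmult_1_l, Rmult_1_r in Hb; lra. }
  assert (Ha : C < cos (2 * PI * (s - s0))) by (unfold a, q in *; nra).
  assert (Hb' : C < cos (2 * PI * (t - t0))) by (unfold b, q in *; nra).
  destruct (cos_large_near_integer d' _ Hd' Ha) as [m Hm].
  destruct (cos_large_near_integer d' _ Hd' Hb') as [n Hn].
  rewrite <- (periodic_IZR F HFp (- m) (- n) s t), !opp_IZR.
  assert (Rmin d (1 / 4) <= d) by apply Rmin_l.
  assert (HH : Rabs (F (s + - IZR m) (t + - IZR n) - F s0 t0) < F s0 t0 / 2).
  { apply Hd.
    - replace (s + - IZR m - s0) with (s - s0 - IZR m) by ring; unfold d' in *; lra.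
    - replace (t + - IZR n - t0) with (t - t0 - IZR n) by ring; unfold d' in *; lra. }
  apply Rabs_def2 in HH; lra.
- unfold bump; rewrite !Rminus_diag, !Rmult_0_r, cos_0.
  replace (/ (4 * q) * ((1 + 1) * (1 + 1))) with (/ q) by (field; lra).
  rewrite <- Rinv_1; apply Rinv_lt_contravar; lra.
- intros n.
  pose proof (orthogonal_tpow q s0 t0 n g Hg (0, 0)%Z) as H.
  rewrite tchar_0 in H; apply (f_equal fst) in H; simpl fst in H.
  rewrite <- H; unfold tint; simpl fst; f_equal.
  apply functional_extensionality; intros s; apply functional_extensionality; intros t.
  unfold in_basis at 1.
  change (F s t * bump q s0 t0 s t ^ n = fst (Cmult (Cmult
    (g (s * fst v1 + t * fst v2) (s * snd v1 + t * snd v2))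
    (tpow (tbump q s0 t0) n (s * fst v1 + t * fst v2) (s * snd v1 + t * snd v2))) 1)).
  rewrite tpow_tbump_in_basis.
  unfold F, in_basis; simpl; ring.
Qed.

(** * Enumerating the dual lattice *)

(** The zigzag bijection, composed below with the Cantor pairing, so that sums over the
    dual lattice are sums over the natural numbers. *)
Definition nat_of_Z (z : Z) : nat :=
  if (0 <=? z)%Z then (2 * Z.to_nat z)%nat else (2 * Z.to_nat (- z) - 1)%nat.

Definition Z_of_nat (n : nat) : Z :=
  if Nat.even n then Z.of_nat (Nat.div2 n) else (- Z.of_nat (Nat.div2 (S n)))%Z.

Lemma Z_of_nat_of_Z (z : Z) : Z_of_nat (nat_of_Z z) = z.
Proof.
unfold nat_of_Z, Z_of_nat; destruct (Z.leb_spec 0 z) as [H|H].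
- rewrite Nat.even_even.
  rewrite Nat.div2_double; lia.
- replace (2 * Z.to_nat (- z) - 1)%nat with (2 * (Z.to_nat (- z) - 1) + 1)%nat by lia.
  rewrite Nat.even_odd.
  replace (S (2 * (Z.to_nat (- z) - 1) + 1))%nat with (2 * Z.to_nat (- z))%nat by lia.
  rewrite Nat.div2_double; lia.
Qed.

Lemma nat_of_Z_of_nat (n : nat) : nat_of_Z (Z_of_nat n) = n.
Proof.
unfold Z_of_nat, nat_of_Z; destruct (Nat.even n) eqn:E.
- apply Nat.even_spec in E; destruct E as [m ->].
  rewrite Nat.div2_double; destruct (Z.leb_spec 0 (Z.of_nat m)); lia.
- assert (O : Nat.odd n = true) by (unfold Nat.odd; now rewrite E).
  apply Nat.odd_spec in O; destruct O as [m ->].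
  replace (S (2 * m + 1)) with (2 * S m)%nat by lia.
  rewrite Nat.div2_double; destruct (Z.leb_spec 0 (- Z.of_nat (S m))); lia.
Qed.

Definition dual (n : nat) : Z * Z :=
  (Z_of_nat (fst (Cantor.of_nat n)), Z_of_nat (snd (Cantor.of_nat n))).

Definition rank (k : Z * Z) : nat := Cantor.to_nat (nat_of_Z (fst k), nat_of_Z (snd k)).

Lemma dual_rank k : dual (rank k) = k.
Proof.
unfold dual, rank; rewrite Cantor.cancel_of_to; simpl; rewrite !Z_of_nat_of_Z.
now destruct k.
Qed.

Lemma rank_dual n : rank (dual n) = n.
Proof.
unfold dual, rank; simpl; rewrite !nat_of_Z_of_nat.
transitivity (Cantor.to_nat (Cantor.of_nat n)); [f_equal; now destruct (Cantor.of_nat n)|].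
apply Cantor.cancel_to_of.
Qed.

Lemma dual_inj m n : dual m = dual n -> m = n.
Proof. intros H; now rewrite <- (rank_dual m), H, rank_dual. Qed.

(** The weight measuring decay; being submultiplicative, it is compatible with
    convolution. *)
Definition wt (k : Z * Z) : R := 1 + Rabs (IZR (fst k)) + Rabs (IZR (snd k)).

Lemma wt_ge_1 k : 1 <= wt k.
Proof. unfold wt; pose proof (Rabs_pos (IZR (fst k))); pose proof (Rabs_pos (IZR (snd k))); lra. Qed.

Lemma wt_kopp k : wt (kopp k) = wt k.
Proof. unfold wt, kopp; simpl; now rewrite !opp_IZR, !Rabs_Ropp. Qed.

Lemma wt_kplus j k : wt (kplus j k) <= wt j * wt k.
Proof.
unfold wt, kplus; simpl; rewrite !plus_IZR.
pose proof (Rabs_triang (IZR (fst j)) (IZR (fst k))).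
pose proof (Rabs_triang (IZR (snd j)) (IZR (snd k))).
pose proof (Rabs_pos (IZR (fst j))); pose proof (Rabs_pos (IZR (snd j))).
pose proof (Rabs_pos (IZR (fst k))); pose proof (Rabs_pos (IZR (snd k))).
nra.
Qed.

Lemma INR_nat_of_Z z : INR (nat_of_Z z) <= 2 * Rabs (IZR z).
Proof.
unfold nat_of_Z; rewrite <- abs_IZR, INR_IZR_INZ, <- mult_IZR; apply IZR_le.
destruct (Z.leb_spec 0 z); lia.
Qed.

(** The Cantor pairing is quadratic, so the fourth power of the weight dominates the
    square of the index and is summable. *)
Lemma rank_le_wt k : INR (S (rank k)) <= 4 * wt k ^ 2.
Proof.
pose proof (Cantor.to_nat_spec (nat_of_Z (fst k)) (nat_of_Z (snd k))) as H.
fold (rank k) in H; apply (f_equal INR) in H.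
rewrite mult_INR, plus_INR, !mult_INR, (S_INR (_ + _)), !plus_INR in H; simpl (INR 2) in H.
rewrite S_INR.
pose proof (INR_nat_of_Z (fst k)) as H1; pose proof (INR_nat_of_Z (snd k)) as H2.
pose proof (pos_INR (nat_of_Z (fst k))); pose proof (pos_INR (nat_of_Z (snd k))).
unfold wt.
set (a := INR (nat_of_Z (fst k))) in *; set (b := INR (nat_of_Z (snd k))) in *.
set (u := Rabs (IZR (fst k))) in *; set (v := Rabs (IZR (snd k))) in *.
assert (INR (rank k) + 1 <= (1 + (a + b)) ^ 2) by nra.
assert (1 + (a + b) <= 2 * (1 + u + v)) by lra.
nra.
Qed.

(** * Sums over the dual lattice *)

Fixpoint rsum (a : nat -> R) (n : nat) : R :=
  match n with O => 0 | S m => rsum a m + a m end.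

Lemma rsum_sum_n a n : sum_n a n = rsum a (S n).
Proof.
induction n as [|n IH]; [rewrite sum_O; symmetry; apply Rplus_0_l|].
rewrite sum_Sn, IH; reflexivity.
Qed.

Lemma rsum_le a b n : (forall i, (i < n)%nat -> a i <= b i) -> rsum a n <= rsum b n.
Proof.
induction n as [|n IH]; intros H; simpl; [lra|].
apply Rplus_le_compat; auto.
Qed.

Lemma rsum_scal c a n : rsum (fun i => c * a i) n = c * rsum a n.
Proof. induction n as [|n IH]; simpl; [ring|rewrite IH; ring]. Qed.

Lemma rsum_nonneg a n : (forall i, 0 <= a i) -> 0 <= rsum a n.
Proof. intros H; induction n as [|n IH]; simpl; [lra|specialize (H n); lra]. Qed.

(** Telescoping: [1 / x^2 <= 2 / x - 2 / (x + 1)] for [x >= 1]. *)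
Lemma rsum_inv_sq_bound n : rsum (fun i => / INR (S i) ^ 2) n <= 2 - 2 * / INR (S n).
Proof.
induction n as [|n IH]; [simpl; lra|].
simpl rsum.
assert (H1 : 1 <= INR (S n)) by (rewrite S_INR; pose proof (pos_INR n); lra).
assert (H2 : INR (S (S n)) = INR (S n) + 1) by now rewrite S_INR.
set (x := INR (S n)) in *; rewrite H2.
enough (/ x ^ 2 <= 2 * / x - 2 * / (x + 1)) by (unfold x in *; simpl in *; lra).
replace (2 * / x - 2 * / (x + 1)) with (2 / (x * (x + 1))) by (field; lra).
apply Rmult_le_reg_r with (x ^ 2 * (x + 1)); [nra|].
replace (/ x ^ 2 * (x ^ 2 * (x + 1))) with (x + 1) by (field; nra).
replace (2 / (x * (x + 1)) * (x ^ 2 * (x + 1))) with (2 * x) by (field; lra).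
lra.
Qed.

Definition lsum (g : nat -> R) (l : list nat) : R :=
  List.fold_right (fun i s => g i + s) 0 l.

Lemma lsum_app g l l' : lsum g (l ++ l') = lsum g l + lsum g l'.
Proof. induction l as [|i l IH]; simpl; [ring|rewrite IH; ring]. Qed.

Lemma lsum_incl g l : (forall i, 0 <= g i) -> List.NoDup l ->
  forall l', List.incl l l' -> lsum g l <= lsum g l'.
Proof.
intros Hg; induction 1 as [|i l Hi _ IH]; intros l' Hl; simpl.
- induction l' as [|j l' IH']; simpl; [lra|specialize (Hg j)].
  enough (0 <= lsum g l') by lra; apply IH'; intros k [].
- destruct (List.in_split i l') as (l1 & l2 & ->); [apply Hl; now left|].
  rewrite lsum_app; simpl.
  enough (lsum g l <= lsum g (l1 ++ l2)) by (rewrite lsum_app in H; lra).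
  apply IH; intros j Hj.
  assert (Hj' : List.In j (l1 ++ i :: l2)) by (apply Hl; now right).
  apply List.in_app_or in Hj'; apply List.in_or_app.
  destruct Hj' as [|[<-|]]; [now left|contradiction|now right].
Qed.

Lemma lsum_seq g n : lsum g (List.seq 0 n) = rsum g n.
Proof.
induction n as [|n IH]; [easy|].
rewrite List.seq_S, lsum_app, IH; simpl; ring.
Qed.

Lemma lsum_map g (phi : nat -> nat) l : lsum g (List.map phi l) = lsum (fun i => g (phi i)) l.
Proof. induction l as [|i l IH]; simpl; [easy|now rewrite IH]. Qed.

(** A finite sum over distinct indices is part of a longer initial sum.  It replaces the
    invariance under translation of sums over the whole lattice. *)
Lemma rsum_reindex g (phi : nat -> nat) n : (forall i, 0 <= g i) ->
  (forall i j, phi i = phi j -> i = j) ->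
  exists m, rsum (fun i => g (phi i)) n <= rsum g m.
Proof.
intros Hg Hphi; exists (S (List.list_max (List.map phi (List.seq 0 n)))).
rewrite <- !lsum_seq, <- lsum_map; apply lsum_incl; [easy| |].
- apply FinFun.Injective_map_NoDup; [exact Hphi|apply List.seq_NoDup].
- intros i Hi; apply List.in_seq; split; [lia|].
  pose proof (proj1 (List.list_max_le (List.map phi (List.seq 0 n)) _) (le_n _)) as H.
  rewrite List.Forall_forall in H; specialize (H i Hi); lia.
Qed.

Lemma inv_wt_le k : / wt k ^ 4 <= 16 * / INR (S (rank k)) ^ 2.
Proof.
pose proof (rank_le_wt k) as H; pose proof (wt_ge_1 k) as H1.
assert (H2 : 0 < INR (S (rank k))) by (apply lt_0_INR; lia).
assert (H3 : 0 < wt k ^ 4) by (apply pow_lt; lra).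
assert (H4 : 0 < INR (S (rank k)) ^ 2) by now apply pow_lt.
apply Rmult_le_reg_r with (wt k ^ 4 * INR (S (rank k)) ^ 2); [now apply Rmult_lt_0_compat|].
replace (/ wt k ^ 4 * (wt k ^ 4 * INR (S (rank k)) ^ 2)) with (INR (S (rank k)) ^ 2)
  by (field; lra).
replace (16 * / INR (S (rank k)) ^ 2 * (wt k ^ 4 * INR (S (rank k)) ^ 2)) with ((4 * wt k ^ 2) ^ 2)
  by (field; lra).
apply pow_incr; lra.
Qed.

(** The bound is uniform in the translation [k]; this is what makes convolution with a
    rapidly decreasing family bounded for every polynomial weight. *)
Lemma rsum_wt_translate k n : rsum (fun i => / wt (kplus (dual i) k) ^ 4) n <= 32.
Proof.
apply Rle_trans with (rsum (fun i => 16 * / INR (S (rank (kplus (dual i) k))) ^ 2) n).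
- apply rsum_le; intros; apply inv_wt_le.
- rewrite rsum_scal.
  destruct (rsum_reindex (fun i => / INR (S i) ^ 2) (fun i => rank (kplus (dual i) k)) n) as [m Hm].
  + intros i; left; apply Rinv_0_lt_compat, pow_lt, lt_0_INR; lia.
  + intros i j H; apply (f_equal dual) in H; rewrite !dual_rank in H.
    apply dual_inj.
    pose proof (f_equal fst H) as H1; pose proof (f_equal snd H) as H2.
    cbn [kplus fst snd] in H1, H2.
    apply injective_projections; lia.
  + pose proof (rsum_inv_sq_bound m).
    assert (0 < / INR (S m)) by (apply Rinv_0_lt_compat, lt_0_INR; lia).
    lra.
Qed.

Definition rapid (a : Z * Z -> R) : Prop :=
  forall M : nat, exists B, forall k, wt k ^ M * Rabs (a k) <= B.

Lemma ex_series_bounded (a : nat -> R) (B : R) :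
  (forall n, 0 <= a n) -> (forall n, rsum a n <= B) -> ex_series a.
Proof.
intros Ha HB.
destruct (ex_finite_lim_seq_incr (sum_n a) B) as [l Hl].
- intros n; rewrite sum_Sn; specialize (Ha (S n)); change (sum_n a n <= sum_n a n + a (S n)); lra.
- intros n; rewrite rsum_sum_n; apply HB.
- now exists l.
Qed.

Lemma kplus_0_r k : kplus k (0, 0)%Z = k.
Proof. destruct k; unfold kplus; simpl; f_equal; lia. Qed.

Lemma rapid_rsum a : rapid a -> exists B, forall n, rsum (fun i => Rabs (a (dual i))) n <= B.
Proof.
intros Ha; destruct (Ha 4%nat) as [B HB]; exists (B * 32); intros n.
assert (HB0 : 0 <= B).
{ eapply Rle_trans; [|apply (HB (0, 0)%Z)].
  apply Rmult_le_pos; [apply pow_le; pose proof (wt_ge_1 (0, 0)%Z); lra|apply Rabs_pos]. }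
apply Rle_trans with (rsum (fun i => B * / wt (kplus (dual i) (0, 0)%Z) ^ 4) n).
- apply rsum_le; intros i _; rewrite kplus_0_r.
  pose proof (wt_ge_1 (dual i)).
  assert (0 < wt (dual i) ^ 4) by (apply pow_lt; lra).
  apply Rmult_le_reg_l with (wt (dual i) ^ 4); [easy|].
  replace (wt (dual i) ^ 4 * (B * / wt (dual i) ^ 4)) with B by (field; lra).
  apply HB.
- rewrite rsum_scal; apply Rmult_le_compat_l; [easy|apply rsum_wt_translate].
Qed.

Lemma rapid_ex_series a : rapid a -> ex_series (fun n => Rabs (a (dual n))).
Proof.
intros Ha; destruct (rapid_rsum a Ha) as [B HB].
apply (ex_series_bounded _ B); [intros; apply Rabs_pos|easy].
Qed.

Lemma rapid_plus a b : rapid a -> rapid b -> rapid (fun k => a k + b k).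
Proof.
intros Ha Hb M; destruct (Ha M) as [A HA], (Hb M) as [B HB]; exists (A + B); intros k.
specialize (HA k); specialize (HB k).
assert (0 <= wt k ^ M) by (apply pow_le; pose proof (wt_ge_1 k); lra).
pose proof (Rabs_triang (a k) (b k)); nra.
Qed.

Lemma rapid_le a b : (forall k, Rabs (a k) <= Rabs (b k)) -> rapid b -> rapid a.
Proof.
intros H Hb M; destruct (Hb M) as [B HB]; exists B; intros k.
eapply Rle_trans; [|apply (HB k)].
apply Rmult_le_compat_l; [apply pow_le; pose proof (wt_ge_1 k); lra|apply H].
Qed.

Lemma rapid_abs a : rapid a -> rapid (fun k => Rabs (a k)).
Proof. apply rapid_le; intros; rewrite Rabs_Rabsolu; lra. Qed.

Lemma rapid_mult_wt a b (L : R) : rapid a -> (forall k, Rabs (b k) <= L * wt k) ->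
  rapid (fun k => a k * b k).
Proof.
intros Ha Hb M; destruct (Ha (S M)) as [A HA]; exists (L * A); intros k.
assert (Hw : 0 <= wt k ^ M) by (apply pow_le; pose proof (wt_ge_1 k); lra).
assert (HL : 0 <= L).
{ pose proof (Hb k); pose proof (Rabs_pos (b k)); pose proof (wt_ge_1 k); nra. }
rewrite Rabs_mult.
apply Rle_trans with (L * (wt k ^ S M * Rabs (a k))).
- simpl; replace (L * (wt k * wt k ^ M * Rabs (a k))) with (wt k ^ M * (Rabs (a k) * (L * wt k))) by ring.
  apply Rmult_le_compat_l; [easy|apply Rmult_le_compat_l; [apply Rabs_pos|apply Hb]].
- now apply Rmult_le_compat_l.
Qed.

(** * Trigonometric series *)

(** The general term of a real trigonometric series, and its derivative. *)
Definition wave (a b t : R) : R := a * cos t + b * sin t.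
Definition wave' (a b t : R) : R := wave b (- a) t.

Lemma is_derive_wave a b t : is_derive (wave a b) t (wave' a b t).
Proof. unfold wave', wave; auto_derive; [easy|ring]. Qed.

Lemma wave_bound a b t : Rabs (wave a b t) <= Rabs a + Rabs b.
Proof.
unfold wave; pose proof (COS_bound t); pose proof (SIN_bound t).
eapply Rle_trans; [apply Rabs_triang|]; rewrite !Rabs_mult.
assert (Rabs (cos t) <= 1) by (apply Rabs_le; lra).
assert (Rabs (sin t) <= 1) by (apply Rabs_le; lra).
pose proof (Rabs_pos a); pose proof (Rabs_pos b); nra.
Qed.

Lemma mean_value_bound (f f' : R -> R) (B u v : R) : (forall t, is_derive f t (f' t)) ->
  (forall t, Rmin u v <= t <= Rmax u v -> Rabs (f' t) <= B) ->
  Rabs (f v - f u) <= B * Rabs (v - u).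
Proof.
intros Hf HB.
destruct (MVT_gen f u v f') as (c & Hc & ->).
- intros; apply Hf.
- intros; apply continuity_pt_filterlim.
  apply (ex_derive_continuous f); eexists; apply Hf.
- rewrite Rabs_mult; apply Rmult_le_compat_r; [apply Rabs_pos|now apply HB].
Qed.

(** First- and second-order bounds with constants proportional to the coefficients; after
    summation they give continuity and termwise differentiation of series. *)
Lemma wave_lipschitz a b t u :
  Rabs (wave a b u - wave a b t) <= (Rabs a + Rabs b) * Rabs (u - t).
Proof.
apply (mean_value_bound _ (wave' a b)); [apply is_derive_wave|].
intros; unfold wave'; rewrite (Rplus_comm (Rabs a)), <- (Rabs_Ropp a); apply wave_bound.
Qed.

Lemma wave_taylor a b t h :
  Rabs (wave a b (t + h) - wave a b t - h * wave' a b t) <= (Rabs a + Rabs b) * h ^ 2.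
Proof.
set (f := fun u => wave a b (t + u) - u * wave' a b t).
replace (wave a b (t + h) - wave a b t - h * wave' a b t) with (f h - f 0)
  by (unfold f; rewrite Rplus_0_r; ring).
replace (h ^ 2) with (Rabs h * Rabs (h - 0))
  by (rewrite Rminus_0_r, <- Rabs_mult, Rabs_pos_eq; [ring|nra]).
rewrite <- Rmult_assoc.
apply (mean_value_bound f (fun u => wave' a b (t + u) - wave' a b t)).
- intros u; unfold f, wave', wave; auto_derive; [easy|ring].
- intros u Hu.
  unfold wave'; eapply Rle_trans; [apply wave_lipschitz|].
  rewrite Rabs_Ropp, (Rplus_comm (Rabs b)).
  apply Rmult_le_compat_l; [pose proof (Rabs_pos a); pose proof (Rabs_pos b); lra|].
  replace (t + u - t) with u by ring.
  unfold Rmin, Rmax in Hu; destruct (Rle_dec 0 h);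
    [rewrite !Rabs_pos_eq|rewrite !Rabs_left1]; lra.
Qed.

Definition tseries (a b : Z * Z -> R) : sfield := fun x y =>
  Series (fun n => wave (a (dual n)) (b (dual n)) (phase (dual n) x y)).

Lemma ex_series_dominated (a b : nat -> R) :
  (forall n, Rabs (a n) <= b n) -> ex_series b -> ex_series a.
Proof. intros H; apply (ex_series_le (V := R_CompleteNormedModule)); exact H. Qed.

Lemma Series_dominated (a b : nat -> R) :
  (forall n, Rabs (a n) <= b n) -> ex_series b -> Rabs (Series a) <= Series b.
Proof.
intros H Hb.
eapply Rle_trans; [apply Series_Rabs|apply Series_le; [|easy]].
- apply ex_series_dominated with b; [|easy]; intros; rewrite Rabs_Rabsolu; apply H.
- intros n; split; [apply Rabs_pos|apply H].
Qed.

Lemma rapid_pair_series a b : rapid a -> rapid b ->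
  ex_series (fun n => Rabs (a (dual n)) + Rabs (b (dual n))).
Proof.
intros Ha Hb.
apply (ex_series_plus (V := R_NormedModule)); now apply rapid_ex_series.
Qed.

Lemma ex_tseries a b x y : rapid a -> rapid b ->
  ex_series (fun n => wave (a (dual n)) (b (dual n)) (phase (dual n) x y)).
Proof.
intros Ha Hb; eapply ex_series_dominated; [|now apply (rapid_pair_series a b)].
intros n; apply wave_bound.
Qed.

(** Differentiation costs one power of the weight. *)
Lemma freq_bound : exists L, forall i k, Rabs (freq k i) <= L * wt k.
Proof.
exists (2 * PI * (Rabs (fst v1) + Rabs (snd v1) + Rabs (fst v2) + Rabs (snd v2)) / Rabs (det2 v1 v2)).
pose proof PI_RGT_0.
assert (Hd : 0 < Rabs (det2 v1 v2)) by now apply Rabs_pos_lt.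
assert (Hk : forall (m n : Z) a b, Rabs (IZR m * a - IZR n * b) <=
   (Rabs a + Rabs b) * (1 + Rabs (IZR m) + Rabs (IZR n))).
{ intros m n a b; eapply Rle_trans; [apply Rabs_triang|].
  rewrite Rabs_Ropp, !Rabs_mult.
  pose proof (Rabs_pos a); pose proof (Rabs_pos b).
  pose proof (Rabs_pos (IZR m)); pose proof (Rabs_pos (IZR n)); nra. }
pose proof (Rabs_pos (fst v1)); pose proof (Rabs_pos (snd v1)).
pose proof (Rabs_pos (fst v2)); pose proof (Rabs_pos (snd v2)).
intros i k; unfold freq; pose proof (wt_ge_1 k).
assert (HS : forall z S, Rabs z <= S * wt k ->
  S <= Rabs (fst v1) + Rabs (snd v1) + Rabs (fst v2) + Rabs (snd v2) ->
  Rabs (2 * PI * z / det2 v1 v2) <= 2 * PI * (Rabs (fst v1) + Rabs (snd v1) + Rabs (fst v2) + Rabs (snd v2)) / Rabs (det2 v1 v2) * wt k).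
{ intros z S Hz HS; unfold Rdiv; rewrite !Rabs_mult, Rabs_inv.
  rewrite (Rabs_pos_eq 2), (Rabs_pos_eq PI) by lra.
  set (T := Rabs (fst v1) + Rabs (snd v1) + Rabs (fst v2) + Rabs (snd v2)) in *.
  replace (2 * PI * T * / Rabs (det2 v1 v2) * wt k) with (2 * PI * (T * wt k) * / Rabs (det2 v1 v2)) by ring.
  apply Rmult_le_compat_r; [left; now apply Rinv_0_lt_compat|].
  apply Rmult_le_compat_l; [lra|].
  eapply Rle_trans; [exact Hz|apply Rmult_le_compat_r; lra]. }
destruct i.
- apply (HS _ (Rabs (snd v2) + Rabs (snd v1))); [|lra]; apply Hk.
- apply (HS _ (Rabs (fst v1) + Rabs (fst v2))); [|lra].
  eapply Rle_trans; [apply Hk|]; unfold wt; apply Req_le; ring.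
Qed.

Lemma rapid_freq a i : rapid a -> rapid (fun k => a k * freq k i).
Proof.
intros Ha; destruct freq_bound as [L HL].
apply (rapid_mult_wt _ _ L); [easy|apply HL].
Qed.

Lemma rapid_opp a : rapid a -> rapid (fun k => - a k).
Proof. apply rapid_le; intros; rewrite Rabs_Ropp; lra. Qed.

Lemma phase_diff k x y x' y' :
  phase k x' y' - phase k x y = freq k ax1 * (x' - x) + freq k ax2 * (y' - y).
Proof. unfold phase; ring. Qed.

Lemma Series_scal_le (c : R) (a b : nat -> R) :
  ex_series b -> 0 <= c -> (forall n, Rabs (a n) <= b n * c) ->
  Rabs (Series a) <= Series b * c.
Proof.
intros Hb Hc H; rewrite <- Series_scal_r.
apply Series_dominated; [easy|now apply ex_series_scal_r].
Qed.

Lemma tseries_continuous2 a b : rapid a -> rapid b -> continuous2 (tseries a b).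
Proof.
intros Ha Hb x y eps.
set (g := fun k => (Rabs (a k) + Rabs (b k)) * (Rabs (freq k ax1) + Rabs (freq k ax2))).
assert (Hg : ex_series (fun n => g (dual n))).
{ destruct freq_bound as [L HL].
  assert (Hr : rapid g).
  { apply (rapid_mult_wt _ _ (L + L)).
    - apply rapid_plus; now apply rapid_abs.
    - intros k; rewrite Rabs_pos_eq.
      + rewrite Rmult_plus_distr_r; apply Rplus_le_compat; apply HL.
      + pose proof (Rabs_pos (freq k ax1)); pose proof (Rabs_pos (freq k ax2)); lra. }
  apply rapid_ex_series in Hr; revert Hr; apply ex_series_dominated; intros n; lra. }
assert (HG : 0 <= Series (fun n => g (dual n))).
{ replace 0 with (Series (fun n => 0 * g (dual n))) by (rewrite Series_scal_l; ring).
  apply Series_le; [|easy]; intros n; split; [lra|].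
  rewrite Rmult_0_l; unfold g; apply Rmult_le_pos; 
  [pose proof (Rabs_pos (a (dual n))); pose proof (Rabs_pos (b (dual n)))|
   pose proof (Rabs_pos (freq (dual n) ax1)); pose proof (Rabs_pos (freq (dual n) ax2))]; lra. }
set (G := Series (fun n => g (dual n))) in *.
assert (Hd : 0 < eps / (2 * (G + 1))) by (apply Rdiv_lt_0_compat; [apply cond_pos|lra]).
exists (mkposreal _ Hd); simpl; intros u v Hu Hv; unfold tseries.
rewrite <- Series_minus by now apply ex_tseries.
apply Rle_lt_trans with (G * (Rabs (u - x) + Rabs (v - y))).
- apply Series_scal_le; [easy| |].
  + pose proof (Rabs_pos (u - x)); pose proof (Rabs_pos (v - y)); lra.
  + intros n; eapply Rle_trans; [apply wave_lipschitz|].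
    unfold g; rewrite Rmult_assoc; apply Rmult_le_compat_l;
      [pose proof (Rabs_pos (a (dual n))); pose proof (Rabs_pos (b (dual n))); lra|].
    rewrite phase_diff; eapply Rle_trans; [apply Rabs_triang|]; rewrite !Rabs_mult.
    pose proof (Rabs_pos (freq (dual n) ax1)); pose proof (Rabs_pos (freq (dual n) ax2)).
    pose proof (Rabs_pos (u - x)); pose proof (Rabs_pos (v - y)); nra.
- apply Rle_lt_trans with (G * (eps / (G + 1))).
  + apply Rmult_le_compat_l; [easy|].
    replace (eps / (G + 1)) with (eps / (2 * (G + 1)) + eps / (2 * (G + 1))) by (field; lra).
    lra.
  + apply Rmult_lt_reg_r with (G + 1); [lra|].
    replace (G * (eps / (G + 1)) * (G + 1)) with (G * eps) by (field; lra).
    pose proof (cond_pos eps); nra.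
Qed.

(** Summing [wave_taylor] bounds the error of the first-order expansion by a constant times
    [h ^ 2].  The line [sh] treats both coordinate directions at once. *)
Lemma tseries_derive a b i x y (sh : R -> R * R) : rapid a -> rapid b ->
  sh = (fun h => match i with ax1 => (x + h, y) | ax2 => (x, y + h) end) ->
  is_derive (fun h => tseries a b (fst (sh h)) (snd (sh h))) 0
    (tseries (fun k => b k * freq k i) (fun k => - (a k * freq k i)) x y).
Proof.
intros Ha Hb Hsh.
set (g := fun k => (Rabs (a k) + Rabs (b k)) * freq k i * freq k i).
assert (Hg : ex_series (fun n => g (dual n))).
{ assert (Hr : rapid g).
  { apply (rapid_freq (fun k => (Rabs (a k) + Rabs (b k)) * freq k i)).
    apply (rapid_freq (fun k => Rabs (a k) + Rabs (b k))).
    apply rapid_plus; now apply rapid_abs. }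
  apply rapid_ex_series in Hr; revert Hr; apply ex_series_dominated; intros n; lra. }
assert (Hd1 : rapid (fun k => b k * freq k i)) by now apply rapid_freq.
assert (Hd2 : rapid (fun k => - (a k * freq k i))) by now apply rapid_opp, rapid_freq.
set (G := Series (fun n => g (dual n))).
assert (H2 : forall h, Rabs (tseries a b (fst (sh h)) (snd (sh h)) - tseries a b x y
   - h * tseries (fun k => b k * freq k i) (fun k => - (a k * freq k i)) x y) <= G * h ^ 2).
{ intros h; unfold tseries.
  rewrite <- Series_minus, <- Series_scal_l, <- Series_minus; try now apply ex_tseries.
  2: apply (ex_series_minus (V := R_NormedModule)); now apply ex_tseries.
  2: apply (ex_series_scal (V := R_NormedModule) h);
     exact (ex_tseries _ _ x y Hd1 Hd2).
  apply Series_scal_le; [easy|nra|].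
  intros n; set (k := dual n).
  assert (E : phase k (fst (sh h)) (snd (sh h)) = phase k x y + freq k i * h).
  { rewrite Hsh; unfold phase; destruct i; simpl; ring. }
  rewrite E.
  replace (h * wave (b k * freq k i) (- (a k * freq k i)) (phase k x y))
    with (freq k i * h * wave' (a k) (b k) (phase k x y)) by (unfold wave', wave; ring).
  eapply Rle_trans; [apply wave_taylor|apply Req_le; unfold g; ring]. }
assert (E0 : tseries a b (fst (sh 0)) (snd (sh 0)) = tseries a b x y).
{ rewrite Hsh; destruct i; simpl; f_equal; ring. }
apply is_derive_Reals; intros eps Heps.
assert (HG : 0 < Rabs G + 1) by (pose proof (Rabs_pos G); lra).
assert (Hd : 0 < eps / (Rabs G + 1)) by now apply Rdiv_lt_0_compat.
exists (mkposreal _ Hd); simpl; intros h Hh0 Hh.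
rewrite Rplus_0_l, E0.
set (D := tseries (fun k => b k * freq k i) (fun k => - (a k * freq k i)) x y) in *.
set (P := tseries a b (fst (sh h)) (snd (sh h)) - tseries a b x y) in *.
replace (P / h - D) with ((P - h * D) / h) by (field; easy).
unfold Rdiv; rewrite Rabs_mult, Rabs_inv.
assert (Hh' : 0 < Rabs h) by now apply Rabs_pos_lt.
apply Rmult_lt_reg_r with (Rabs h); [easy|].
rewrite Rmult_assoc, Rinv_l, Rmult_1_r by lra.
apply Rle_lt_trans with (G * h ^ 2); [apply H2|].
apply Rle_lt_trans with (Rabs G * (Rabs h * Rabs h)).
- rewrite <- Rabs_mult, (Rabs_pos_eq (h * h)) by nra.
  replace (h * h) with (h ^ 2) by ring.
  apply Rmult_le_compat_r; [nra|apply Rle_abs].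
- apply (Rmult_lt_compat_r (Rabs G + 1)) in Hh; [|lra].
  unfold Rdiv in Hh; rewrite Rmult_assoc, Rinv_l, Rmult_1_r in Hh by lra.
  nra.
Qed.

Lemma tseries_is_derive a b i x y : rapid a -> rapid b ->
  match i with
  | ax1 => is_derive (fun u => tseries a b u y) x
  | ax2 => is_derive (fun v => tseries a b x v) y
  end (tseries (fun k => b k * freq k i) (fun k => - (a k * freq k i)) x y).
Proof.
intros Ha Hb; pose proof (tseries_derive a b i x y _ Ha Hb eq_refl) as H.
assert (HT : forall (f : R -> R) z l, is_derive (fun h => f (z + h)) 0 l -> is_derive f z l).
{ intros f z l Hf.
  apply (is_derive_ext (fun u => f (z + (u - z)))); [intros; f_equal; ring|].
  evar_last.
  - apply (is_derive_comp (fun h => f (z + h)) (fun u => u - z)).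
    + rewrite Rminus_diag; exact Hf.
    + auto_derive; [easy|reflexivity].
  - unfold scal; simpl; unfold mult; simpl; ring. }
destruct i; [apply (HT (fun u => tseries a b u y))|apply (HT (fun v => tseries a b x v))];
  exact H.
Qed.

Lemma tseries_partial a b i : rapid a -> rapid b ->
  partial i (tseries a b) = tseries (fun k => b k * freq k i) (fun k => - (a k * freq k i)).
Proof.
intros Ha Hb; apply functional_extensionality; intros x; apply functional_extensionality; intros y.
pose proof (tseries_is_derive a b i x y Ha Hb) as H.
destruct i; now apply is_derive_unique.
Qed.

(** Trigonometric series with rapidly decreasing coefficients are stable under partial
    derivatives, so the coinduction principle applies. *)
Lemma tseries_smooth a b : rapid a -> rapid b -> smooth (tseries a b).
Proof.
intros Ha Hb.
apply (smooth_coind (fun f => exists a b, rapid a /\ rapid b /\ f = tseries a b)).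
2: now exists a, b.
clear a b Ha Hb; intros f (a & b & Ha & Hb & ->); repeat split.
- now apply tseries_continuous2.
- eexists; exact (tseries_is_derive a b ax1 x y Ha Hb).
- eexists; exact (tseries_is_derive a b ax2 x y Ha Hb).
- intros i; eexists _, _; split; [|split]; [| |now apply tseries_partial].
  + now apply rapid_freq.
  + now apply rapid_opp, rapid_freq.
Qed.

Definition Crapid (c : Z * Z -> C) : Prop := rapid (fun k => Cmod (c k)).

Lemma Crapid_re c : Crapid c -> rapid (fun k => fst (c k)).
Proof.
apply rapid_le; intros k; rewrite (Rabs_pos_eq (Cmod _)) by apply Cmod_ge_0.
eapply Rle_trans; [apply Rmax_l|apply Rmax_Cmod].
Qed.

Lemma Crapid_im c : Crapid c -> rapid (fun k => snd (c k)).
Proof.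
apply rapid_le; intros k; rewrite (Rabs_pos_eq (Cmod _)) by apply Cmod_ge_0.
eapply Rle_trans; [apply Rmax_r|apply Rmax_Cmod].
Qed.

Lemma tseries_periodic a b : periodic v1 v2 (tseries a b).
Proof.
intros x y; unfold tseries, shift; split; apply Series_ext; intros n;
  pose proof (ev_periodic (tchar (dual n)) x y) as [H1 H2]; simpl in H1, H2;
  unfold shift in H1, H2; unfold wave.
- pose proof (f_equal fst H1) as E1; pose proof (f_equal snd H1) as E2; simpl in E1, E2.
  now rewrite E1, E2.
- pose proof (f_equal fst H2) as E1; pose proof (f_equal snd H2) as E2; simpl in E1, E2.
  now rewrite E1, E2.
Qed.

(** The sum of the series with terms [c k * tchar k], split into its real and imaginary
    parts. *)
Definition synth (c : Z * Z -> C) (Hc : Crapid c) : tfun.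
Proof.
refine (Tfun (fun x y =>
  (tseries (fun k => fst (c k)) (fun k => - snd (c k)) x y,
   tseries (fun k => snd (c k)) (fun k => fst (c k)) x y)) _ _).
- split; simpl; apply tseries_smooth; try apply rapid_opp;
    first [now apply Crapid_re|now apply Crapid_im].
- intros x y.
  destruct (tseries_periodic (fun k => fst (c k)) (fun k => - snd (c k)) x y) as [H1 H2].
  destruct (tseries_periodic (fun k => snd (c k)) (fun k => fst (c k)) x y) as [H3 H4].
  unfold shift in *; split; now f_equal.
Defined.

Fixpoint tsum (c : Z * Z -> C) (n : nat) : tfun :=
  match n with
  | O => tconst 0
  | S m => tplus (tsum c m) (tmult (tconst (c (dual m))) (tchar (dual m)))
  end.

Lemma Series_split (a : nat -> R) n : ex_series a ->
  Series a = rsum a n + Series (fun i => a (n + i)%nat).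
Proof.
intros Ha; induction n as [|n IH]; simpl rsum; [rewrite Rplus_0_l; now apply Series_ext|].
rewrite IH, (Series_incr_1 (fun i => a (n + i)%nat)) by now apply ex_series_incr_n.
rewrite Nat.add_0_r, Rplus_assoc; do 2 f_equal; apply Series_ext; intros; f_equal; lia.
Qed.

Lemma tsum_ev c n x y : tsum c n x y =
  (rsum (fun n => wave (fst (c (dual n))) (- snd (c (dual n))) (phase (dual n) x y)) n,
   rsum (fun n => wave (snd (c (dual n))) (fst (c (dual n))) (phase (dual n) x y)) n).
Proof.
induction n as [|n IH]; [easy|].
simpl; rewrite IH; unfold wave; apply C_ext; simpl; ring.
Qed.

Lemma synth_tail c Hc n x y : Cmod (Cminus (synth c Hc x y) (tsum c n x y)) <=
  2 * (Series (fun i => 2 * Cmod (c (dual i))) - rsum (fun i => 2 * Cmod (c (dual i))) n).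
Proof.
assert (Hs : ex_series (fun i => 2 * Cmod (c (dual i)))).
{ apply (ex_series_scal (V := R_NormedModule) 2).
  apply rapid_ex_series in Hc; revert Hc; apply ex_series_dominated; intros; lra. }
rewrite (Series_split _ n Hs), Rplus_comm; unfold Rminus; rewrite Rplus_assoc, Rplus_opp_r, Rplus_0_r.
assert (Ht : forall a b, rapid a -> rapid b ->
   (forall k, Rabs (a k) <= Cmod (c k)) -> (forall k, Rabs (b k) <= Cmod (c k)) ->
   Rabs (tseries a b x y - rsum (fun n => wave (a (dual n)) (b (dual n)) (phase (dual n) x y)) n)
   <= Series (fun i => 2 * Cmod (c (dual (n + i)%nat)))).
{ intros a b Ha Hb Ha' Hb'; unfold tseries.
  rewrite (Series_split _ n (ex_tseries a b x y Ha Hb)), Rplus_comm; unfold Rminus.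
  rewrite Rplus_assoc, Rplus_opp_r, Rplus_0_r.
  apply Series_dominated.
  - intros i; eapply Rle_trans; [apply wave_bound|].
    specialize (Ha' (dual (n + i))); specialize (Hb' (dual (n + i))); lra.
  - now apply (ex_series_incr_n (fun i => 2 * Cmod (c (dual i)))). }
assert (Hre : forall k, Rabs (fst (c k)) <= Cmod (c k))
  by (intros; eapply Rle_trans; [apply Rmax_l|apply Rmax_Cmod]).
assert (Him : forall k, Rabs (snd (c k)) <= Cmod (c k))
  by (intros; eapply Rle_trans; [apply Rmax_r|apply Rmax_Cmod]).
set (T := Series _) in *.
rewrite tsum_ev.
assert (H1 := Ht _ _ (Crapid_re c Hc) (rapid_opp _ (Crapid_im c Hc)) Hre
  (fun k => eq_ind_r (fun r => r <= _) (Him k) (Rabs_Ropp _))).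
assert (H2 := Ht _ _ (Crapid_im c Hc) (Crapid_re c Hc) Him Hre).
eapply Rle_trans; [apply Cmod_2Rmax|].
assert (sqrt 2 <= 2) by (rewrite <- (sqrt_square 2) at 2 by lra; apply sqrt_le_1; lra).
assert (HT : 0 <= T) by (eapply Rle_trans; [apply Rabs_pos|exact H1]).
apply Rmult_le_compat; try easy; [apply sqrt_pos| |].
- eapply Rle_trans; [apply Rabs_pos|apply Rmax_l].
- apply Rmax_lub; [exact H1|exact H2].
Qed.

Lemma synth_tail_lim c : Crapid c ->
  forall eps, 0 < eps -> exists N, forall n, (N <= n)%nat ->
  2 * (Series (fun i => 2 * Cmod (c (dual i))) - rsum (fun i => 2 * Cmod (c (dual i))) n) < eps.
Proof.
intros Hc eps Heps.
assert (Hs : ex_series (fun i => 2 * Cmod (c (dual i)))).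
{ apply (ex_series_scal (V := R_NormedModule) 2).
  apply rapid_ex_series in Hc; revert Hc; apply ex_series_dominated; intros; lra. }
assert (He : 0 < eps / 2) by lra.
pose proof (Series_correct _ Hs) as Hl.
destruct (proj1 (filterlim_locally _ _) Hl (mkposreal _ He)) as [N HN].
exists (S N); intros n Hn; destruct n as [|n]; [lia|].
assert (Hb : Rabs (sum_n (fun i => 2 * Cmod (c (dual i))) n
  - Series (fun i => 2 * Cmod (c (dual i)))) < eps / 2) by (apply (HN n); lia).
rewrite rsum_sum_n in Hb; apply Rabs_def2 in Hb; lra.
Qed.

(** * The Hermitian structure *)

Lemma Cmod_sq (z : C) : Cmod z ^ 2 = fst z ^ 2 + snd z ^ 2.
Proof. apply Cmod2_alt. Qed.

Lemma Cmod_le_of_sq (z : C) (B : R) : 0 <= B -> Cmod z ^ 2 <= B ^ 2 -> Cmod z <= B.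
Proof. intros HB H; pose proof (Cmod_ge_0 z); nra. Qed.

(** The polynomial is the value of a nonnegative Hermitian form at [x + z y], with
    [p] and [r] its values at [x] and [y] and [g] the mixed term; minimizing over [z] gives
    the Cauchy-Schwarz inequality.  It is used for the scalar product and for the form
    [energy - lam * mass]. *)
Lemma discriminant_le (p r : R) (g : C) : 0 <= r ->
  (forall z : C, 0 <= p + 2 * fst (Cmult (Cconj z) g) + Cmod z ^ 2 * r) ->
  Cmod g ^ 2 <= p * r.
Proof.
intros Hr H.
assert (Ht : forall t : R, 0 <= p - 2 * t * Cmod g ^ 2 + t ^ 2 * Cmod g ^ 2 * r).
{ intros t; specialize (H (Cmult (RtoC (- t)) g)); rewrite Cmod_sq in H.
  rewrite Cmod_sq; destruct g as [a b]; simpl in *; nra. }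
set (G := Cmod g ^ 2) in *.
assert (HG : 0 <= G) by (unfold G; apply pow2_ge_0).
destruct (Rle_lt_or_eq_dec 0 r Hr) as [Hr'|<-].
- specialize (Ht (/ r)).
  replace (p - 2 * / r * G + (/ r) ^ 2 * G * r) with ((p * r - G) / r) in Ht by (field; lra).
  apply (Rmult_le_compat_r r) in Ht; [|easy].
  unfold Rdiv in Ht; rewrite Rmult_assoc, Rinv_l, Rmult_1_r in Ht by lra; lra.
- destruct (Rle_lt_or_eq_dec 0 G HG) as [HG'|]; [|lra].
  specialize (Ht ((p + 1) / (2 * G))).
  replace (2 * ((p + 1) / (2 * G)) * G) with (p + 1) in Ht by (field; lra).
  nra.
Qed.

Definition tip (f g : tfun) : C := tint (tmult f (tconj g)).

Definition tnsq (f : tfun) : R := fst (tip f f).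

Lemma tip_plus_l f g u : tip (tplus f g) u = Cplus (tip f u) (tip g u).
Proof. unfold tip; rewrite <- tint_plus; f_equal; ring. Qed.

Lemma tip_scal_l c f u : tip (tmult (tconst c) f) u = Cmult c (tip f u).
Proof. unfold tip; rewrite <- tint_scal; f_equal; ring. Qed.

Lemma tip_conj f g : tip g f = Cconj (tip f g).
Proof. unfold tip; rewrite <- tint_conj, tconj_mult, tconj_conj; f_equal; ring. Qed.

Lemma tip_plus_r f g u : tip u (tplus f g) = Cplus (tip u f) (tip u g).
Proof. now rewrite tip_conj, tip_plus_l, Cplus_conj, <- !tip_conj. Qed.

Lemma tip_scal_r c f u : tip u (tmult (tconst c) f) = Cmult (Cconj c) (tip u f).
Proof. now rewrite tip_conj, tip_scal_l, Cmult_conj, <- tip_conj. Qed.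

Lemma tip_mult_l w f g : tip (tmult w f) g = tip f (tmult (tconj w) g).
Proof. unfold tip; rewrite tconj_mult, tconj_conj; f_equal; ring. Qed.

Lemma tip_self f : tip f f = RtoC (tnsq f).
Proof.
apply C_ext; [easy|]; simpl.
pose proof (f_equal snd (tip_conj f f)) as H; simpl in H; lra.
Qed.

Lemma tnsq_re (f : tfun) x y : fst (tmult f (tconj f) x y) = Cmod (f x y) ^ 2.
Proof. rewrite Cmod_sq; simpl; ring. Qed.

Lemma tnsq_mult_le (w f : tfun) (B : R) : (forall x y, Cmod (w x y) <= B) ->
  tnsq (tmult w f) <= B ^ 2 * tnsq f.
Proof.
intros HB.
replace (B ^ 2 * tnsq f) with (fst (tint (tmult (tconst (RtoC (B ^ 2))) (tmult f (tconj f)))))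
  by (rewrite tint_scal; unfold tnsq, tip; simpl; ring).
unfold tnsq at 1, tip; apply tint_re_le; intros x y; rewrite (tnsq_re (tmult w f)).
replace (fst (tmult (tconst (RtoC (B ^ 2))) (tmult f (tconj f)) x y)) with (B ^ 2 * Cmod (f x y) ^ 2).
- change (tmult w f x y) with (Cmult (w x y) (f x y)).
  rewrite Cmod_mult, Rpow_mult_distr; apply Rmult_le_compat_r; [apply pow2_ge_0|].
  apply pow_incr; split; [apply Cmod_ge_0|apply HB].
- rewrite Cmod_sq; simpl; ring.
Qed.

Lemma tnsq_one : tnsq (tconst 1) = 1.
Proof. unfold tnsq, tip; rewrite tconj_const, <- tconst_mult, tint_const; simpl; ring. Qed.

Lemma tnsq_bound (f : tfun) (B : R) : (forall x y, Cmod (f x y) <= B) -> tnsq f <= B ^ 2.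
Proof.
intros HB; replace f with (tmult f (tconst 1)) by ring.
eapply Rle_trans; [apply (tnsq_mult_le f _ B HB)|rewrite tnsq_one; lra].
Qed.

Lemma tnsq_nonneg f : 0 <= tnsq f.
Proof.
replace 0 with (fst (tint (tconst 0))) by (now rewrite tint_const).
unfold tnsq, tip; apply tint_re_le; intros x y; rewrite (tnsq_re f); apply pow2_ge_0.
Qed.

Lemma tnsq_eq_0 f : tnsq f = 0 -> f = tconst 0.
Proof.
intros H; apply tfun_eq_0_in_cell; intros s t Hs Ht.
apply Cmod_eq_0.
assert (E : in_basis v1 v2 (fun x y => fst (tmult f (tconj f) x y)) s t = 0).
{ apply square_int_eq_0; try easy.
  - apply continuous2_re.
  - intros s' t'; unfold in_basis; rewrite (tnsq_re f); apply pow2_ge_0. }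
unfold in_basis in E; rewrite (tnsq_re f) in E.
set (m := Cmod _) in *; nra.
Qed.

Lemma tnsq_expand f g z : tnsq (tplus f (tmult (tconst z) g)) =
  tnsq f + 2 * fst (Cmult (Cconj z) (tip f g)) + Cmod z ^ 2 * tnsq g.
Proof.
unfold tnsq at 1.
rewrite !tip_plus_l, !tip_plus_r, !tip_scal_l, !tip_scal_r, !tip_self, (tip_conj f g), Cmod_sq.
simpl; ring.
Qed.

Lemma tip_cauchy_schwarz f g : Cmod (tip f g) ^ 2 <= tnsq f * tnsq g.
Proof.
apply discriminant_le; [apply tnsq_nonneg|].
intros z; rewrite <- tnsq_expand; apply tnsq_nonneg.
Qed.

Lemma tnsq_scal c f : tnsq (tmult (tconst c) f) = Cmod c ^ 2 * tnsq f.
Proof. unfold tnsq at 1; rewrite tip_scal_l, tip_scal_r, tip_self, Cmod_sq; simpl; ring. Qed.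

Lemma tnsq_conj f : tnsq (tconj f) = tnsq f.
Proof.
unfold tnsq, tip; rewrite tconj_conj; f_equal; f_equal; ring.
Qed.

Lemma tnsq_mult_tchar f k : tnsq (tmult f (tchar k)) = tnsq f.
Proof.
unfold tnsq, tip; rewrite tconj_mult, tconj_tchar; do 2 f_equal.
transitivity (tmult (tmult f (tconj f)) (tmult (tchar k) (tchar (kopp k)))); [ring|].
rewrite <- tchar_kplus.
replace (kplus k (kopp k)) with (0, 0)%Z by (unfold kplus, kopp; simpl; f_equal; lia).
rewrite tchar_0; ring.
Qed.

Lemma tnsq_tchar k : tnsq (tchar k) = 1.
Proof. rewrite <- tnsq_one, <- (tnsq_mult_tchar (tconst 1) k); f_equal; ring. Qed.

(** * The two halves of the flat Dirac operator *)

Definition tA (f : tfun) : tfun :=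
  tplus (tmult (tconst Ci) (tpartial ax1 f)) (tpartial ax2 f).

Definition tB (f : tfun) : tfun :=
  tminus (tmult (tconst Ci) (tpartial ax1 f)) (tpartial ax2 f).

Lemma tconst_0_l (f : tfun) : tmult (tconst 0) f = tconst 0.
Proof. ring. Qed.

Lemma tA_plus f g : tA (tplus f g) = tplus (tA f) (tA g).
Proof. unfold tA; rewrite !tpartial_plus; ring. Qed.

Lemma tA_mult f g : tA (tmult f g) = tplus (tmult (tA f) g) (tmult f (tA g)).
Proof. unfold tA; rewrite !tpartial_mult; ring. Qed.

Lemma tB_mult f g : tB (tmult f g) = tplus (tmult (tB f) g) (tmult f (tB g)).
Proof. unfold tB, tminus; rewrite !tpartial_mult; ring. Qed.

Lemma tA_const c : tA (tconst c) = tconst 0.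
Proof. unfold tA; rewrite !tpartial_const; ring. Qed.

Lemma tB_const c : tB (tconst c) = tconst 0.
Proof. unfold tB; rewrite !tpartial_const; ring. Qed.

Lemma tA_scal c f : tA (tmult (tconst c) f) = tmult (tconst c) (tA f).
Proof. rewrite tA_mult, tA_const; ring. Qed.

Lemma tB_scal c f : tB (tmult (tconst c) f) = tmult (tconst c) (tB f).
Proof. rewrite tB_mult, tB_const; ring. Qed.

Lemma tconj_tA f : tconj (tA f) = topp (tB (tconj f)).
Proof.
unfold tA, tB, tminus; rewrite tconj_plus, tconj_mult, tconj_const, !tpartial_conj.
replace (Cconj Ci) with (Copp Ci) by (apply C_ext; simpl; ring).
rewrite tconst_opp; ring.
Qed.

Lemma tint_tA f : tint (tA f) = RtoC 0.
Proof. unfold tA; rewrite tint_plus, tint_scal, !tint_partial by easy; ring. Qed.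

Lemma tint_tB f : tint (tB f) = RtoC 0.
Proof. unfold tB; rewrite tint_minus, tint_scal, !tint_partial by easy; ring. Qed.

Lemma tint_tA_parts f g : tint (tmult (tA f) g) = Copp (tint (tmult f (tA g))).
Proof.
pose proof (tint_tA (tmult f g)) as H; rewrite tA_mult, tint_plus in H.
replace (tint (tmult (tA f) g)) with
  (Cminus (Cplus (tint (tmult (tA f) g)) (tint (tmult f (tA g)))) (tint (tmult f (tA g)))) by ring.
rewrite H; ring.
Qed.

Lemma tint_tB_parts f g : tint (tmult (tB f) g) = Copp (tint (tmult f (tB g))).
Proof.
pose proof (tint_tB (tmult f g)) as H; rewrite tB_mult, tint_plus in H.
replace (tint (tmult (tB f) g)) with
  (Cminus (Cplus (tint (tmult (tB f) g)) (tint (tmult f (tB g)))) (tint (tmult f (tB g)))) by ring.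
rewrite H; ring.
Qed.

(** [A] and [B] are adjoint: integrating by parts gives a sign, and so does exchanging
    [A] with conjugation. *)
Lemma tip_tA f g : tip (tA f) g = tip f (tB g).
Proof.
unfold tip; rewrite tint_tA_parts, <- tint_opp; f_equal.
replace (tconj (tB g)) with (topp (tA (tconj g))).
- ring.
- rewrite <- (tconj_conj (tA (tconj g))), tconj_tA, tconj_conj, tconj_opp; ring.
Qed.

(** The multiplier by which [A] acts on characters; [B] acts by its conjugate. *)
Definition symbol (k : Z * Z) : C := (- freq k ax1, freq k ax2).

Lemma tA_tchar k : tA (tchar k) = tmult (tconst (symbol k)) (tchar k).
Proof.
unfold tA; rewrite !tpartial_tchar.
replace (symbol k) with (Cplus (Cmult Ci (Cmult Ci (freq k ax1))) (Cmult Ci (freq k ax2)))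
  by (apply C_ext; simpl; ring).
rewrite tconst_plus, !tconst_mult; ring.
Qed.

Lemma tB_tchar k : tB (tchar k) = tmult (tconst (Cconj (symbol k))) (tchar k).
Proof.
unfold tB, tminus; rewrite !tpartial_tchar.
replace (Cconj (symbol k)) with (Cplus (Cmult Ci (Cmult Ci (freq k ax1))) (Copp (Cmult Ci (freq k ax2))))
  by (apply C_ext; simpl; ring).
rewrite tconst_plus, tconst_opp, !tconst_mult; ring.
Qed.

Lemma symbol_kopp k : symbol (kopp k) = Copp (symbol k).
Proof.
unfold symbol, kopp, freq; simpl; rewrite !opp_IZR; apply C_ext; simpl; field; exact Hdet.
Qed.

(** Ellipticity: the modulus of the symbol is the length of the dual vector [freq k],
    whose products with [v1] and [v2] recover [k]. *)
Lemma wt_le_symbol : exists L, 0 <= L /\ forall k, wt k <= 1 + L * Cmod (symbol k).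
Proof.
exists ((Rabs (fst v1) + Rabs (snd v1) + Rabs (fst v2) + Rabs (snd v2)) / (2 * PI)).
pose proof PI_RGT_0.
pose proof (Rabs_pos (fst v1)); pose proof (Rabs_pos (snd v1)).
pose proof (Rabs_pos (fst v2)); pose proof (Rabs_pos (snd v2)).
split; [apply Rmult_le_pos; [lra|left; apply Rinv_0_lt_compat; lra]|].
intros k.
assert (F1 : Rabs (freq k ax1) <= Cmod (symbol k)).
{ eapply Rle_trans; [|apply Rmax_Cmod]; simpl; rewrite Rabs_Ropp; apply Rmax_l. }
assert (F2 : Rabs (freq k ax2) <= Cmod (symbol k)).
{ eapply Rle_trans; [|apply Rmax_Cmod]; simpl; apply Rmax_r. }
assert (Hb : forall (n : Z) a b, freq k ax1 * a + freq k ax2 * b = 2 * PI * IZR n ->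
  Rabs (IZR n) <= (Rabs a + Rabs b) / (2 * PI) * Cmod (symbol k)).
{ intros n a b E.
  apply Rmult_le_reg_l with (2 * PI); [lra|].
  replace (2 * PI * Rabs (IZR n)) with (Rabs (2 * PI * IZR n))
    by (rewrite !Rabs_mult, (Rabs_pos_eq 2), (Rabs_pos_eq PI); lra).
  rewrite <- E.
  replace (2 * PI * ((Rabs a + Rabs b) / (2 * PI) * Cmod (symbol k)))
    with ((Rabs a + Rabs b) * Cmod (symbol k)) by (field; lra).
  eapply Rle_trans; [apply Rabs_triang|]; rewrite !Rabs_mult.
  pose proof (Rabs_pos a); pose proof (Rabs_pos b); nra. }
pose proof (Hb _ _ _ (freq_v1 k)); pose proof (Hb _ _ _ (freq_v2 k)).
unfold wt, Rdiv in *; lra.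
Qed.

Lemma symbol_neq_0 k : k <> (0, 0)%Z -> symbol k <> RtoC 0.
Proof.
intros Hk E; destruct wt_le_symbol as (L & HL & H); specialize (H k).
rewrite E, Cmod_0, Rmult_0_r, Rplus_0_r in H; unfold wt in H.
pose proof (Rabs_pos (IZR (fst k))); pose proof (Rabs_pos (IZR (snd k))).
assert (Hz : forall n, Rabs (IZR n) <= 0 -> n = 0%Z).
{ intros n Hn; apply eq_IZR; destruct (Req_dec (IZR n) 0) as [|Hne]; [easy|].
  apply Rabs_pos_lt in Hne; lra. }
apply Hk, injective_projections; simpl; apply Hz; lra.
Qed.

(** * Fourier coefficients *)

Lemma kopp_kopp k : kopp (kopp k) = k.
Proof. destruct k; unfold kopp; simpl; f_equal; lia. Qed.

Definition coef (f : tfun) (k : Z * Z) : C := tint (tmult f (tchar (kopp k))).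

Lemma coef_tip f k : coef f k = tip f (tchar k).
Proof. unfold coef, tip; now rewrite tconj_tchar. Qed.

Lemma coef_plus f g k : coef (tplus f g) k = Cplus (coef f k) (coef g k).
Proof. rewrite !coef_tip; apply tip_plus_l. Qed.

Lemma coef_scal c f k : coef (tmult (tconst c) f) k = Cmult c (coef f k).
Proof. rewrite !coef_tip; apply tip_scal_l. Qed.

Lemma coef_minus f g k : coef (tminus f g) k = Cminus (coef f k) (coef g k).
Proof.
replace (tminus f g) with (tplus f (tmult (tconst (Copp 1)) g)) by (rewrite tconst_opp; ring).
rewrite coef_plus, coef_scal; ring.
Qed.

Lemma coef_le f k : Cmod (coef f k) ^ 2 <= tnsq f.
Proof.
rewrite coef_tip; eapply Rle_trans; [apply tip_cauchy_schwarz|].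
rewrite tnsq_tchar; lra.
Qed.

Lemma coef_tA f k : coef (tA f) k = Cmult (symbol k) (coef f k).
Proof.
unfold coef; rewrite tint_tA_parts, tA_tchar, symbol_kopp, tconst_opp.
replace (tmult f (tmult (topp (tconst (symbol k))) (tchar (kopp k)))) with
  (topp (tmult (tconst (symbol k)) (tmult f (tchar (kopp k))))) by ring.
rewrite tint_opp, tint_scal; ring.
Qed.

Lemma coef_tchar j k : coef (tchar j) k = if Nat.eq_dec (rank j) (rank k) then RtoC 1 else RtoC 0.
Proof.
unfold coef; rewrite <- tchar_kplus.
destruct Nat.eq_dec as [E|E].
- apply (f_equal dual) in E; rewrite !dual_rank in E; subst k.
  replace (kplus j (kopp j)) with (0, 0)%Z by (unfold kplus, kopp; simpl; f_equal; lia).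
  rewrite tchar_0; apply tint_const.
- set (m := kplus j (kopp k)).
  assert (Hm : m <> (0, 0)%Z).
  { intros H; apply E; f_equal; unfold m, kplus, kopp in H.
    pose proof (f_equal fst H) as H1; pose proof (f_equal snd H) as H2; cbn [fst snd] in H1, H2.
    apply injective_projections; lia. }
  apply symbol_neq_0 in Hm.
  pose proof (tint_tA (tchar m)) as H; rewrite tA_tchar, tint_scal in H.
  replace (tint (tchar m)) with (Cmult (Cinv (symbol m)) (Cmult (symbol m) (tint (tchar m))))
    by (field; easy).
  rewrite H; ring.
Qed.

Lemma coef_tsum c n k :
  coef (tsum c n) k = if lt_dec (rank k) n then c k else RtoC 0.
Proof.
induction n as [|n IH].
- simpl; unfold coef; rewrite tconst_0_l, tint_const; destruct (lt_dec (rank k) 0); [lia|easy].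
- simpl; rewrite coef_plus, IH, coef_scal, coef_tchar, rank_dual.
  destruct (lt_dec (rank k) n), (Nat.eq_dec n (rank k)), (lt_dec (rank k) (S n)); try lia; try ring.
  subst n; rewrite dual_rank; ring.
Qed.

Lemma tfun_sub_ev (f g : tfun) x y : tminus f g x y = Cminus (f x y) (g x y).
Proof. easy. Qed.

(** The partial sums have the prescribed coefficients from some index on, and a coefficient
    is bounded by the mean-square norm, hence by the supremum. *)
Lemma coef_synth c Hc k : coef (synth c Hc) k = c k.
Proof.
apply Ceq_minus, Cmod_eq_0.
destruct (Req_dec (Cmod (Cminus (coef (synth c Hc) k) (c k))) 0) as [|Hn]; [easy|exfalso].
pose proof (Cmod_ge_0 (Cminus (coef (synth c Hc) k) (c k))) as Hp.
set (m := Cmod _) in *.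
destruct (synth_tail_lim c Hc m) as [N HN]; [lra|].
set (n := Nat.max N (S (rank k))).
specialize (HN n ltac:(lia)).
set (T := 2 * (_ - _)) in *.
assert (HT : forall x y, Cmod (tminus (synth c Hc) (tsum c n) x y) <= T)
  by (intros; rewrite tfun_sub_ev; apply synth_tail).
assert (HT0 : 0 <= T) by (eapply Rle_trans; [apply Cmod_ge_0|apply (HT 0 0)]).
pose proof (coef_le (tminus (synth c Hc) (tsum c n)) k) as H.
rewrite coef_minus, coef_tsum in H.
destruct lt_dec as [_|]; [|lia].
pose proof (tnsq_bound _ _ HT) as H'; fold m in H; nra.
Qed.

(** Each power of the weight is absorbed by one application of [A], which multiplies the
    coefficients by the symbol. *)
Lemma coef_decay M : forall f, exists B, forall k, wt k ^ M * Cmod (coef f k) <= B.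
Proof.
induction M as [|M IH]; intros f.
- exists (sqrt (tnsq f)); intros k; rewrite Rmult_1_l.
  rewrite <- (sqrt_pow2 (Cmod (coef f k))) by apply Cmod_ge_0.
  apply sqrt_le_1; [apply pow2_ge_0|apply tnsq_nonneg|apply coef_le].
- destruct (IH f) as [B1 H1], (IH (tA f)) as [B2 H2], wt_le_symbol as (L & HL & HW).
  exists (B1 + L * B2); intros k; specialize (H1 k); specialize (H2 k); specialize (HW k).
  rewrite coef_tA, Cmod_mult in H2.
  assert (Hw : 0 <= wt k ^ M) by (apply pow_le; pose proof (wt_ge_1 k); lra).
  pose proof (Cmod_ge_0 (coef f k)).
  simpl.
  apply Rle_trans with ((1 + L * Cmod (symbol k)) * wt k ^ M * Cmod (coef f k)).
  + apply Rmult_le_compat_r; [easy|]; now apply Rmult_le_compat_r.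
  + apply (Rmult_le_compat_l L) in H2; [|easy]; lra.
Qed.

Lemma coef_rapid f : Crapid (coef f).
Proof.
intros M; destruct (coef_decay M f) as [B HB]; exists B; intros k.
rewrite Rabs_pos_eq by apply Cmod_ge_0; apply HB.
Qed.

Lemma tfun_ext_coef f g : (forall k, coef f k = coef g k) -> f = g.
Proof.
intros H.
assert (E : tminus f g = tconst 0).
{ apply tchar_complete; intros k.
  rewrite <- (kopp_kopp k); change (coef (tminus f g) (kopp k) = RtoC 0).
  rewrite coef_minus, H; ring. }
transitivity (tplus (tminus f g) g); [ring|rewrite E; ring].
Qed.

Lemma synth_coef f : synth (coef f) (coef_rapid f) = f.
Proof. apply tfun_ext_coef; intros k; apply coef_synth. Qed.

(** Boundedness comes for free from the absolutely convergent Fourier series. *)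
Lemma tfun_bounded (f : tfun) : exists B, 0 <= B /\ forall x y, Cmod (f x y) <= B.
Proof.
rewrite <- (synth_coef f); eexists.
assert (H : forall x y, Cmod (synth (coef f) (coef_rapid f) x y) <=
   2 * (Series (fun i => 2 * Cmod (coef f (dual i))) - rsum (fun i => 2 * Cmod (coef f (dual i))) 0)).
{ intros x y; eapply Rle_trans; [|apply (synth_tail _ (coef_rapid f) 0 x y)].
  change (tsum (coef f) 0 x y) with (RtoC 0).
  generalize (synth (coef f) (coef_rapid f) x y); intros z.
  apply Req_le; replace (Cminus z 0) with z by ring; easy. }
split; [|exact H]; eapply Rle_trans; [apply Cmod_ge_0|apply (H 0 0)].
Qed.

Lemma tsum_approx f : forall eps, 0 < eps -> exists N, forall n, (N <= n)%nat ->
  tnsq (tminus f (tsum (coef f) n)) <= eps ^ 2.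
Proof.
intros eps Heps; destruct (synth_tail_lim (coef f) (coef_rapid f) eps Heps) as [N HN].
exists N; intros n Hn; apply tnsq_bound; intros x y.
rewrite tfun_sub_ev, <- (synth_coef f) at 1.
eapply Rle_trans; [apply synth_tail|]; left; now apply HN.
Qed.

Lemma bessel_identity f n :
  tnsq f = rsum (fun i => Cmod (coef f (dual i)) ^ 2) n + tnsq (tminus f (tsum (coef f) n)).
Proof.
induction n as [|n IH]; cbn [rsum tsum].
- rewrite Rplus_0_l; replace (tminus f (tconst 0)) with f by ring; easy.
- rewrite IH, Rplus_assoc; f_equal.
  set (g := tminus f (tsum (coef f) n)).
  replace (tminus f (tplus (tsum (coef f) n) (tmult (tconst (coef f (dual n))) (tchar (dual n)))))
    with (tplus g (tmult (tconst (Copp (coef f (dual n)))) (tchar (dual n))))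
    by (unfold g; rewrite tconst_opp; ring).
  rewrite tnsq_expand, tnsq_tchar, Cmod_opp, <- coef_tip.
  assert (E : coef g (dual n) = coef f (dual n)).
  { unfold g; rewrite coef_minus, coef_tsum, rank_dual; destruct lt_dec; [lia|ring]. }
  rewrite E, Cmod_sq; simpl; ring.
Qed.

(** Beyond the index [N] the symbol is at least [1 / sqrt d], so the coefficients are small
    compared with those of [A f].  This is the compactness of the embedding of the
    Sobolev space: [N] does not depend on [f]. *)
Lemma tail_le_energy d : 0 < d -> exists N, forall f,
  tnsq (tminus f (tsum (coef f) N)) <= d * tnsq (tA f).
Proof.
intros Hd; destruct wt_le_symbol as (L & HL & HW).
set (D := / sqrt d).
assert (HsD : 0 < sqrt d) by now apply sqrt_lt_R0.
assert (HD : 0 < D) by now apply Rinv_0_lt_compat.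
destruct (archimed (4 * (1 + L * D) ^ 2)) as [HN _].
set (N := Z.to_nat (up (4 * (1 + L * D) ^ 2))); exists N; intros f.
assert (HN0 : 4 * (1 + L * D) ^ 2 < INR N).
{ unfold N; rewrite INR_IZR_INZ, Z2Nat.id; [lra|].
  apply le_IZR; assert (0 <= (1 + L * D) ^ 2) by apply pow2_ge_0; lra. }
assert (Hi : forall i, (N <= i)%nat -> Cmod (coef f (dual i)) ^ 2 <= d * Cmod (coef (tA f) (dual i)) ^ 2).
{ intros i Hi.
  assert (HS : D <= Cmod (symbol (dual i))).
  { destruct (Rle_lt_dec D (Cmod (symbol (dual i)))) as [|Hlt]; [easy|exfalso].
    pose proof (rank_le_wt (dual i)) as H1; rewrite rank_dual in H1.
    specialize (HW (dual i)); pose proof (wt_ge_1 (dual i)).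
    assert (H2 : wt (dual i) <= 1 + L * D) by nra.
    apply le_INR in Hi; rewrite S_INR in H1; nra. }
  rewrite coef_tA, Cmod_mult, Rpow_mult_distr.
  assert (1 <= d * Cmod (symbol (dual i)) ^ 2).
  { replace 1 with (d * D ^ 2).
    - apply Rmult_le_compat_l; [lra|]; apply pow_incr; lra.
    - unfold D; rewrite <- (sqrt_sqrt d) at 1 by lra; field; lra. }
  pose proof (pow2_ge_0 (Cmod (coef f (dual i)))); nra. }
assert (Hm : forall m, rsum (fun i => Cmod (coef f (dual i)) ^ 2) (N + m)
   - rsum (fun i => Cmod (coef f (dual i)) ^ 2) N <=
   d * (rsum (fun i => Cmod (coef (tA f) (dual i)) ^ 2) (N + m)
   - rsum (fun i => Cmod (coef (tA f) (dual i)) ^ 2) N)).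
{ induction m as [|m IH]; [rewrite Nat.add_0_r; lra|].
  rewrite Nat.add_succ_r; cbn [rsum]; specialize (Hi (N + m)%nat ltac:(lia)); lra. }
apply Rle_plus_epsilon; intros eps Heps.
destruct (tsum_approx f (sqrt eps)) as [K HK]; [now apply sqrt_lt_R0|].
specialize (HK (N + K)%nat ltac:(lia)).
rewrite pow2_sqrt in HK by lra.
pose proof (bessel_identity f N) as E1.
pose proof (bessel_identity f (N + K)) as E2.
pose proof (bessel_identity (tA f) (N + K)) as E3.
pose proof (tnsq_nonneg (tminus (tA f) (tsum (coef (tA f)) (N + K)))) as E4.
specialize (Hm K).
assert (0 <= rsum (fun i => Cmod (coef (tA f) (dual i)) ^ 2) N)
  by (apply rsum_nonneg; intros; apply pow2_ge_0).
nra.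
Qed.

(** * Limits along a free ultrafilter *)

(** An ultrafilter limit exists for all bounded sequences simultaneously and is additive,
    which spares the extraction of diagonal subsequences. *)
Record free_ultrafilter (U : (nat -> Prop) -> Prop) : Prop := {
  ultra_mono : forall P Q : nat -> Prop, (forall n, P n -> Q n) -> U P -> U Q;
  ultra_and : forall P Q : nat -> Prop, U P -> U Q -> U (fun n => P n /\ Q n);
  ultra_ex : forall P : nat -> Prop, U P -> exists n, P n;
  ultra_or_not : forall P : nat -> Prop, U P \/ U (fun n => ~ P n);
  ultra_tail : forall N : nat, U (fun n => (N <= n)%nat) }.

Lemma free_ultrafilter_exists : exists U, free_ultrafilter U.
Proof.
set (F := fun P : nat -> Prop => exists N, forall n, (N <= n)%nat -> P n).
assert (HF : filter.ProperFilter F).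
{ constructor; [|constructor].
  - intros [N HN]; exact (HN N (le_n N)).
  - now exists 0%nat.
  - intros P Q [M HM] [N HN]; exists (Nat.max M N); intros n Hn; split; [apply HM|apply HN]; lia.
  - intros P Q HPQ [N HN]; exists N; intros n Hn; now apply HPQ, HN. }
destruct (filter.ultraFilterLemma HF) as (U & HU & HFU).
pose proof (filter.ultra_proper (UltraFilter := HU)) as [HU0 [HUT HUI HUS]].
exists U; constructor.
- intros P Q HPQ; now apply HUS.
- intros P Q HP HQ; exact (HUI P Q HP HQ).
- intros P HP; apply NNPP; intros Hn; apply HU0.
  apply (HUS P); [|easy]; intros n Hn'; apply Hn; now exists n.
- intros P; exact (filter.in_ultra_setVsetC P HU).
- intros N; apply HFU; now exists N.
Qed.

Section UltraLimit.

Context {U : (nat -> Prop) -> Prop} (HU : free_ultrafilter U).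

Definition ulim (a : nat -> C) (z : C) : Prop :=
  forall eps, 0 < eps -> U (fun n => Cmod (Cminus (a n) z) < eps).

Lemma ultra_and3 (P Q S : nat -> Prop) : (forall n, P n -> Q n -> S n) -> U P -> U Q -> U S.
Proof.
intros H HP HQ; apply (ultra_mono U HU) with (fun n => P n /\ Q n).
- intros n []; auto.
- now apply (ultra_and U HU).
Qed.

Lemma ultra_all (P : nat -> Prop) : (forall n, P n) -> U P.
Proof.
intros H; apply (ultra_mono U HU) with (fun n => (0 <= n)%nat); [auto|apply (ultra_tail U HU)].
Qed.

(** The limit is the supremum of the [x] such that [x <= a n] for almost all [n]. *)
Lemma real_ulim_exists (a : nat -> R) (B : R) : (forall n, Rabs (a n) <= B) ->
  exists x, forall eps, 0 < eps -> U (fun n => Rabs (a n - x) < eps).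
Proof.
intros HB.
assert (HB' : forall n, - B <= a n <= B) by (intros n; specialize (HB n); now apply Rabs_le_between).
destruct (completeness (fun x => U (fun n => x <= a n))) as [x [Hub Hlub]].
- exists B; intros x Hx; destruct (ultra_ex U HU _ Hx) as [n Hn]; specialize (HB' n); lra.
- exists (- B); apply ultra_all; intros n; apply HB'.
- exists x; intros eps Heps.
  assert (H1 : U (fun n => x - eps < a n)).
  { apply NNPP; intros Hn.
    assert (x <= x - eps / 2); [|lra].
    apply Hlub; intros e He.
    destruct (Rle_lt_dec e (x - eps / 2)) as [|Hlt]; [easy|exfalso; apply Hn].
    revert He; apply (ultra_mono U HU); intros; lra. }
  assert (H2 : U (fun n => a n < x + eps)).
  { destruct (ultra_or_not U HU (fun n => x + eps / 2 <= a n)) as [H|H].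
    - apply Hub in H; lra.
    - revert H; apply (ultra_mono U HU); intros; lra. }
  revert H1 H2; apply ultra_and3; intros n ? ?; apply Rabs_def1; lra.
Qed.

Lemma ulim_exists (a : nat -> C) (B : R) : (forall n, Cmod (a n) <= B) -> exists z, ulim a z.
Proof.
intros HB.
destruct (real_ulim_exists (fun n => fst (a n)) B) as [x Hx].
{ intros n; eapply Rle_trans; [|apply (HB n)].
  eapply Rle_trans; [apply Rmax_l|apply Rmax_Cmod]. }
destruct (real_ulim_exists (fun n => snd (a n)) B) as [y Hy].
{ intros n; eapply Rle_trans; [|apply (HB n)].
  eapply Rle_trans; [apply Rmax_r|apply Rmax_Cmod]. }
exists (x, y); intros eps Heps.
generalize (Hx (eps / 2) ltac:(lra)) (Hy (eps / 2) ltac:(lra)).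
apply ultra_and3; intros n H1 H2.
apply Rabs_def2 in H1; apply Rabs_def2 in H2.
assert (H : Cmod (Cminus (a n) (x, y)) ^ 2 < eps ^ 2) by (rewrite Cmod_sq; simpl; nra).
pose proof (Cmod_ge_0 (Cminus (a n) (x, y))); nra.
Qed.

Lemma ulim_unique a z z' : ulim a z -> ulim a z' -> z = z'.
Proof.
intros H H'; apply Ceq_minus, Cmod_eq_0.
destruct (Req_dec (Cmod (Cminus z z')) 0) as [|Hn]; [easy|exfalso].
pose proof (Cmod_ge_0 (Cminus z z')).
assert (He : 0 < Cmod (Cminus z z') / 2) by lra.
destruct (ultra_ex U HU _ (ultra_and U HU _ _ (H _ He) (H' _ He))) as (n & H1 & H2).
pose proof (Cmod_triangle (Cminus (a n) z') (Copp (Cminus (a n) z))) as H3.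
rewrite Cmod_opp in H3.
replace (Cplus (Cminus (a n) z') (Copp (Cminus (a n) z))) with (Cminus z z') in H3 by ring.
lra.
Qed.

Lemma ulim_plus a b z w : ulim a z -> ulim b w -> ulim (fun n => Cplus (a n) (b n)) (Cplus z w).
Proof.
intros Ha Hb eps Heps.
generalize (Ha (eps / 2) ltac:(lra)) (Hb (eps / 2) ltac:(lra)).
apply ultra_and3; intros n H1 H2.
pose proof (Cmod_triangle (Cminus (a n) z) (Cminus (b n) w)) as H3.
replace (Cminus (Cplus (a n) (b n)) (Cplus z w))
  with (Cplus (Cminus (a n) z) (Cminus (b n) w)) by ring.
lra.
Qed.

Lemma ulim_scal c a z : ulim a z -> ulim (fun n => Cmult c (a n)) (Cmult c z).
Proof.
intros Ha eps Heps.
pose proof (Cmod_ge_0 c).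
assert (He : 0 < eps / (Cmod c + 1)) by (apply Rdiv_lt_0_compat; lra).
generalize (Ha _ He); apply (ultra_mono U HU); intros n Hn.
replace (Cminus (Cmult c (a n)) (Cmult c z)) with (Cmult c (Cminus (a n) z)) by ring.
rewrite Cmod_mult.
apply (Rmult_lt_compat_r (Cmod c + 1)) in Hn; [|lra].
unfold Rdiv in Hn; rewrite Rmult_assoc, Rinv_l, Rmult_1_r in Hn by lra.
pose proof (Cmod_ge_0 (Cminus (a n) z)); nra.
Qed.

Lemma ulim_ext a b z : (forall n, a n = b n) -> ulim a z -> ulim b z.
Proof.
intros H Ha eps Heps; generalize (Ha eps Heps).
apply (ultra_mono U HU); intros n; now rewrite H.
Qed.

Lemma ulim_bound a z B : (forall n, Cmod (a n) ^ 2 <= B) -> ulim a z -> Cmod z ^ 2 <= B.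
Proof.
intros HB Ha.
assert (HB0 : 0 <= B) by (eapply Rle_trans; [apply (pow2_ge_0 (Cmod (a 0%nat)))|apply HB]).
rewrite <- (pow2_sqrt B) by easy.
apply pow_incr; split; [apply Cmod_ge_0|].
apply Rle_plus_epsilon; intros eps Heps.
destruct (ultra_ex U HU _ (Ha eps Heps)) as [n Hn].
pose proof (Cmod_triangle (a n) (Copp (Cminus (a n) z))) as H3.
rewrite Cmod_opp in H3; replace (Cplus (a n) (Copp (Cminus (a n) z))) with z in H3 by ring.
assert (Cmod (a n) <= sqrt B); [|lra].
apply Cmod_le_of_sq; [apply sqrt_pos|rewrite pow2_sqrt; auto].
Qed.

Lemma ulim_0 a B : (forall n, Cmod (a n) ^ 2 <= B * / INR (S n)) -> ulim a (RtoC 0).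
Proof.
intros H eps Heps.
destruct (archimed (B / eps ^ 2)) as [HN _].
generalize (ultra_tail U HU (Z.to_nat (up (B / eps ^ 2)))); apply (ultra_mono U HU); intros n Hn.
replace (Cminus (a n) 0) with (a n) by ring.
assert (He : 0 < eps ^ 2) by now apply pow_lt.
assert (Hn' : B / eps ^ 2 < INR (S n)).
{ apply le_INR in Hn; rewrite S_INR; rewrite INR_IZR_INZ in Hn.
  assert (IZR (up (B / eps ^ 2)) <= IZR (Z.of_nat (Z.to_nat (up (B / eps ^ 2))))) by (apply IZR_le; lia).
  lra. }
assert (HS : 0 < INR (S n)) by (apply lt_0_INR; lia).
assert (H1 : Cmod (a n) ^ 2 < eps ^ 2).
{ eapply Rle_lt_trans; [apply H|].
  apply Rmult_lt_reg_r with (INR (S n)); [easy|].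
  rewrite Rmult_assoc, Rinv_l, Rmult_1_r by lra.
  apply (Rmult_lt_compat_l (eps ^ 2)) in Hn'; [|easy].
  replace (eps ^ 2 * (B / eps ^ 2)) with B in Hn' by (field; lra); lra. }
pose proof (Cmod_ge_0 (a n)); nra.
Qed.

End UltraLimit.

Lemma functional_choice_of_total {A B : Type} (P : A -> B -> Prop) :
  (forall a, exists b, P a b) -> exists f, forall a, P a (f a).
Proof.
intros H; exists (fun a => proj1_sig (constructive_indefinite_description _ (H a))).
intros a; apply proj2_sig.
Qed.

(** * Functionals bounded for the mean-square norm *)

Record bounded_functional (l : tfun -> C) : Prop := {
  bf_plus : forall f g, l (tplus f g) = Cplus (l f) (l g);
  bf_scal : forall c f, l (tmult (tconst c) f) = Cmult c (l f);
  bf_bound : exists B, 0 <= B /\ forall f, Cmod (l f) ^ 2 <= B * tnsq f }.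

Lemma bf_opp l f : bounded_functional l -> l (topp f) = Copp (l f).
Proof.
intros Hl; replace (topp f) with (tmult (tconst (Copp 1)) f) by (rewrite tconst_opp; ring).
rewrite (bf_scal l Hl); ring.
Qed.

Lemma bf_0 l : bounded_functional l -> l (tconst 0) = RtoC 0.
Proof.
intros Hl; replace (tconst 0) with (tmult (tconst (RtoC 0)) (tconst 0)) by ring.
rewrite (bf_scal l Hl); ring.
Qed.

(** Bounded functionals are determined by their values on characters. *)
Lemma bf_close l f eps : bounded_functional l -> 0 < eps -> exists N, forall n, (N <= n)%nat ->
  Cmod (Cminus (l f) (l (tsum (coef f) n))) <= eps.
Proof.
intros Hl Heps; destruct (bf_bound l Hl) as (B & HB & Hb).
assert (He : 0 < eps / (B + 1)) by (apply Rdiv_lt_0_compat; lra).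
destruct (tsum_approx f _ He) as [N HN]; exists N; intros n Hn; specialize (HN n Hn).
apply Cmod_le_of_sq; [lra|].
replace (Cminus (l f) (l (tsum (coef f) n))) with (l (tminus f (tsum (coef f) n)))
  by (unfold tminus; rewrite (bf_plus l Hl), bf_opp by easy; ring).
eapply Rle_trans; [apply Hb|].
eapply Rle_trans; [apply Rmult_le_compat_l; [easy|exact HN]|].
replace ((eps / (B + 1)) ^ 2) with (eps ^ 2 * / (B + 1) ^ 2) by (field; lra).
assert (B * / (B + 1) ^ 2 <= 1).
{ apply Rmult_le_reg_r with ((B + 1) ^ 2); [nra|].
  rewrite Rmult_assoc, Rinv_l, Rmult_1_r, Rmult_1_l by nra; nra. }
pose proof (pow2_ge_0 eps); nra.
Qed.

Lemma bf_eq_0 l : bounded_functional l -> (forall k, l (tchar k) = RtoC 0) ->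
  forall f, l f = RtoC 0.
Proof.
intros Hl H0 f.
assert (Hs : forall c n, l (tsum c n) = RtoC 0).
{ intros c n; induction n as [|n IH]; simpl; [now apply bf_0|].
  rewrite (bf_plus l Hl), (bf_scal l Hl), IH, H0; ring. }
apply Cmod_eq_0, Rle_antisym; [|apply Cmod_ge_0].
apply Rle_plus_epsilon; intros eps Heps.
destruct (bf_close l f eps Hl Heps) as [N HN]; specialize (HN N (le_n N)).
rewrite Hs in HN; replace (Cminus (l f) 0) with (l f) in HN by ring; lra.
Qed.

Lemma tint_bounded_functional u : bounded_functional (fun f => tint (tmult u f)).
Proof.
constructor.
- intros f g; rewrite <- tint_plus; f_equal; ring.
- intros c f; rewrite <- tint_scal; f_equal; ring.
- exists (tnsq u); split; [apply tnsq_nonneg|]; intros f.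
  pose proof (tip_cauchy_schwarz u (tconj f)) as H; rewrite tnsq_conj in H.
  unfold tip in H; now rewrite tconj_conj in H.
Qed.

(** The difference of the two functionals is bounded and vanishes on characters. *)
Lemma bf_represent l (Hl : bounded_functional l) (Hc : Crapid (fun k => l (tchar (kopp k)))) :
  forall f, l f = tint (tmult (synth (fun k => l (tchar (kopp k))) Hc) f).
Proof.
set (u := synth _ Hc); intros f.
enough (H : forall f, Cminus (l f) (tint (tmult u f)) = RtoC 0) by (now apply Ceq_minus).
apply (bf_eq_0 (fun f => Cminus (l f) (tint (tmult u f)))).
- pose proof (tint_bounded_functional u) as Hu; constructor.
  + intros g g'; rewrite (bf_plus l Hl), (bf_plus _ Hu); ring.
  + intros c g; rewrite (bf_scal l Hl), (bf_scal _ Hu); ring.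
  + destruct (bf_bound l Hl) as (B & HB & Hb), (bf_bound _ Hu) as (B' & HB' & Hb').
    exists (2 * (B + B')); split; [lra|]; intros g; specialize (Hb g); specialize (Hb' g).
    rewrite Cmod_sq in *.
    destruct (l g) as [a b], (tint (tmult u g)) as [a' b']; simpl in *.
    pose proof (pow2_ge_0 (a + a')); pose proof (pow2_ge_0 (b + b')); lra.
- intros k; pose proof (coef_synth _ Hc (kopp k)) as E; fold u in E; unfold coef in E.
  rewrite kopp_kopp in E; rewrite E; ring.
Qed.

(** Expanding [g] times a character, the value is a convolution of the coefficients of [g]
    with the values of [l].  As the weight is submultiplicative, [wt k ^ s] can be
    distributed over the two factors, and four more powers taken from the coefficients
    of [g] make the sum converge. *)
Lemma bf_mult_decay l g s : bounded_functional l ->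
  (exists B, forall k, wt k ^ s * Cmod (l (tchar (kopp k))) <= B) ->
  exists B, forall k, wt k ^ s * Cmod (l (tmult g (tchar (kopp k)))) <= B.
Proof.
intros Hl [B HB]; destruct (coef_decay (s + 4) g) as [D HD].
assert (HB0 : 0 <= B).
{ eapply Rle_trans; [|apply (HB (0, 0)%Z)].
  apply Rmult_le_pos; [apply pow_le; pose proof (wt_ge_1 (0, 0)%Z); lra|apply Cmod_ge_0]. }
assert (HD0 : 0 <= D).
{ eapply Rle_trans; [|apply (HD (0, 0)%Z)].
  apply Rmult_le_pos; [apply pow_le; pose proof (wt_ge_1 (0, 0)%Z); lra|apply Cmod_ge_0]. }
exists (B * D * 32); intros k.
set (f := tmult g (tchar (kopp k))).
assert (Hw : forall j, 0 < wt j ^ s) by (intros j; apply pow_lt; pose proof (wt_ge_1 j); lra).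
assert (Hf : forall j, coef f j = coef g (kplus j k)).
{ intros j; unfold f, coef.
  replace (kopp (kplus j k)) with (kplus (kopp k) (kopp j)) by (unfold kplus, kopp; simpl; f_equal; lia).
  rewrite tchar_kplus; f_equal; ring. }
assert (Hn : forall n, wt k ^ s * Cmod (l (tsum (coef f) n)) <=
   rsum (fun i => B * D * / wt (kplus (dual i) k) ^ 4) n).
{ induction n as [|n IH]; cbn [rsum tsum].
  - rewrite bf_0, Cmod_0 by easy; lra.
  - rewrite (bf_plus l Hl), (bf_scal l Hl).
    apply Rle_trans with (wt k ^ s * (Cmod (l (tsum (coef f) n)) +
      Cmod (Cmult (coef f (dual n)) (l (tchar (dual n)))))).
    { apply Rmult_le_compat_l; [left; apply Hw|apply Cmod_triangle]. }
    rewrite Rmult_plus_distr_l; apply Rplus_le_compat; [exact IH|].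
    rewrite Cmod_mult, Hf; set (j := dual n).
    specialize (HB (kopp j)); rewrite kopp_kopp, wt_kopp in HB.
    specialize (HD (kplus j k)).
    assert (Hwk : wt k ^ s <= wt j ^ s * wt (kplus j k) ^ s).
    { rewrite <- Rpow_mult_distr; apply pow_incr; split; [pose proof (wt_ge_1 k); lra|].
      replace k with (kplus (kopp j) (kplus j k)) at 1
        by (destruct k; unfold kplus, kopp; simpl; f_equal; lia).
      rewrite <- (wt_kopp j); apply wt_kplus. }
    assert (H4 : 0 < wt (kplus j k) ^ 4) by (apply pow_lt; pose proof (wt_ge_1 (kplus j k)); lra).
    set (a := Cmod (coef g (kplus j k))) in *; set (b := Cmod (l (tchar j))) in *.
    assert (Ha : 0 <= a) by apply Cmod_ge_0; assert (Hb : 0 <= b) by apply Cmod_ge_0.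
    apply Rle_trans with ((wt j ^ s * b) * (wt (kplus j k) ^ s * a)).
    { replace ((wt j ^ s * b) * (wt (kplus j k) ^ s * a))
        with ((wt j ^ s * wt (kplus j k) ^ s) * (a * b)) by ring.
      apply Rmult_le_compat_r; [now apply Rmult_le_pos|easy]. }
    rewrite pow_add in HD.
    assert (Ha' : wt (kplus j k) ^ s * a <= D * / wt (kplus j k) ^ 4).
    { apply Rmult_le_reg_r with (wt (kplus j k) ^ 4); [easy|].
      rewrite (Rmult_assoc D), Rinv_l, Rmult_1_r by lra; lra. }
    rewrite (Rmult_assoc B); apply Rmult_le_compat; try easy;
      apply Rmult_le_pos; try easy; left; apply Hw. }
apply Rle_plus_epsilon; intros eps Heps.
assert (He : 0 < eps / wt k ^ s) by (apply Rdiv_lt_0_compat; [easy|apply Hw]).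
destruct (bf_close l f _ Hl He) as [N HN]; specialize (HN N (le_n N)); specialize (Hn N).
rewrite rsum_scal in Hn.
pose proof (rsum_wt_translate k N) as H32.
pose proof (Cmod_triangle (l (tsum (coef f) N)) (Cminus (l f) (l (tsum (coef f) N)))) as H3.
replace (Cplus (l (tsum (coef f) N)) (Cminus (l f) (l (tsum (coef f) N)))) with (l f) in H3 by ring.
apply (Rmult_le_compat_l (wt k ^ s)) in H3; [|left; apply Hw].
apply (Rmult_le_compat_l (wt k ^ s)) in HN; [|left; apply Hw].
replace (wt k ^ s * (eps / wt k ^ s)) with eps in HN by (field; specialize (Hw k); lra).
apply (Rmult_le_compat_l (B * D)) in H32; [|now apply Rmult_le_pos].
lra.
Qed.

(** Off the origin the symbol does not vanish, so only the zeroth coefficient survives. *)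
Lemma tA_eq_0 u : tA u = tconst 0 -> u = tconst (coef u (0, 0)%Z).
Proof.
intros H; apply tfun_ext_coef; intros k.
replace (tconst (coef u (0, 0)%Z)) with (tmult (tconst (coef u (0, 0)%Z)) (tchar (0, 0)%Z))
  by (rewrite tchar_0; ring).
rewrite coef_scal, coef_tchar.
destruct Nat.eq_dec as [E|E].
- apply (f_equal dual) in E; rewrite !dual_rank in E; subst k; ring.
- pose proof (coef_tA u k) as H1; rewrite H in H1.
  assert (Hk : symbol k <> RtoC 0) by (apply symbol_neq_0; intros ->; now apply E).
  replace (coef u k) with (Cmult (Cinv (symbol k)) (Cmult (symbol k) (coef u k))) by (field; easy).
  rewrite <- H1; unfold coef; rewrite tconst_0_l, tint_const; ring.
Qed.

(** Elliptic regularity for the first-order system.  By [bf_mult_decay] the left sides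
    decay on characters as fast as [m] and [l] do, and the right sides are [l] and [m]
    multiplied by symbols of linear growth; so decay of order [s] improves to [s + 1]. *)
Lemma weak_system_smooth (rho : tfun) (lam : R) (l m : tfun -> C) :
  bounded_functional l -> bounded_functional m ->
  (forall f, m (tmult rho f) = Copp (l (tA f))) ->
  (forall f, Cmult (RtoC lam) (l (tmult rho f)) = Copp (m (tB f))) ->
  exists u w : tfun, (forall f, l f = tint (tmult u f)) /\ (forall f, m f = tint (tmult w f)) /\
    tA u = tmult rho w /\ tB w = tmult (tconst (RtoC lam)) (tmult rho u).
Proof.
intros Hl Hm HA HB.
assert (Hreg : forall s : nat,
  (exists B, forall k, wt k ^ s * Cmod (l (tchar (kopp k))) <= B) /\
  (exists B, forall k, wt k ^ s * Cmod (m (tchar (kopp k))) <= B)).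
{ induction s as [|s [IHl IHm]].
  - assert (H0 : forall l, bounded_functional l ->
      exists B, forall k, wt k ^ 0 * Cmod (l (tchar (kopp k))) <= B).
    { clear; intros l Hl; destruct (bf_bound l Hl) as (B & HB & Hb); exists (sqrt B); intros k.
      simpl; rewrite Rmult_1_l; apply Cmod_le_of_sq; [apply sqrt_pos|].
      rewrite pow2_sqrt by easy; specialize (Hb (tchar (kopp k))).
      rewrite tnsq_tchar in Hb; lra. }
    split; now apply H0.
  - destruct (bf_mult_decay l rho s Hl IHl) as [Bl HBl].
    destruct (bf_mult_decay m rho s Hm IHm) as [Bm HBm].
    destruct IHl as [Cl HCl], IHm as [Cm HCm].
    destruct (wt_le_symbol) as (L & HL & HW).
    assert (Hgain : forall (c : C) k B D, wt k ^ s * Cmod c <= B ->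
       wt k ^ s * (Cmod (symbol k) * Cmod c) <= D -> wt k ^ S s * Cmod c <= B + L * D).
    { intros c k B D H1 H2; specialize (HW k).
      assert (Hw : 0 <= wt k ^ s) by (apply pow_le; pose proof (wt_ge_1 k); lra).
      pose proof (Cmod_ge_0 c).
      apply Rle_trans with ((1 + L * Cmod (symbol k)) * (wt k ^ s * Cmod c)).
      - simpl; rewrite Rmult_assoc; apply Rmult_le_compat_r; [now apply Rmult_le_pos|easy].
      - apply (Rmult_le_compat_l L) in H2; [|easy]; lra. }
    split.
    + exists (Cl + L * Bm); intros k; apply Hgain; [apply HCl|].
      specialize (HBm k); rewrite HA, tA_tchar, (bf_scal l Hl), symbol_kopp in HBm by easy.
      now rewrite Cmod_opp, Cmod_mult, Cmod_opp in HBm.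
    + exists (Cm + L * (Rabs lam * Bl)); intros k; apply Hgain; [apply HCm|].
      specialize (HBl k).
      assert (E : Cmod (symbol k) * Cmod (m (tchar (kopp k))) =
        Rabs lam * Cmod (l (tmult rho (tchar (kopp k))))).
      { transitivity (Cmod (Cmult (RtoC lam) (l (tmult rho (tchar (kopp k))))));
          [|now rewrite Cmod_mult, Cmod_R].
        rewrite HB, tB_tchar, (bf_scal m Hm), symbol_kopp by easy.
        now rewrite Cmod_opp, Cmod_mult, Cmod_conj, Cmod_opp. }
      rewrite E; apply (Rmult_le_compat_l (Rabs lam)) in HBl; [lra|apply Rabs_pos]. }
assert (Hcl : Crapid (fun k => l (tchar (kopp k)))).
{ intros s; destruct (proj1 (Hreg s)) as [B HB']; exists B; intros k.
  rewrite Rabs_pos_eq by apply Cmod_ge_0; apply HB'. }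
assert (Hcm : Crapid (fun k => m (tchar (kopp k)))).
{ intros s; destruct (proj2 (Hreg s)) as [B HB']; exists B; intros k.
  rewrite Rabs_pos_eq by apply Cmod_ge_0; apply HB'. }
exists (synth _ Hcl), (synth _ Hcm).
pose proof (bf_represent l Hl Hcl) as El; pose proof (bf_represent m Hm Hcm) as Em.
set (u := synth _ Hcl) in *; set (w := synth _ Hcm) in *.
split; [exact El|split; [exact Em|split]].
- apply tfun_ext_coef; intros k; unfold coef.
  rewrite tint_tA_parts, <- El, <- HA, Em by easy; f_equal; ring.
- apply tfun_ext_coef; intros k; unfold coef.
  rewrite tint_tB_parts, <- Em, <- HB, El, <- tint_scal by easy; f_equal; ring.
Qed.

(** * The variational problem *)

Section Variational.

(** The function [k] stands for [1 / h]; both are real elements of the algebra. *)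
Context (h k : tfun) (Hh : tconj h = h) (Hk : tconj k = k) (Hhk : tmult h k = tconst 1).

Definition energy (v : tfun) : R := tnsq (tmult k (tA v)).
Definition mass (v : tfun) : R := tnsq (tmult h v).
Definition centred (v : tfun) : Prop := tint (tmult (tmult h h) v) = RtoC 0.

Lemma centred_plus u v z : centred u -> centred v -> centred (tplus u (tmult (tconst z) v)).
Proof.
unfold centred; intros Hu Hv.
replace (tmult (tmult h h) (tplus u (tmult (tconst z) v))) with
  (tplus (tmult (tmult h h) u) (tmult (tconst z) (tmult (tmult h h) v))) by ring.
rewrite tint_plus, tint_scal, Hu, Hv; ring.
Qed.

Lemma energy_expand u v z : energy (tplus u (tmult (tconst z) v)) =
  energy u + 2 * fst (Cmult (Cconj z) (tip (tmult k (tA u)) (tmult k (tA v)))) + Cmod z ^ 2 * energy v.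
Proof.
unfold energy; rewrite <- tnsq_expand; f_equal.
rewrite tA_plus, tA_scal; ring.
Qed.

Lemma mass_expand u v z : mass (tplus u (tmult (tconst z) v)) =
  mass u + 2 * fst (Cmult (Cconj z) (tip (tmult h u) (tmult h v))) + Cmod z ^ 2 * mass v.
Proof. unfold mass; rewrite <- tnsq_expand; f_equal; ring. Qed.

Lemma energy_scal c v : energy (tmult (tconst c) v) = Cmod c ^ 2 * energy v.
Proof. unfold energy; rewrite <- tnsq_scal; f_equal; rewrite tA_scal; ring. Qed.

Lemma mass_scal c v : mass (tmult (tconst c) v) = Cmod c ^ 2 * mass v.
Proof. unfold mass; rewrite <- tnsq_scal; f_equal; ring. Qed.

Lemma divide_h v w : tmult h v = w -> v = tmult k w.
Proof. intros <-; transitivity (tmult (tmult h k) v); [rewrite Hhk; ring|ring]. Qed.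

Lemma mass_eq_0 v : mass v = 0 -> v = tconst 0.
Proof. intros H; unfold mass in H; apply tnsq_eq_0, divide_h in H; rewrite H; ring. Qed.

Lemma tint_rho_neq_0 : tint (tmult h h) <> RtoC 0.
Proof.
intros H.
assert (E : mass (tconst 1) = 0).
{ unfold mass, tnsq, tip.
  replace (tmult (tmult h (tconst 1)) (tconj (tmult h (tconst 1)))) with (tmult h h).
  - now rewrite H.
  - rewrite tconj_mult, Hh, tconj_const.
    replace (Cconj 1) with (RtoC 1) by (apply C_ext; simpl; ring); ring. }
apply mass_eq_0 in E; apply (f_equal (fun f => fst (tint f))) in E.
rewrite !tint_const in E; simpl in E; lra.
Qed.

(** [lam] is the infimum of the energy on centred functions of mass 1.  The function
    [k ^ 2 tchar (1, 0)] shows that there are such functions. *)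
Lemma minimizing_sequence : exists lam, 0 <= lam /\
  (forall v, centred v -> lam * mass v <= energy v) /\
  forall n : nat, exists u, centred u /\ mass u = 1 /\ energy u <= lam + / INR (S n).
Proof.
set (E := fun q => exists v, centred v /\ mass v = 1 /\ q = - energy v).
assert (Hnorm : forall v, centred v -> mass v <> 0 ->
  exists u, centred u /\ mass u = 1 /\ energy u = energy v / mass v).
{ intros v Hv Hm.
  assert (Hp : 0 < mass v) by (pose proof (tnsq_nonneg (tmult h v)); unfold mass in *; lra).
  assert (Hc : Cmod (RtoC (/ sqrt (mass v))) ^ 2 = / mass v).
  { rewrite Cmod_sq; simpl; rewrite <- (sqrt_sqrt (mass v)) at 3 by lra.
    assert (sqrt (mass v) <> 0) by (apply Rgt_not_eq, sqrt_lt_R0; lra). field; easy. }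
  exists (tmult (tconst (RtoC (/ sqrt (mass v)))) v); split; [|split].
  - unfold centred in *.
    replace (tmult (tmult h h) (tmult (tconst (RtoC (/ sqrt (mass v)))) v)) with
      (tmult (tconst (RtoC (/ sqrt (mass v)))) (tmult (tmult h h) v)) by ring.
    rewrite tint_scal, Hv; ring.
  - rewrite mass_scal, Hc; field; lra.
  - rewrite energy_scal, Hc; field; lra. }
destruct (completeness E) as [lub [Hub Hlub]].
- exists 0; intros q (v & _ & _ & ->); pose proof (tnsq_nonneg (tmult k (tA v))).
  unfold energy; lra.
- set (v0 := tmult (tmult k k) (tchar (1, 0)%Z)).
  assert (Hv0 : centred v0).
  { unfold centred, v0.
    replace (tmult (tmult h h) (tmult (tmult k k) (tchar (1, 0)%Z))) with
      (tmult (tmult (tmult h k) (tmult h k)) (tchar (1, 0)%Z)) by ring.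
    rewrite Hhk.
    replace (tmult (tmult (tconst 1) (tconst 1)) (tchar (1, 0)%Z)) with
      (tmult (tchar (1, 0)%Z) (tchar (kopp (0, 0)%Z))) by (change (kopp (0, 0)%Z) with (0, 0)%Z; rewrite tchar_0; ring).
    change (coef (tchar (1, 0)%Z) (0, 0)%Z = RtoC 0); rewrite coef_tchar.
    now destruct Nat.eq_dec. }
  assert (Hm0 : mass v0 <> 0).
  { intros H; apply mass_eq_0 in H.
    assert (E1 : tchar (1, 0)%Z = tconst 0).
    { transitivity (tmult (tmult (tmult h k) (tmult h k)) (tchar (1, 0)%Z)); [rewrite Hhk; ring|].
      transitivity (tmult (tmult h h) v0); [unfold v0; ring|rewrite H; ring]. }
    pose proof (tnsq_tchar (1, 0)%Z) as H1; rewrite E1 in H1.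
    unfold tnsq, tip in H1; rewrite tconst_0_l, tint_const in H1; simpl in H1; lra. }
  destruct (Hnorm v0 Hv0 Hm0) as (u & Hu & Hu' & _).
  exists (- energy u); now exists u.
- exists (- lub); split; [|split].
  + enough (lub <= 0) by lra.
    apply Hlub; intros q (v & _ & _ & ->); pose proof (tnsq_nonneg (tmult k (tA v))).
    unfold energy; lra.
  + intros v Hv; destruct (Req_dec (mass v) 0) as [H0|H0].
    * rewrite H0; pose proof (tnsq_nonneg (tmult k (tA v))); unfold energy; lra.
    * destruct (Hnorm v Hv H0) as (u & Hu & Hu' & Eu).
      assert (- energy u <= lub) by (apply Hub; now exists u).
      assert (0 < mass v) by (pose proof (tnsq_nonneg (tmult h v)); unfold mass in *; lra).
      rewrite Eu in H; apply (Rmult_le_compat_r (mass v)) in H; [|lra].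
      replace (- (energy v / mass v) * mass v) with (- energy v) in H by (field; lra); lra.
  + intros n; apply NNPP; intros Hn.
    assert (Hpos : 0 < / INR (S n)) by (apply Rinv_0_lt_compat, lt_0_INR; lia).
    assert (lub <= lub - / INR (S n)); [|lra].
    apply Hlub; intros q (v & Hv & Hv' & ->).
    destruct (Rle_lt_dec (- energy v) (lub - / INR (S n))) as [|Hlt]; [easy|exfalso].
    apply Hn; exists v; repeat split; try easy; lra.
Qed.

(** An almost minimizer almost satisfies the Euler-Lagrange equation, by the
    Cauchy-Schwarz inequality for the nonnegative form [energy - lam * mass]. *)
Lemma almost_euler_lagrange lam u v :
  (forall v, centred v -> lam * mass v <= energy v) -> centred u -> centred v ->
  Cmod (Cminus (tip (tmult k (tA u)) (tmult k (tA v)))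
               (Cmult (RtoC lam) (tip (tmult h u) (tmult h v)))) ^ 2
  <= (energy u - lam * mass u) * (energy v - lam * mass v).
Proof.
intros Hlam Hu Hv; apply discriminant_le; [specialize (Hlam v Hv); lra|].
intros z; pose proof (Hlam _ (centred_plus u v z Hu Hv)) as H.
rewrite energy_expand, mass_expand in H.
set (a := tip _ _) in *; set (b := tip _ _) in *; simpl in *; lra.
Qed.

Lemma tint_mult_bound (u f : tfun) B : tnsq u <= B -> Cmod (tint (tmult u f)) ^ 2 <= B * tnsq f.
Proof.
intros HB.
pose proof (tip_cauchy_schwarz u (tconj f)) as H; rewrite tnsq_conj in H.
unfold tip in H; rewrite tconj_conj in H.
pose proof (tnsq_nonneg f); nra.
Qed.

Lemma limit_functional (U : (nat -> Prop) -> Prop) (HU : free_ultrafilter U)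
  (u : nat -> tfun) B : (forall n, tnsq (u n) <= B) ->
  exists l, bounded_functional l /\ forall f, ulim (U := U) (fun n => tint (tmult (u n) f)) (l f).
Proof.
intros HB.
assert (HB0 : 0 <= B) by (eapply Rle_trans; [apply (tnsq_nonneg (u 0%nat))|apply HB]).
destruct (functional_choice_of_total (fun f z => ulim (U := U) (fun n => tint (tmult (u n) f)) z)) as [l Hl].
- intros f; apply (ulim_exists HU _ (sqrt (B * tnsq f))); intros n.
  pose proof (tnsq_nonneg f).
  apply Cmod_le_of_sq; [apply sqrt_pos|].
  rewrite pow2_sqrt by nra; now apply tint_mult_bound.
- exists l; split; [|exact Hl]; constructor.
  + intros f g; apply (ulim_unique HU (fun n => tint (tmult (u n) (tplus f g)))); [apply Hl|].
    apply (ulim_ext HU) with (fun n => Cplus (tint (tmult (u n) f)) (tint (tmult (u n) g))).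
    * intros n; rewrite <- tint_plus; f_equal; ring.
    * now apply (ulim_plus HU).
  + intros c f; apply (ulim_unique HU (fun n => tint (tmult (u n) (tmult (tconst c) f)))); [apply Hl|].
    apply (ulim_ext HU) with (fun n => Cmult c (tint (tmult (u n) f))).
    * intros n; rewrite <- tint_scal; f_equal; ring.
    * now apply (ulim_scal HU).
  + exists B; split; [easy|]; intros f.
    apply (ulim_bound HU (fun n => tint (tmult (u n) f))); [|apply Hl].
    intros n; now apply tint_mult_bound.
Qed.

Definition eigenpair (lam : R) (u : tfun) : Prop :=
  tB (tmult (tmult k k) (tA u)) = tmult (tconst (RtoC lam)) (tmult (tmult h h) u).

(** Pair the equation with [u] and use the adjointness of [A] and [B]. *)
Lemma eigenpair_energy lam u : eigenpair lam u -> energy u = lam * mass u.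
Proof.
intros H; unfold energy, mass, tnsq.
assert (E : tip (tmult k (tA u)) (tmult k (tA u)) = Cmult (RtoC lam) (tip (tmult h u) (tmult h u))).
{ rewrite (tip_conj (tmult k (tA u))).
  rewrite tip_mult_l, Hk.
  replace (tmult k (tmult k (tA u))) with (tmult (tmult k k) (tA u)) by ring.
  rewrite tip_tA, H, tip_scal_r by easy.
  rewrite (tip_mult_l h u), Hh.
  replace (tmult h (tmult h u)) with (tmult (tmult h h) u) by ring.
  rewrite Cmult_conj, Cconj_conj, <- tip_conj, (tip_mult_l (tmult h h)), tconj_mult, Hh; easy. }
rewrite E; simpl; ring.
Qed.

(** The left side of the equation is a derivative and integrates to zero. *)
Lemma eigenpair_centred lam u : lam <> 0 -> eigenpair lam u -> centred u.
Proof.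
intros Hlam H; apply (f_equal tint) in H; rewrite tint_tB, tint_scal in H by easy.
unfold centred; set (z := tint _) in *.
assert (RtoC lam <> RtoC 0) by (intros E; apply Hlam; now injection E).
replace z with (Cmult (Cinv (RtoC lam)) (Cmult (RtoC lam) z)) by (field; easy).
rewrite <- H; ring.
Qed.

(** The limit functionals [l] and [m] of a minimizing sequence [u] and of
    [w = k ^ 2 A u] solve the first-order system weakly: the first equation by integrating
    by parts, the second by [almost_euler_lagrange].  The smooth solution representing
    them is an eigenfunction.  It is not zero because, by [tail_le_energy], finitely many
    coefficients carry a fixed part of the mass of all [u n]; and [lam] is not zero because
    a centred function with zero energy vanishes. *)
Theorem first_eigenvalue : exists lam u, 0 < lam /\ u <> tconst 0 /\ eigenpair lam u /\
  forall v, centred v -> lam * mass v <= energy v.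
Proof.
destruct minimizing_sequence as (lam & Hlam0 & Hmin & Hseq).
destruct (functional_choice_of_total _ Hseq) as [u Hu].
destruct free_ultrafilter_exists as [U HU].
set (w := fun n => tmult (tmult k k) (tA (u n))).
destruct (tfun_bounded h) as (Bh & HBh0 & HBh).
destruct (tfun_bounded k) as (Bk & HBk0 & HBk).
assert (Hen : forall n, energy (u n) <= lam + 1).
{ intros n; destruct (Hu n) as (_ & _ & H).
  assert (/ INR (S n) <= 1); [|lra].
  rewrite <- Rinv_1; apply Rinv_le_contravar; [lra|].
  rewrite S_INR; pose proof (pos_INR n); lra. }
assert (Hub : forall n, tnsq (u n) <= Bk ^ 2).
{ intros n; destruct (Hu n) as (_ & H & _).
  rewrite (divide_h (u n) _ eq_refl).
  eapply Rle_trans; [apply (tnsq_mult_le k _ Bk HBk)|].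
  unfold mass in H; rewrite H; lra. }
assert (Hwb : forall n, tnsq (w n) <= Bk ^ 2 * (lam + 1)).
{ intros n; unfold w.
  replace (tmult (tmult k k) (tA (u n))) with (tmult k (tmult k (tA (u n)))) by ring.
  eapply Rle_trans; [apply (tnsq_mult_le k _ Bk HBk)|].
  apply Rmult_le_compat_l; [apply pow2_ge_0|apply Hen]. }
destruct (limit_functional U HU u _ Hub) as (l & Hl & Ul).
destruct (limit_functional U HU w _ Hwb) as (m & Hm & Um).
assert (HA : forall f, m (tmult (tmult h h) f) = Copp (l (tA f))).
{ intros f.
  apply (ulim_unique HU (fun n => tint (tmult (w n) (tmult (tmult h h) f)))); [apply Um|].
  apply (ulim_ext HU) with (fun n => Cmult (Copp 1) (tint (tmult (u n) (tA f)))).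
  - intros n; transitivity (tint (tmult (tA (u n)) f)).
    + rewrite tint_tA_parts by easy; ring.
    + f_equal; unfold w.
      transitivity (tmult (tmult (tmult h k) (tmult h k)) (tmult (tA (u n)) f)); [rewrite Hhk; ring|ring].
  - replace (Copp (l (tA f))) with (Cmult (Copp 1) (l (tA f))) by ring.
    apply (ulim_scal HU), Ul. }
assert (HB : forall f, Cmult (RtoC lam) (l (tmult (tmult h h) f)) = Copp (m (tB f))).
{ intros f.
  (* The variation must be centred; subtracting a constant from [conj f] achieves this and
     changes neither side. *)
  set (c := Cdiv (tint (tmult (tmult h h) (tconj f))) (tint (tmult h h))).
  set (v := tplus (tconj f) (tconst (Copp c))).
  assert (Hv : centred v).
  { unfold centred, v.
    replace (tmult (tmult h h) (tplus (tconj f) (tconst (Copp c)))) with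
      (tplus (tmult (tmult h h) (tconj f)) (tmult (tconst (Copp c)) (tmult h h))) by ring.
    rewrite tint_plus, tint_scal; unfold c; field; apply tint_rho_neq_0. }
  assert (Hlim : ulim (U := U) (fun n => Cplus (Cmult (RtoC lam) (tint (tmult (u n) (tmult (tmult h h) f))))
     (tint (tmult (w n) (tB f)))) (RtoC 0)).
  { apply (ulim_0 HU) with (energy v - lam * mass v); intros n.
    destruct (Hu n) as (Hc & Hm1 & Hen1).
    pose proof (almost_euler_lagrange lam (u n) v Hmin Hc Hv) as H.
    assert (E1 : tip (tmult k (tA (u n))) (tmult k (tA v)) = Copp (tint (tmult (w n) (tB f)))).
    { unfold v; rewrite tA_plus, tA_const.
      unfold tip; rewrite <- tint_opp; f_equal; unfold w.
      replace (tplus (tA (tconj f)) (tconst 0)) with (tA (tconj f)) by ring.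
      rewrite tconj_mult, Hk, tconj_tA, tconj_conj; ring. }
    assert (E2 : tip (tmult h (u n)) (tmult h v) = tint (tmult (u n) (tmult (tmult h h) f))).
    { unfold tip, v; rewrite tconj_mult, Hh, tconj_plus, tconj_conj, tconj_const.
      replace (tmult (tmult h (u n)) (tmult h (tplus f (tconst (Cconj (Copp c)))))) with
        (tplus (tmult (u n) (tmult (tmult h h) f))
               (tmult (tconst (Cconj (Copp c))) (tmult (tmult h h) (u n)))) by ring.
      rewrite tint_plus, tint_scal, Hc; ring. }
    rewrite E1, E2 in H.
    replace (Cplus (Cmult lam (tint (tmult (u n) (tmult (tmult h h) f)))) (tint (tmult (w n) (tB f))))
      with (Copp (Cminus (Copp (tint (tmult (w n) (tB f))))
         (Cmult lam (tint (tmult (u n) (tmult (tmult h h) f)))))) by ring.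
    rewrite Cmod_opp; eapply Rle_trans; [exact H|].
    rewrite Rmult_comm; apply Rmult_le_compat_l; [specialize (Hmin v Hv); lra|].
    rewrite Hm1; lra. }
  assert (H0 := ulim_unique HU _ _ _ Hlim (ulim_plus HU _ _ _ _
    (ulim_scal HU (RtoC lam) _ _ (Ul (tmult (tmult h h) f))) (Um (tB f)))).
  set (a := l _) in *; set (b := m _) in *.
  replace (Cmult lam a) with (Cminus (Cplus (Cmult lam a) b) b) by ring.
  rewrite <- H0; ring. }
destruct (weak_system_smooth (tmult h h) lam l m Hl Hm HA HB)
  as (u' & w' & Eu & Ew & EA & EB).
assert (Heig : eigenpair lam u').
{ unfold eigenpair; rewrite EA, <- EB; f_equal.
  transitivity (tmult (tmult (tmult h k) (tmult h k)) w'); [ring|rewrite Hhk; ring]. }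
assert (Hcen : l (tmult h h) = RtoC 0).
{ apply (ulim_unique HU (fun n => tint (tmult (u n) (tmult h h)))); [apply Ul|].
  apply (ulim_0 HU) with 0; intros n; destruct (Hu n) as (Hc & _).
  replace (tmult (u n) (tmult h h)) with (tmult (tmult h h) (u n)) by ring.
  rewrite Hc, Cmod_0; lra. }
assert (Hne : u' <> tconst 0).
{ intros E.
  (* With [Bt] the tail contributes at most 1/4 to the mass; if [l] were zero, the finitely
     many low coefficients would contribute at most 1/4 for some [n], but the mass is 1. *)
  set (Bt := Bh ^ 2 * (Bh ^ 2 * (lam + 1)) + 1).
  assert (HBt : 1 <= Bt).
  { unfold Bt; pose proof (pow2_ge_0 Bh).
    assert (0 <= Bh ^ 2 * (lam + 1)) by nra; nra. }
  destruct (tail_le_energy (/ (4 * Bt))) as [N HN]; [apply Rinv_0_lt_compat; lra|].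
  assert (Hlow : forall M eps, 0 < eps ->
     U (fun n => rsum (fun i => Cmod (coef (u n) (dual i)) ^ 2) M < eps)).
  { induction M as [|M IH]; intros eps Heps; cbn [rsum].
    - now apply (ultra_all HU).
    - assert (Hs : 0 < sqrt (eps / 2)) by (apply sqrt_lt_R0; lra).
      pose proof (Ul (tchar (kopp (dual M))) _ Hs) as H1; rewrite Eu, E in H1.
      rewrite tconst_0_l, tint_const in H1.
      generalize (IH (eps / 2) ltac:(lra)) H1; apply (ultra_and3 HU); intros n H2 H3.
      replace (Cminus (tint (tmult (u n) (tchar (kopp (dual M))))) 0)
        with (coef (u n) (dual M)) in H3 by (unfold coef; ring).
      assert (H4 : Cmod (coef (u n) (dual M)) ^ 2 < eps / 2).
      { rewrite <- (pow2_sqrt (eps / 2)) by lra.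
        pose proof (Cmod_ge_0 (coef (u n) (dual M))); nra. }
      lra. }
  assert (Hs : 0 < / (4 * (Bh ^ 2 + 1))) by (apply Rinv_0_lt_compat; pose proof (pow2_ge_0 Bh); lra).
  destruct (ultra_ex U HU _ (Hlow N _ Hs)) as [n Hn].
  destruct (Hu n) as (_ & Hm1 & _).
  pose proof (bessel_identity (u n) N) as Hb.
  specialize (HN (u n)).
  assert (H1 : mass (u n) <= Bh ^ 2 * tnsq (u n)) by (apply (tnsq_mult_le h _ Bh HBh)).
  assert (H2 : tnsq (tA (u n)) <= Bh ^ 2 * (lam + 1)).
  { replace (tA (u n)) with (tmult h (tmult k (tA (u n)))).
    - eapply Rle_trans; [apply (tnsq_mult_le h _ Bh HBh)|].
      apply Rmult_le_compat_l; [apply pow2_ge_0|apply Hen].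
    - transitivity (tmult (tmult h k) (tA (u n))); [ring|rewrite Hhk; ring]. }
  rewrite Hm1 in H1.
  pose proof (pow2_ge_0 Bh) as Hb2.
  assert (H3 : Bh ^ 2 * rsum (fun i => Cmod (coef (u n) (dual i)) ^ 2) N <= 1 / 4).
  { apply Rle_trans with (Bh ^ 2 * / (4 * (Bh ^ 2 + 1))); [apply Rmult_le_compat_l; lra|].
    apply Rmult_le_reg_r with (4 * (Bh ^ 2 + 1)); [lra|].
    rewrite Rmult_assoc, Rinv_l by lra; lra. }
  assert (H4 : Bh ^ 2 * tnsq (tminus (u n) (tsum (coef (u n)) N)) <= 1 / 4).
  { apply Rle_trans with (Bh ^ 2 * (/ (4 * Bt) * (Bh ^ 2 * (lam + 1)))).
    - apply Rmult_le_compat_l; [easy|].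
      eapply Rle_trans; [exact HN|]; apply Rmult_le_compat_l; [|easy].
      left; apply Rinv_0_lt_compat; lra.
    - apply Rmult_le_reg_r with (4 * Bt); [lra|].
      replace (Bh ^ 2 * (/ (4 * Bt) * (Bh ^ 2 * (lam + 1))) * (4 * Bt))
        with (Bh ^ 2 * (Bh ^ 2 * (lam + 1))) by (field; lra).
      unfold Bt; lra. }
  rewrite Hb in H1; lra. }
exists lam, u'; repeat split; try easy.
destruct (Rle_lt_or_eq_dec 0 lam Hlam0) as [|E]; [easy|exfalso].
(* For [lam = 0] the energy of [u'] is zero, so [u'] is constant; being centred, it is 0. *)
apply Hne.
apply eigenpair_energy in Heig; rewrite <- E, Rmult_0_l in Heig.
unfold energy in Heig; apply tnsq_eq_0 in Heig.
assert (HA0 : tA u' = tconst 0).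
{ transitivity (tmult (tmult h k) (tA u')); [rewrite Hhk; ring|].
  transitivity (tmult h (tmult k (tA u'))); [ring|rewrite Heig; ring]. }
pose proof (tA_eq_0 u' HA0) as Ec.
rewrite Eu, Ec, tint_scal in Hcen; set (c := coef u' _) in *.
replace c with (RtoC 0) in Ec; [easy|].
replace c with (Cmult (Cmult c (tint (tmult h h))) (Cinv (tint (tmult h h))))
  by (field; apply tint_rho_neq_0).
rewrite Hcen; ring.
Qed.

End Variational.

(** * The Dirac operator of a conformally flat metric *)

Section ConformalDirac.

Context (h : sfield) (Hs : smooth h) (Hpos : forall x y, 0 < h x y).

Lemma partial_conf_metric i j l : partial i (conf_metric h j l) =
  fun x y => if axis_eqb j l then 4 * h x y ^ 3 * partial i h x y else 0.
Proof.
pose proof (smooth_derivable2 h Hs) as D.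
unfold conf_metric; destruct (axis_eqb j l); [|apply partial_const].
replace (fun x y => h x y ^ 4) with (fun x y => (h x y * h x y) * (h x y * h x y))
  by (apply functional_extensionality; intros x; apply functional_extensionality; intros y; ring).
assert (D2 : derivable2 (fun x y => h x y * h x y)) by now apply smooth_derivable2, smooth_mult.
rewrite (partial_mult i (fun x y => h x y * h x y)), partial_mult by easy.
apply functional_extensionality; intros x; apply functional_extensionality; intros y; ring.
Qed.

Lemma partial_conf_frame i a b : partial i (conf_frame h a b) =
  fun x y => if axis_eqb a b then - 2 * partial i h x y / h x y ^ 3 else 0.
Proof.
pose proof (smooth_derivable2 h Hs) as D.
assert (Hn : forall x y, h x y <> 0) by (intros x y; pose proof (Hpos x y); lra).
unfold conf_frame; destruct (axis_eqb a b); [|apply partial_const].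
assert (D2 : derivable2 (fun x y => / h x y)) by now apply smooth_derivable2, smooth_inv.
replace (fun x y => / h x y ^ 2) with (fun x y => / h x y * / h x y)
  by (apply functional_extensionality; intros x; apply functional_extensionality; intros y;
      field; apply Hn).
rewrite partial_mult, partial_inv by easy.
apply functional_extensionality; intros x; apply functional_extensionality; intros y.
field; apply Hn.
Qed.

(** For [g = e^(2 phi) g_o] the connection form of the rescaled frame is given by the
    rotated gradient of [phi]; here [phi = 2 ln h]. *)
Lemma conf_connection_form a x y :
  inner (conf_metric h) (levi_civita (conf_metric h) (conf_frame h a) (conf_frame h ax1))
    (conf_frame h ax2) x y =
  match a with
  | ax1 => - 2 * partial ax2 h x y / h x y ^ 3
  | ax2 => 2 * partial ax1 h x y / h x y ^ 3
  end.
Proof.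
pose proof (Hpos x y).
unfold inner, levi_civita, christoffel, sum_axis.
rewrite !partial_conf_metric, !partial_conf_frame.
unfold inv_metric, metric_det, conf_metric, conf_frame; destruct a; simpl; field; lra.
Qed.

(** Conformal covariance: the right side is [h^-3 D_o (h psi)] with the product [h psi]
    differentiated by the Leibniz rule. *)
Lemma conf_dirac_formula psi x y : conf_dirac h psi x y =
  (Cmult (RtoC (/ h x y ^ 3))
     (Cminus
       (Cmult Ci (Cplus (Cmult (RtoC (partial ax1 h x y)) (snd (psi x y)))
          (Cmult (RtoC (h x y)) (Cpartial ax1 (fun u v => snd (psi u v)) x y))))
       (Cplus (Cmult (RtoC (partial ax2 h x y)) (snd (psi x y)))
          (Cmult (RtoC (h x y)) (Cpartial ax2 (fun u v => snd (psi u v)) x y)))),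
   Cmult (RtoC (/ h x y ^ 3))
     (Cplus
       (Cmult Ci (Cplus (Cmult (RtoC (partial ax1 h x y)) (fst (psi x y)))
          (Cmult (RtoC (h x y)) (Cpartial ax1 (fun u v => fst (psi u v)) x y))))
       (Cplus (Cmult (RtoC (partial ax2 h x y)) (fst (psi x y)))
          (Cmult (RtoC (h x y)) (Cpartial ax2 (fun u v => fst (psi u v)) x y))))).
Proof.
unfold conf_dirac, dirac, spin_connection; rewrite !conf_connection_form.
pose proof (Hpos x y); unfold conf_frame, sp_partial.
simpl axis_eqb; cbv iota.
destruct (psi x y) as [[a b] [c d]]; simpl fst; simpl snd.
generalize (Cpartial ax1 (fun u v => fst (psi u v)) x y); intros [f1 f2].
generalize (Cpartial ax2 (fun u v => fst (psi u v)) x y); intros [f3 f4].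
generalize (Cpartial ax1 (fun u v => snd (psi u v)) x y); intros [g1 g2].
generalize (Cpartial ax2 (fun u v => snd (psi u v)) x y); intros [g3 g4].
generalize (partial ax1 h x y) (partial ax2 h x y); intros p q.
generalize dependent (h x y); intros r Hr.
unfold sp_plus, sp_scal, clifford, Cplus, Cmult, Cminus, Copp, Ci, RtoC; simpl.
apply injective_projections; apply injective_projections; simpl; field; lra.
Qed.

End ConformalDirac.

Definition tpair (f g : tfun) : spfield := fun x y => (f x y, g x y).

Lemma trivial_section_tpair f g : trivial_section v1 v2 (tpair f g).
Proof.
split; [split; simpl; apply ev_smooth|]; intros x y.
destruct (ev_periodic f x y) as [F1 F2], (ev_periodic g x y) as [G1 G2].
unfold shift, tpair, sp_scal, spin_sign in *; simpl; rewrite F1, F2, G1, G2.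
now rewrite !Cmult_1_l.
Qed.

Lemma trivial_section_inv psi : trivial_section v1 v2 psi ->
  exists f g : tfun, psi = tpair f g.
Proof.
intros [[Hf Hg] Hp].
assert (Hp' : forall x y, shift v1 psi x y = psi x y /\ shift v2 psi x y = psi x y).
{ intros x y; destruct (Hp x y) as [-> ->]; unfold sp_scal, spin_sign.
  rewrite !Cmult_1_l; destruct (psi x y); easy. }
unshelve eexists (Tfun (fun x y => fst (psi x y)) Hf _), (Tfun (fun x y => snd (psi x y)) Hg _).
- intros x y; destruct (Hp' x y) as [H1 H2].
  exact (conj (f_equal fst H1) (f_equal fst H2)).
- intros x y; destruct (Hp' x y) as [H1 H2].
  exact (conj (f_equal snd H1) (f_equal snd H2)).
- apply functional_extensionality; intros x; apply functional_extensionality; intros y.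
  unfold tpair; simpl; apply surjective_pairing.
Qed.

Lemma tpair_inj f g f' g' : (forall x y, tpair f g x y = tpair f' g' x y) -> f = f' /\ g = g'.
Proof.
intros H; split; apply tfun_ext; intros x y; specialize (H x y); now injection H.
Qed.

Lemma tB_eq_0 (u : tfun) : tB u = tconst 0 -> exists c, u = tconst c.
Proof.
intros H.
assert (E : tA (tconj u) = tconst 0).
{ rewrite <- (tconj_conj (tA (tconj u))), tconj_tA, tconj_conj, H, tconj_opp, tconj_const.
  replace (Cconj 0) with (RtoC 0) by (apply C_ext; simpl; ring); ring. }
apply tA_eq_0 in E; set (c := coef _ _) in E; exists (Cconj c).
now rewrite <- tconj_const, <- E, tconj_conj.
Qed.

Section ConformalClass.

Context (h : sfield) (Hs : smooth h) (Hp : periodic v1 v2 h) (Hpos : forall x y, 0 < h x y).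

Lemma periodic_inv : periodic v1 v2 (fun x y => / h x y).
Proof. intros x y; destruct (Hp x y) as [H1 H2]; unfold shift in *; now rewrite H1, H2. Qed.

Lemma conf_pos_neq_0 x y : h x y <> 0.
Proof. specialize (Hpos x y); lra. Qed.

Definition th : tfun := treal h Hs Hp.
Definition tk : tfun := treal _ (smooth_inv h Hs conf_pos_neq_0) periodic_inv.

Lemma tconj_th : tconj th = th.
Proof. apply tfun_ext; intros; apply C_ext; simpl; ring. Qed.

Lemma tconj_tk : tconj tk = tk.
Proof. apply tfun_ext; intros; apply C_ext; simpl; ring. Qed.

Lemma th_tk : tmult th tk = tconst 1.
Proof.
apply tfun_ext; intros x y; apply C_ext; simpl; [|ring].
field; apply conf_pos_neq_0.
Qed.

Lemma th_tk_l f : tmult th (tmult tk f) = f.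
Proof. transitivity (tmult (tmult th tk) f); [ring|rewrite th_tk; ring]. Qed.

Lemma tk_th_l f : tmult tk (tmult th f) = f.
Proof. transitivity (tmult (tmult th tk) f); [ring|rewrite th_tk; ring]. Qed.

Lemma tpartial_th i x y : tpartial i th x y = RtoC (partial i h x y).
Proof. simpl; unfold Cpartial, RtoC; simpl; now rewrite partial_const. Qed.

Lemma conf_dirac_tpair f g : conf_dirac h (tpair f g) =
  tpair (tmult (tmult tk (tmult tk tk)) (tB (tmult th g)))
        (tmult (tmult tk (tmult tk tk)) (tA (tmult th f))).
Proof.
apply functional_extensionality; intros x; apply functional_extensionality; intros y.
rewrite (conf_dirac_formula h Hs Hpos).
rewrite tB_mult, tA_mult; unfold tA, tB.
assert (Hk : RtoC (/ h x y ^ 3) = tmult tk (tmult tk tk) x y).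
{ pose proof (conf_pos_neq_0 x y); apply C_ext; simpl; field; easy. }
rewrite Hk; unfold tpair.
change (Cpartial ax1 (fun u v => fst (f u v, g u v)) x y) with (tpartial ax1 f x y).
change (Cpartial ax2 (fun u v => fst (f u v, g u v)) x y) with (tpartial ax2 f x y).
change (Cpartial ax1 (fun u v => snd (f u v, g u v)) x y) with (tpartial ax1 g x y).
change (Cpartial ax2 (fun u v => snd (f u v, g u v)) x y) with (tpartial ax2 g x y).
rewrite <- !tpartial_th.
change (RtoC (h x y)) with (th x y).
generalize (tmult tk (tmult tk tk)); intros k3.
generalize (tpartial ax1 th) (tpartial ax2 th) (tpartial ax1 f) (tpartial ax2 f)
  (tpartial ax1 g) (tpartial ax2 g) th; intros h1 h2 f1 f2 g1 g2 h0.
unfold tminus; simpl; f_equal; ring.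
Qed.

Lemma conf_dirac_sq_tpair f g : conf_dirac_sq h (tpair f g) =
  tpair (tmult (tmult tk (tmult tk tk)) (tB (tmult (tmult tk tk) (tA (tmult th f)))))
        (tmult (tmult tk (tmult tk tk)) (tA (tmult (tmult tk tk) (tB (tmult th g))))).
Proof.
assert (E : forall u, tmult th (tmult (tmult tk (tmult tk tk)) u) = tmult (tmult tk tk) u).
{ intros u; transitivity (tmult th (tmult tk (tmult (tmult tk tk) u))); [ring|apply th_tk_l]. }
unfold conf_dirac_sq; now rewrite !conf_dirac_tpair, !E.
Qed.

(** A basis is given by [(1 / h, 0)] and [(0, 1 / h)]. *)
Lemma conf_kernel_dim : has_complex_dim (kernel (trivial_section v1 v2) (conf_dirac h)) 2.
Proof.
exists (fun n => match n with O => tpair tk (tconst 0) | _ => tpair (tconst 0) tk end).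
assert (Hlin : forall c, lin_comb 2 c (fun n => match n with O => tpair tk (tconst 0)
     | _ => tpair (tconst 0) tk end) = tpair (tmult (tconst (c 0%nat)) tk) (tmult (tconst (c 1%nat)) tk)).
{ intros c; apply functional_extensionality; intros x; apply functional_extensionality; intros y.
  unfold lin_comb, sp_plus, sp_scal, sp_zero, tpair; simpl; f_equal; ring. }
split.
- intros c Hc; rewrite Hlin in Hc.
  destruct (tpair_inj _ _ (tconst 0) (tconst 0) Hc) as [H0 H1].
  assert (H : forall z, tmult (tconst z) tk = tconst 0 -> z = RtoC 0).
  { intros z Hz; apply (f_equal (tmult th)) in Hz.
    rewrite <- (tint_const z), <- (tint_const 0).
    f_equal; transitivity (tmult th (tmult (tconst z) tk)); [|rewrite Hz; ring].
    transitivity (tmult (tconst z) (tmult th tk)); [rewrite th_tk; ring|ring]. }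
  intros [|[|n]] Hn; [now apply H|now apply H|lia].
- intros psi; split.
  + intros [Hsec H0]; destruct (trivial_section_inv psi Hsec) as (f & g & ->).
    rewrite conf_dirac_tpair in H0.
    destruct (tpair_inj _ _ (tconst 0) (tconst 0) H0) as [E1 E2].
    assert (Hcancel : forall u, tmult (tmult tk (tmult tk tk)) u = tconst 0 -> u = tconst 0).
    { intros u Hu; rewrite <- (th_tk_l u), <- (th_tk_l (tmult tk u)), <- (th_tk_l (tmult tk (tmult tk u))).
      replace (tmult tk (tmult tk (tmult tk u))) with (tconst 0) by (rewrite <- Hu; ring).
      ring. }
    apply Hcancel in E1; apply Hcancel in E2.
    apply tB_eq_0 in E1; destruct E1 as [c1 E1].
    apply tA_eq_0 in E2; set (c0 := coef _ _) in E2.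
    exists (fun n => match n with O => c0 | _ => c1 end); intros x y; rewrite Hlin.
    rewrite <- E1, <- E2; f_equal; f_equal; [rewrite <- (tk_th_l f) at 1|rewrite <- (tk_th_l g) at 1]; ring.
  + intros [c Hc].
    assert (E : psi = tpair (tmult (tconst (c 0%nat)) tk) (tmult (tconst (c 1%nat)) tk)).
    { rewrite <- Hlin; apply functional_extensionality; intros x; apply functional_extensionality; intros y.
      apply Hc. }
    rewrite E; split; [apply trivial_section_tpair|].
    rewrite conf_dirac_tpair.
    assert (Ec : forall z, tmult th (tmult (tconst z) tk) = tconst z).
    { intros z; transitivity (tmult (tconst z) (tmult th tk)); [ring|rewrite th_tk; ring]. }
    rewrite !Ec, tA_const, tB_const.
    intros x y; unfold tpair, sp_zero; simpl; f_equal; ring.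
Qed.

Lemma eigenpair_conf lam u :
  tmult (tmult tk (tmult tk tk)) (tB (tmult (tmult tk tk) (tA u))) =
    tmult (tconst (RtoC lam)) (tmult tk u) <-> eigenpair th tk lam u.
Proof.
unfold eigenpair; split; intros H.
- rewrite <- (th_tk_l (tB _)), <- (th_tk_l (tmult tk (tB _))), <- (th_tk_l (tmult tk (tmult tk (tB _)))).
  replace (tmult tk (tmult tk (tmult tk (tB (tmult (tmult tk tk) (tA u))))))
    with (tmult (tmult tk (tmult tk tk)) (tB (tmult (tmult tk tk) (tA u)))) by ring.
  rewrite H.
  transitivity (tmult th (tmult tk (tmult (tconst (RtoC lam)) (tmult (tmult th th) u)))); [ring|apply th_tk_l].
- rewrite H.
  transitivity (tmult th (tmult tk (tmult th (tmult tk (tmult (tconst (RtoC lam)) (tmult tk u)))))); [ring|].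
  now rewrite !th_tk_l.
Qed.

(** Conjugation exchanges [A] and [- B]. *)
Lemma eigenpair_conf_conj lam u :
  tmult (tmult tk (tmult tk tk)) (tA (tmult (tmult tk tk) (tB u))) =
    tmult (tconst (RtoC lam)) (tmult tk u) -> eigenpair th tk lam (tconj u).
Proof.
intros H; apply eigenpair_conf; apply (f_equal tconj) in H.
rewrite !tconj_mult, tconj_tA, tconj_const, tconj_tk, tconj_mult, tconj_mult, tconj_tk in H.
replace (Cconj lam) with (RtoC lam) in H by (apply C_ext; simpl; ring).
rewrite <- H.
replace (tconj (tB u)) with (topp (tA (tconj u))).
- replace (tmult (tmult tk tk) (topp (tA (tconj u))))
    with (tmult (tconst (Copp 1)) (tmult (tmult tk tk) (tA (tconj u)))) by (rewrite tconst_opp; ring).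
  rewrite tB_scal, tconst_opp; ring.
- rewrite <- (tconj_conj (tA (tconj u))), tconj_tA, tconj_conj, tconj_opp; ring.
Qed.

(** [D^2] preserves the two components, so an eigenspinor has an eigenfunction in one of
    them; conversely [(u / h, 0)] is an eigenspinor. *)
Lemma conf_eigenvalue_iff lam :
  is_eigenvalue (trivial_section v1 v2) (conf_dirac_sq h) lam <->
  exists u, u <> tconst 0 /\ eigenpair th tk lam u.
Proof.
split.
- intros (psi & Hsec & (x & y & Hne) & Heq).
  destruct (trivial_section_inv psi Hsec) as (f & g & ->).
  rewrite conf_dirac_sq_tpair in Heq.
  assert (Heq' : forall x y, tpair
     (tmult (tmult tk (tmult tk tk)) (tB (tmult (tmult tk tk) (tA (tmult th f)))))
     (tmult (tmult tk (tmult tk tk)) (tA (tmult (tmult tk tk) (tB (tmult th g))))) x y =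
     tpair (tmult (tconst (RtoC lam)) f) (tmult (tconst (RtoC lam)) g) x y) by exact Heq.
  apply tpair_inj in Heq' as [E1 E2].
  rewrite <- (tk_th_l f) in E1 at 2; rewrite <- (tk_th_l g) in E2 at 2.
  assert (Hth : forall f, tmult th f = tconst 0 -> f = tconst 0).
  { intros u Hu; rewrite <- (tk_th_l u), Hu; ring. }
  destruct (excluded_middle_informative (f = tconst 0)) as [Ef|Ef].
  + exists (tconj (tmult th g)); split; [|now apply eigenpair_conf_conj].
    intros E; apply Hne.
    assert (Eg : g = tconst 0).
    { apply Hth; rewrite <- (tconj_conj (tmult th g)), E, tconj_const.
      f_equal; apply C_ext; simpl; ring. }
    now rewrite Ef, Eg.
  + exists (tmult th f); split; [|now apply eigenpair_conf].
    intros E; now apply Ef, Hth.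
- intros (u & Hne & Hu).
  exists (tpair (tmult tk u) (tconst 0)); split; [apply trivial_section_tpair|split].
  + apply NNPP; intros Hn; apply Hne.
    rewrite <- (th_tk_l u).
    replace (tmult tk u) with (tconst 0); [ring|].
    apply tfun_ext; intros x y; apply NNPP; intros Hxy; apply Hn; exists x, y.
    intros E; apply Hxy; exact (eq_sym (f_equal fst E)).
  + intros x y; rewrite conf_dirac_sq_tpair, th_tk_l.
    apply eigenpair_conf in Hu; rewrite Hu.
    replace (tmult th (tconst 0)) with (tconst 0) by ring.
    rewrite tB_const.
    replace (tmult (tmult tk tk) (tconst 0)) with (tconst 0) by ring.
    rewrite tA_const; unfold tpair, sp_scal; simpl; f_equal; ring.
Qed.

(** An eigenfunction for [mu > 0] is centred and has energy [mu] times its mass, so the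
    Poincare constant [lam] is at most [mu]. *)
Lemma conf_first_eigenvalue : exists lam,
  is_first_positive_eigenvalue (trivial_section v1 v2) (conf_dirac_sq h) lam /\
  forall v, centred th v -> lam * mass th v <= energy tk v.
Proof.
destruct (first_eigenvalue th tk tconj_th tconj_tk th_tk) as (lam & u & Hlam & Hu & Heig & Hmin).
exists lam; split; [|easy]; split; [easy|split].
- apply conf_eigenvalue_iff; now exists u.
- intros mu Hmu Hev; apply conf_eigenvalue_iff in Hev; destruct Hev as (v & Hv & Ev).
  assert (Hc : centred th v) by (apply (eigenpair_centred th tk mu); [lra|easy]).
  specialize (Hmin v Hc); rewrite (eigenpair_energy th tk tconj_th tconj_tk mu v Ev) in Hmin.
  assert (Hm : 0 < mass th v).
  { destruct (Rle_lt_or_eq_dec 0 (mass th v)) as [|E]; [apply tnsq_nonneg|easy|exfalso].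
    apply Hv, (mass_eq_0 th tk th_tk); now rewrite <- E. }
  now apply Rmult_le_reg_r in Hmin.
Qed.

End ConformalClass.

(** * The test spinor *)

(** Compare the Fourier coefficients of both sides at a frequency where [u] has a nonzero
    one: the equation multiplies it by [|symbol xi|^2]. *)
Lemma flat_eigenpair_symbol (h k u : tfun) lam : h = tconst 1 -> k = tconst 1 ->
  u <> tconst 0 -> eigenpair h k lam u ->
  exists xi, lam = Cmod (symbol xi) ^ 2.
Proof.
intros -> -> Hu H; unfold eigenpair in H.
assert (Hc : exists xi, coef u xi <> RtoC 0).
{ apply NNPP; intros Hn; apply Hu, (tfun_ext_coef); intros xi.
  transitivity (RtoC 0).
  - apply NNPP; intros Hxi; apply Hn; now exists xi.
  - unfold coef; rewrite tconst_0_l, tint_const; easy. }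
destruct Hc as [xi Hxi]; exists xi.
apply (f_equal (fun f => coef f xi)) in H.
replace (tmult (tmult (tconst 1) (tconst 1)) (tA u)) with (tA u) in H by ring.
replace (tmult (tmult (tconst 1) (tconst 1)) u) with u in H by ring.
rewrite coef_scal in H.
unfold coef at 1 in H; rewrite tint_tB_parts, tB_tchar, symbol_kopp in H by easy.
replace (tmult (tA u) (tmult (tconst (Cconj (Copp (symbol xi)))) (tchar (kopp xi)))) with
  (tmult (tconst (Cconj (Copp (symbol xi)))) (tmult (tA u) (tchar (kopp xi)))) in H by ring.
rewrite tint_scal in H; change (tint (tmult (tA u) (tchar (kopp xi)))) with (coef (tA u) xi) in H.
rewrite coef_tA in H.
assert (E : Cmult (Cminus (Cmult (symbol xi) (Cconj (symbol xi))) (RtoC lam)) (coef u xi) = RtoC 0).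
{ replace (Cmult (Cminus (Cmult (symbol xi) (Cconj (symbol xi))) (RtoC lam)) (coef u xi)) with
    (Cminus (Copp (Cmult (Cconj (Copp (symbol xi))) (Cmult (symbol xi) (coef u xi))))
            (Cmult (RtoC lam) (coef u xi))) by (rewrite Copp_conj; ring).
  rewrite H; ring. }
assert (E' : Cminus (Cmult (symbol xi) (Cconj (symbol xi))) (RtoC lam) = RtoC 0).
{ set (z := Cminus _ _) in *.
  replace z with (Cmult (Cmult z (coef u xi)) (Cinv (coef u xi))) by (field; easy).
  rewrite E; ring. }
apply (f_equal fst) in E'; rewrite Cmod_sq; simpl in *; lra.
Qed.

(** As [A k = - k^2 A h], the function [k A (k^2 e)] is [e] times
    [symbol xi * k^3 - 2 k^4 A h].  The mixed term of its square is a multiple of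
    [k^7 A h], which integrates to zero because it is proportional to [A (k^6)]. *)
Lemma test_function_energy (h k : tfun) xi : tconj h = h -> tconj k = k -> tmult h k = tconst 1 ->
  energy k (tmult (tmult k k) (tchar xi)) =
  Cmod (symbol xi) ^ 2 * tnsq (tmult k (tmult k k)) +
  4 * tnsq (tmult (tmult (tmult k k) (tmult k k)) (tA h)).
Proof.
intros Hh Hk Hhk; unfold energy.
assert (EA : tA k = topp (tmult (tmult k k) (tA h))).
{ pose proof (f_equal tA Hhk) as H; rewrite tA_mult, tA_const in H.
  transitivity (tmult (tmult h k) (tA k)); [rewrite Hhk; ring|].
  transitivity (tmult k (tminus (tplus (tmult (tA h) k) (tmult h (tA k))) (tmult (tA h) k))); [ring|].
  rewrite H; ring. }
set (a := tmult (tconst (symbol xi)) (tmult k (tmult k k))).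
set (b := tmult (tmult (tmult k k) (tmult k k)) (tA h)).
replace (tmult k (tA (tmult (tmult k k) (tchar xi)))) with
  (tmult (tplus a (tmult (tconst (Copp (Cplus 1 1))) b)) (tchar xi)).
2: { rewrite !tA_mult, tA_tchar, EA, tconst_opp, tconst_plus; unfold a, b; ring. }
rewrite tnsq_mult_tchar, tnsq_expand.
assert (H0 : tip a b = RtoC 0).
{ unfold a, b; rewrite tip_scal_l, tip_conj.
  set (k3 := tmult k (tmult k k)).
  assert (H6 : tA (tmult k3 k3) = tmult (tconst (Copp 6))
    (tmult (tmult (tmult (tmult k k) (tmult k k)) (tA h)) (tconj k3))).
  { unfold k3; rewrite !tconj_mult, Hk, !tA_mult, EA, tconst_opp.
    replace (RtoC 6) with (Cplus (Cplus (Cplus 1 1) (Cplus 1 1)) (Cplus 1 1))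
      by (apply C_ext; simpl; ring).
    rewrite !tconst_plus; ring. }
  apply (f_equal tint) in H6; rewrite tint_tA, tint_scal in H6 by easy.
  fold (tip (tmult (tmult (tmult k k) (tmult k k)) (tA h)) k3) in H6.
  set (z := tip _ k3) in *.
  replace z with (Cmult (Cinv (Copp 6)) (Cmult (Copp 6) z)).
  - rewrite <- H6; apply C_ext; simpl; ring.
  - field; intros E; apply (f_equal fst) in E; simpl in E; lra. }
rewrite H0; unfold a; rewrite tnsq_scal.
replace (Cmod (Copp (Cplus 1 1)) ^ 2) with 4 by (rewrite Cmod_sq; simpl; ring).
simpl; ring.
Qed.

Lemma test_function_centred (h k : tfun) xi : tmult h k = tconst 1 ->
  xi <> (0, 0)%Z -> centred h (tmult (tmult k k) (tchar xi)).
Proof.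
intros Hhk Hxi; unfold centred.
replace (tmult (tmult h h) (tmult (tmult k k) (tchar xi))) with
  (tmult (tmult (tmult h k) (tmult h k)) (tchar xi)) by ring.
rewrite Hhk.
replace (tmult (tmult (tconst 1) (tconst 1)) (tchar xi)) with
  (tmult (tchar xi) (tchar (kopp (0, 0)%Z))) by (change (kopp (0, 0)%Z) with (0, 0)%Z; rewrite tchar_0; ring).
change (coef (tchar xi) (0, 0)%Z = RtoC 0); rewrite coef_tchar.
destruct Nat.eq_dec as [E|]; [|easy].
now apply (f_equal dual) in E; rewrite !dual_rank in E.
Qed.

Lemma test_function_mass (h k : tfun) xi : tmult h k = tconst 1 ->
  mass h (tmult (tmult k k) (tchar xi)) = tnsq k.
Proof.
intros Hhk; unfold mass.
rewrite <- (tnsq_mult_tchar k xi); f_equal.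
transitivity (tmult (tmult h k) (tmult k (tchar xi))); [ring|rewrite Hhk; ring].
Qed.

Lemma torus_int_re (F : tfun) (f : sfield) : (forall x y, fst (F x y) = f x y) ->
  torus_int v1 v2 f = Rabs (det2 v1 v2) * fst (tint F).
Proof.
intros H; replace f with (fun x y => fst (F x y)); [easy|].
apply functional_extensionality; intros x; apply functional_extensionality; intros y; apply H.
Qed.

End Torus.

Theorem theorem3 (v1 v2 : R * R) (Hbasis : det2 v1 v2 <> 0)
  (h : R -> R -> R) (Hsmooth : smooth h) (Hper : periodic v1 v2 h)
  (Hpos : forall x y : R, 0 < h x y) :
  has_complex_dim (kernel (trivial_section v1 v2) (conf_dirac h)) 2 /\
  exists lam_o lam : R,
    is_first_positive_eigenvalue (trivial_section v1 v2)
      (conf_dirac_sq flat_factor) lam_o /\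
    is_first_positive_eigenvalue (trivial_section v1 v2)
      (conf_dirac_sq h) lam /\
    lam <=
      torus_int v1 v2 (fun x y =>
        (lam_o + 4 / h x y ^ 2 * flat_grad_sq h x y) * (1 / h x y ^ 6))
      / torus_int v1 v2 (fun x y => 1 / h x y ^ 2).
Proof.
split; [exact (conf_kernel_dim Hbasis h Hsmooth Hper Hpos)|].
assert (H1s : smooth flat_factor) by exact (smooth_const 1).
assert (H1p : periodic v1 v2 flat_factor) by (intros x y; now split).
assert (H1pos : forall x y, 0 < flat_factor x y) by (intros; unfold flat_factor; lra).
destruct (conf_first_eigenvalue Hbasis flat_factor H1s H1p H1pos) as (lam_o & Hlam_o & _).
destruct (conf_first_eigenvalue Hbasis h Hsmooth Hper Hpos) as (lam & Hlam & Hmin).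
exists lam_o, lam; split; [easy|split; [easy|]].
set (H := th h Hsmooth Hper) in *.
set (K := tk h Hsmooth Hper Hpos) in *.
assert (HHK : tmult H K = tconst 1) by apply th_tk.
assert (Hxi : exists xi, lam_o = Cmod (@symbol v1 v2 xi) ^ 2).
{ destruct Hlam_o as (_ & Hev & _).
  apply (conf_eigenvalue_iff flat_factor H1s H1p H1pos) in Hev.
  destruct Hev as (u & Hu & Heig).
  apply (flat_eigenpair_symbol Hbasis _ _ u lam_o) in Heig; try easy.
  - now apply tfun_ext.
  - apply tfun_ext; intros x y; simpl; unfold flat_factor; now rewrite Rinv_1. }
destruct Hxi as [xi Exi].
assert (Hxi0 : xi <> (0, 0)%Z).
{ intros ->; destruct Hlam_o as (Hp & _).
  rewrite Exi, Cmod_sq in Hp; unfold symbol, freq in Hp; simpl in Hp; unfold Rdiv in Hp.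
  rewrite !Rmult_0_l in Hp; lra || nra. }
specialize (Hmin _ (test_function_centred Hbasis H K xi HHK Hxi0)).
rewrite (test_function_energy Hbasis H K xi) in Hmin; try easy;
  [|apply tconj_th|apply tconj_tk].
rewrite (test_function_mass Hbasis H K xi HHK), <- Exi in Hmin.
set (k3 := tmult K (tmult K K)) in *.
set (b := tmult (tmult (tmult K K) (tmult K K)) (tA H)) in *.
assert (Hd : 0 < Rabs (det2 v1 v2)) by now apply Rabs_pos_lt.
assert (Hn : forall x y, h x y <> 0) by (intros x y; pose proof (Hpos x y); lra).
rewrite (torus_int_re (tplus (tmult (tconst (RtoC lam_o)) (tmult k3 (tconj k3)))
  (tmult (tconst (RtoC 4)) (tmult b (tconj b))))).
2: { intros x y.
  assert (HA : tA H x y = (partial ax2 h x y, partial ax1 h x y)).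
  { change (tA H x y) with (Cplus (Cmult Ci (tpartial ax1 H x y)) (tpartial ax2 H x y)).
    unfold H; rewrite !tpartial_th; apply C_ext; simpl fst; simpl snd; ring. }
  assert (Eb : b x y = (/ h x y ^ 4 * partial ax2 h x y, / h x y ^ 4 * partial ax1 h x y)).
  { change (b x y) with (Cmult (Cmult (Cmult (K x y) (K x y)) (Cmult (K x y) (K x y))) (tA H x y)).
    rewrite HA; specialize (Hn x y); apply C_ext; simpl; field; easy. }
  assert (E3 : k3 x y = RtoC (/ h x y ^ 3)).
  { specialize (Hn x y); apply C_ext; simpl; field; easy. }
  change (fst (Cplus (Cmult (RtoC lam_o) (Cmult (k3 x y) (Cconj (k3 x y))))
    (Cmult (RtoC 4) (Cmult (b x y) (Cconj (b x y))))) =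
    (lam_o + 4 / h x y ^ 2 * flat_grad_sq h x y) * (1 / h x y ^ 6)).
  rewrite Eb, E3; unfold flat_grad_sq, sum_axis; specialize (Hn x y); simpl; field; easy. }
rewrite (torus_int_re (tmult K (tconj K))).
2: { intros x y; specialize (Hn x y); simpl; field; easy. }
rewrite tint_plus, !tint_scal.
change (tint (tmult K (tconj K))) with (tip K K).
change (tint (tmult k3 (tconj k3))) with (tip k3 k3).
change (tint (tmult b (tconj b))) with (tip b b).
rewrite !tip_self.
assert (HK : 0 < tnsq K).
{ destruct (Rle_lt_or_eq_dec 0 (tnsq K)) as [|E]; [apply tnsq_nonneg|easy|exfalso].
  symmetry in E; apply (tnsq_eq_0 Hbasis) in E; rewrite E in HHK.
  apply (f_equal (fun f => fst (ev f 0 0))) in HHK; simpl in HHK; lra. }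
simpl fst.
apply Rmult_le_reg_r with (Rabs (det2 v1 v2) * tnsq K); [now apply Rmult_lt_0_compat|].
unfold Rdiv; rewrite Rmult_assoc, Rinv_l, Rmult_1_r by (apply Rgt_not_eq; now apply Rmult_lt_0_compat).
nra.
Qed.
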